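(* Let $d\ge 2$ be a fixed integer. For every sequence $(G_n)$ of finite abelian groups of odd orders $N_n\to\infty$, with $M_n=(N_n-1)/2$, the point processes $$\Xi_n=\sum_{[x]\in (G_n\setminus\{0\})/\{\pm1\}}\delta_{Z_{n,[x]}},\qquad Z_{n,[x]}=\frac{N_n^{d-1}}{d!}\,\tau_{G_n,[x]}^{\,d}-\log M_n,$$ converge in distribution, in the space of locally finite point measures on $\mathbb R$ with the vague topology, to the Poisson point process on $\mathbb R$ with intensity measure $e^{-z}\,dz$.
   Context: For a finite abelian group $G$ (written additively) of odd order $N$, let $\mathcal Q_G=(G\setminus\{0\})/\{\pm1\}$ be the set of inversion classes $[a]=\{a,-a\}$; since $N$ is odd, each class has two elements and $|\mathcal Q_G|=M=(N-1)/2$. Let $(T_\xi)_{\xi\in\mathcal Q_G}$ be independent random variables uniform on $[0,1]$. The class $\xi$ is called active at time $r$ if $T_\xi\le r$. The random graph $\Gamma_G^*(r)$ is the undirected Cayley graph on vertex set $G$ whose connection set is the union of all classes active at time $r$. Distances in a graph are graph distances (infinite between different components). For $[x]\in\mathcal Q_G$, the first distance-$d$ coverage time is $$\tau_{G,[x]}=\inf\{r:\operatorname{dist}_{\Gamma_G^*(r)}(0,x)\le d\},$$ which does not depend on the choice of representative $x$ of the class. *)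

(* Defs.v *)
From HB Require Import structures.
From mathcomp Require Import all_boot all_order all_algebra.
From mathcomp Require Import all_classical all_reals all_analysis.
From mathcomp Require Import measurable_realfun.

Set Implicit Arguments.
Unset Strict Implicit.
Unset Printing Implicit Defensive.

Import Order.TTheory GRing.Theory Num.Theory.
Import numFieldNormedType.Exports.

Local Open Scope classical_set_scope.
Local Open Scope ring_scope.

Section InversionClasses.
Variable G : finZmodType.

Definition inv_class (a : G) : {set G} := [set a; - a]%SET.

Definition inv_classes : {set {set G}} := (inv_class @: [set~ 0])%SET.

Definition invQ : Type := {xi : {set G} | xi \in inv_classes}.

Definition class_repr (xi : invQ) : G := odflt 0 [pick x in val xi].

Lemma invQP (xi : invQ) : exists2 a, a != 0 & val xi = inv_class a.
Proof. by case: xi => s /= /imsetP[a]; rewrite !inE => a0 ->; exists a. Qed.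

Lemma invQ_class (a : G) : a != 0 -> exists xi : invQ, val xi = inv_class a.
Proof.
move=> a0; have aQ : inv_class a \in inv_classes by apply: imset_f; rewrite !inE.
by exists (exist (fun s => is_true (s \in inv_classes)) _ aQ).
Qed.

Lemma class_reprP (xi : invQ) : class_repr xi \in val xi.
Proof.
rewrite /class_repr; case: pickP => //= nx.
by have [a _ xia] := invQP xi; have := nx a; rewrite xia !inE eqxx.
Qed.

Lemma invQE (xi : invQ) x : x \in val xi -> val xi = inv_class x /\ x != 0.
Proof.
have [a a0 ->] := invQP xi; rewrite !inE => /orP[] /eqP ->; split => //.
  by rewrite /inv_class opprK finset.setUC.
by rewrite oppr_eq0.
Qed.

End InversionClasses.

(* Distances are extended reals: the infimum over the empty set of walks, i.e.
   the distance between distinct components, is +oo. *)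
Definition gdist (R : realType) (V : finType) (e : rel V) (x y : V) : \bar R :=
  ereal_inf
    [set (size p)%:R%:E | p in [set p : seq V | path e x p /\ last x p = y]].

Definition cayley (G : finZmodType) (S : {set G}) : rel G :=
  fun x y => y - x \in S.

Section Coverage.
Variables (R : realType) (G : finZmodType).
Implicit Types (t : invQ G -> R) (r : R) (xi : invQ G).

Definition conn_set t r : {set G} := (\bigcup_(xi | t xi <= r) val xi)%SET.

Definition Gamma t r : rel G := cayley (conn_set t r).

(* Taken over all real r; for times in [0, 1] nothing is active at r < 0 and
   everything is active at r = 1, so this is the infimum over [0, 1] as well. *)
Definition tau_at (d : nat) t (x : G) : R :=
  inf [set r | (gdist R (Gamma t r) 0%R x <= d%:R%:E)%E].

Definition tau (d : nat) t xi : R := tau_at d t (class_repr xi).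

(* (#|G| - 1) / 2 is the number M of inversion classes. *)
Definition Zcov (d : nat) t xi : R :=
  #|G|%:R ^+ d.-1 / d`!%:R * tau d t xi ^+ d - ln ((#|G|%:R - 1) / 2).

Lemma conn_setN t r x : (- x \in conn_set t r) = (x \in conn_set t r).
Proof.
have H y : y \in conn_set t r -> - y \in conn_set t r.
  case/finset.bigcupP => xi ht yxi; apply/finset.bigcupP; exists xi => //.
  by have [-> _] := invQE yxi; rewrite !inE eqxx orbT.
by apply/idP/idP => /H //; rewrite opprK.
Qed.

Lemma gdist_GammaN t r x : gdist R (Gamma t r) 0 (- x) = gdist R (Gamma t r) 0 x.
Proof.
have pN y p : path (Gamma t r) y p -> path (Gamma t r) (- y) (map -%R p).
  elim: p y => //= z p IH y /andP[h /IH ->]; rewrite andbT.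
  by rewrite /Gamma /cayley -opprD conn_setN.
have H z : (gdist R (Gamma t r) 0%R (- z)%R <= gdist R (Gamma t r) 0%R z)%E.
  apply: le_ereal_inf => _ [p [pp lp] <-]; exists (map -%R p); last by rewrite size_map.
  by split; [rewrite -[X in path _ X]oppr0; exact: pN
            |rewrite -[X in last X]oppr0 last_map lp].
apply: le_anti; apply/andP; split; first exact: H.
by have := H (- x); rewrite opprK.
Qed.

Lemma tau_repr (d : nat) t xi x : x \in val xi -> tau d t xi = tau_at d t x.
Proof.
move=> xxi; rewrite /tau; have := class_reprP xi.
have [-> _] := invQE xxi; rewrite !inE => /orP[] /eqP -> //.
by rewrite /tau_at; under eq_fun do rewrite gdist_GammaN.
Qed.

End Coverage.

Section PointMeasures.
Variable R : realType.

(* A sum of Dirac masses over a finite or countable index set D. *)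
Definition is_point_measure (mu : set R -> \bar R) : Prop :=
  exists (D : set nat) (z : nat -> R), forall B : set R, measurable B ->
    mu B = (\esum_(i in D) \d_(z i) B)%E.

Definition locally_finite (mu : set R -> \bar R) : Prop :=
  forall K : set R, compact K -> (mu K < +oo)%E.

Record point_measure := PointMeasure {
  pm_measure :> {measure set R -> \bar R} ;
  pm_point : is_point_measure pm_measure ;
  pm_locally_finite : locally_finite pm_measure }.

HB.instance Definition _ := gen_eqMixin point_measure.
HB.instance Definition _ := gen_choiceMixin point_measure.

Record test_fun := TestFun {
  tf_fun :> R -> R ;
  tf_continuous : continuous tf_fun ;
  tf_compact_support : compact (closure [set x | tf_fun x != 0]) }.

HB.instance Definition _ := gen_eqMixin test_fun.
HB.instance Definition _ := gen_choiceMixin test_fun.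

Definition vague_eval (mu : point_measure) : {ptws test_fun -> R} :=
  fun f => \int[mu]_x f x.

(* The vague topology: the coarsest one making all the maps
   mu |-> \int[mu]_x f x continuous, for f continuous with compact support. *)
HB.instance Definition _ :=
  Topological.copy point_measure (initial_topology vague_eval).

Section FiniteSum.
Variables (I : finType) (z : I -> R).

Definition dirac_sum : set R -> \bar R :=
  fun B => (\sum_(i : I) \d_(z i) B)%E.

Let dirac_sum0 : dirac_sum set0 = 0%E.
Proof. by rewrite /dirac_sum big1. Qed.

Let dirac_sum_ge0 B : (0 <= dirac_sum B)%E.
Proof. by apply: sume_ge0 => i _; exact: measure_ge0. Qed.

Let dirac_sum_sigma_additive : semi_sigma_additive dirac_sum.
Proof.
pose m (k : nat) : {measure set R -> \bar R} :=
  if insub k is Some j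
  then (\d_(z (@enum_val I I j)) : {measure set R -> \bar R})
  else mzero.
have -> : dirac_sum = msum m #|I|.
  apply/funext => B; rewrite /dirac_sum /msum (reindex _ (onW_bij _ (@enum_val_bij I))).
  by apply: eq_bigr => i _; rewrite /m valK.
exact: measure_semi_sigma_additive.
Qed.

HB.instance Definition _ := isMeasure.Build _ _ _
  dirac_sum dirac_sum0 dirac_sum_ge0 dirac_sum_sigma_additive.

Lemma dirac_sum_point : is_point_measure dirac_sum.
Proof.
exists `I_#|I|, (fun k => if insub k is Some j then z (@enum_val I I j) else 0).
move=> B mB; rewrite esum_fset//.
rewrite -fsbig_ord /dirac_sum (reindex _ (onW_bij _ (@enum_val_bij I))).
by apply: eq_bigr => i _; rewrite valK.
Qed.

Lemma dirac_sum_locally_finite : locally_finite dirac_sum.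
Proof. by move=> K _; apply: lte_sum_pinfty => i _; rewrite ltry. Qed.

Definition point_sum : point_measure :=
  PointMeasure dirac_sum_point dirac_sum_locally_finite.

End FiniteSum.

End PointMeasures.

Section Probability.
Variable R : realType.

Definition mutually_independent d d' (Omega : measurableType d)
    (E : measurableType d') (P : probability Omega R)
    (I : finType) (X : I -> Omega -> E) : Prop :=
  forall (J : {set I}) (B : I -> set E), (forall i, measurable (B i)) ->
    P (\bigcap_(i in [set` J]) (X i @^-1` B i)) =
    (\prod_(i in J) P (X i @^-1` B i))%E.

Definition cvg_in_distribution (S : topologicalType)
    (dn : nat -> measure_display) (Omega_ : forall n, measurableType (dn n))
    (P_ : forall n, probability (Omega_ n) R) (X_ : forall n, Omega_ n -> S)
    (d : measure_display) (Omega : measurableType d) (P : probability Omega R)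
    (X : Omega -> S) : Prop :=
  forall F : S -> R, continuous F -> bounded_fun F ->
    ('E_(P_ n)[F \o X_ n])%E @[n --> \oo] --> ('E_P[F \o X])%E.

(* The evaluation maps mu |-> mu B generate the Borel sigma-algebra of the vague
   topology, so this is measurability as a random element of point_measure. *)
Definition is_point_process d (Omega : measurableType d)
    (Xi : Omega -> point_measure R) : Prop :=
  forall B : set R, measurable B -> measurable_fun setT (fun w => Xi w B).

(* In the library's [poisson_prob r k A] the argument [k] is unused. *)
Definition is_poisson_process d (Omega : measurableType d)
    (P : probability Omega R) (lambda : set R -> \bar R)
    (Xi : Omega -> point_measure R) : Prop :=
  [/\ is_point_process Xi,
      forall B : set R, measurable B -> bounded_set B -> forall k : nat,
        P [set w | Xi w B = k%:R%:E] =
        poisson_prob (fine (lambda B)) 0 [set k]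
    & forall (I : finType) (B : I -> set R),
        (forall i, measurable (B i)) -> (forall i, bounded_set (B i)) ->
        trivIset setT B ->
        mutually_independent P (fun i w => Xi w (B i))].

Definition exp_intensity (B : set R) : \bar R :=
  (\int[lebesgue_measure]_(z in B) (expR (- z))%:E)%E.

End Probability.

Section Measurability.
Variables (R : realType) (G : finZmodType) (d : nat).
Hypothesis d_gt0 : (0 < d)%N.
Implicit Types (t : invQ G -> R) (r : R) (xi : invQ G) (x : G).

Let good (S : {set invQ G}) x : bool :=
  (gdist R (cayley (\bigcup_(xi in S) val xi)%SET) 0%R x <= d%:R%:E)%E.

Let goodE t r x :
  (gdist R (Gamma t r) 0%R x <= d%:R%:E)%E = good [set xi | t xi <= r]%SET x.
Proof.
rewrite /good /Gamma /conn_set; congr (gdist R (cayley _) _ _ <= _)%E.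
by apply: eq_bigl => xi; rewrite inE.
Qed.

Let good_sub (S S' : {set invQ G}) x : S \subset S' -> good S x -> good S' x.
Proof.
move=> /fintype.subsetP sS; apply: le_trans; apply: le_ereal_inf => _ [p [pp lp] <-].
exists p => //; split=> //; apply: sub_path pp => y z.
case/finset.bigcupP => xi /sS xiS h; apply/finset.bigcupP; by exists xi.
Qed.

Let good_set0 x : x != 0 -> ~~ good finset.set0 x.
Proof.
move=> x0; rewrite /good /gdist (_ : image _ _ = set0) ?ereal_inf0//.
rewrite -subset0 => _ [[|y p] [/= pp lp] _].
  by rewrite -lp eqxx in x0.
by move: pp; rewrite /cayley big_set0 inE.
Qed.

Let good_setT x : x != 0 -> good finset.setT x.
Proof.
move=> x0; rewrite /good; apply: (@le_trans _ _ (1%:R%:E : \bar R)).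
  apply: ereal_inf_lbound; exists [:: x] => //; split=> //=; rewrite andbT.
  have [q qE] := invQ_class x0.
  have xq : x \in val q by rewrite qE !inE eqxx.
  by rewrite /cayley subr0; apply/finset.bigcupP; exists q; rewrite ?inE.
by rewrite lee_fin ler_nat.
Qed.

Lemma tau_at_lt t x c : x != 0 ->
  tau_at d t x < c <->
  exists2 S : {set invQ G}, good S x & forall xi, xi \in S -> t xi < c.
Proof.
move=> x0; have [q _] := invQ_class x0.
split=> [|[S gS tS]].
  move/inf_lt => /(_ _)[].
    exists (t [arg max_(i > q) t i]%O); rewrite /= goodE.
    rewrite (_ : finset _ = finset.setT) ?good_setT//; apply/setP => xi.
    by rewrite !inE; case: arg_maxP => // j _; apply.
  move=> r /=; rewrite goodE => gr rc; exists [set xi | t xi <= r]%SET => //.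
  by move=> xi; rewrite inE => /le_lt_trans; apply.
have [j jS] : exists j, j \in S.
  apply/set0Pn; apply/eqP => S0.
  by move: gS; rewrite S0 (negbTE (good_set0 x0)).
pose r := t [arg max_(i > j in S) t i]%O.
have rc : r < c by rewrite /r; case: arg_maxP => // i iS _; exact: tS.
apply: le_lt_trans rc; apply: ge_inf.
  exists (t [arg min_(i < q) t i]%O) => s /=; rewrite goodE => gs.
  rewrite leNgt; apply/negP => sm; move: gs; apply/negP.
  rewrite (_ : finset _ = finset.set0) ?good_set0//; apply/setP => xi.
  rewrite !inE; apply/negbTE; rewrite -ltNge; apply: (lt_le_trans sm).
  by case: arg_minP => // i _; apply.
rewrite /= goodE; apply: good_sub gS; apply/fintype.subsetP => xi xiS.
by rewrite inE /r; case: arg_maxP => // i _; apply.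
Qed.

Lemma measurable_tau d' (Omega : measurableType d')
    (T : invQ G -> {mfun Omega >-> R}) xi :
  measurable_fun setT (fun w => tau d (fun eta => T eta w) xi).
Proof.
have [_ x0] := invQE (class_reprP xi).
move=> mD; apply: (measurability _ (RGenInftyO.measurableE R)) => // _ [_ [c ->] <-].
rewrite setTI (_ : _ @^-1` _ = \bigcup_(S in [set S | good S (class_repr xi)])
    \bigcap_(eta in [set` S]) (T eta @^-1` `]-oo, c[)).
  apply: fin_bigcup_measurable => // S _; apply: fin_bigcap_measurable => // eta _.
  by rewrite -[X in measurable X]setTI; exact: measurable_funP.
apply/seteqP; split=> w /=; rewrite in_itv/=.
  by move/(tau_at_lt _ _ x0) => [S gS h]; exists S.
by move=> [S gS h]; apply/(tau_at_lt _ _ x0); exists S.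
Qed.

Lemma coverage_point_process d' (Omega : measurableType d')
    (T : invQ G -> {mfun Omega >-> R}) :
  is_point_process (fun w => point_sum (Zcov d (fun xi => T xi w))).
Proof.
move=> B mB; apply: emeasurable_sum => xi.
have mZ : measurable_fun setT (fun w => Zcov d (fun eta => T eta w) xi).
  apply: measurable_funB => //; apply: measurable_funM => //.
  by apply: measurable_funX; exact: measurable_tau.
apply/measurable_EFinP; exact: (measurableT_comp (measurable_indic mB) mZ).
Qed.

End Measurability.

(* Main.v *)
Require Import Defs.
From HB Require Import structures.
From mathcomp Require Import all_boot all_order all_algebra.
From mathcomp Require Import all_classical all_reals all_analysis.
From mathcomp Require Import measurable_realfun.
From mathcomp Require Import ring lra zify.
From mathcomp Require cyclic.

Import Order.TTheory GRing.Theory Num.Theory.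
Import numFieldNormedType.Exports.
Set Implicit Arguments.
Unset Strict Implicit.
Unset Printing Implicit Defensive.

Local Open Scope ring_scope.

(* Write M for the number of classes and fix thresholds r_i such that Z < z_i iff
   tau < r_i.  A class [x] is uncovered at r_i unless some d elements, all of
   whose nonzero classes are active, sum to x.  Up to lower order terms there are N^(d-1)/d!
   sets of d pairwise independent summands; each is fully active with probability
   r_i^d, and different sets rarely share classes, except for pairs obtained from
   each other by sign changes, of which there are few because N is odd.  Janson's
   inequality (upper bound) and Harris' inequality (lower bound) then show that k
   distinct classes are uncovered at levels r_(i_1), ..., r_(i_k) with probability
   asymptotic to M^(-k) exp(- z_(i_1) - ... - z_(i_k)), so all joint factorial
   moments of the numbers of uncovered classes converge.  Differences give the
   factorial moments of the counts in the intervals [z_i, z_(i+1)), and the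
   Bonferroni inequalities turn them into convergence of the joint law of these
   counts to independent Poisson laws.  Finally, a bounded vaguely continuous
   functional is controlled by its suprema over the measures with prescribed
   counts on a fine grid, which reduces convergence in distribution to the
   convergence of these counts. *)

(** * Correlation inequalities on a product of finite chains *)

(** One scale governs the error terms. At a threshold r the product N^(d-1) r^d is of order log N,
    so X = N r satisfies that X^d is of order N log N. Partial overlaps and degenerate tuples then
    contribute X^(d-1) / N up to logarithms, that is N^(-1/d) up to logarithms. The dangerous
    overlaps are pairs of d-sets with the same classes, since one is active exactly when the other
    is. Changing the signs of a proper nonempty part prescribes a second linear functional of the
    summands, and odd order turns this into the loss of a factor N. Changing all signs loses
    nothing, but it turns the sum x into - x; this is why one representative per class is fixed, and
    representatives of distinct classes are never opposite. Only finitely many thresholds matter at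
    a time, so the uniform times are replaced by their positions in a finite chain, where the
    correlation inequalities become statements about finite sums. All comparisons are strict and the
    cells half-open, so that counts on the grid and coverage at the thresholds match exactly,
    without boundary terms. *)

Section ProductModel.
Variables (R : realType) (V : finType) (n : nat) (p : 'I_n.+1 -> R).
Hypotheses (p_ge0 : forall l, 0 <= p l) (p_sum : \sum_l p l = 1).
Local Notation L := ('I_n.+1).
Local Notation W := ({ffun V -> L}).
Implicit Types (f g : W -> R) (w : W) (v : V) (s : seq V) (A B : {set V}).

(* Only the position of T_v among finitely many thresholds r_0 <= r_1 <= ...
   matters: w v is that position, so that w v <= i encodes T_v < r_i. *)
Definition wt w : R := \prod_v p (w v).
Definition Ex f : R := \sum_w wt w * f w.
Definition upd w v (l : L) : W := [ffun u => if u == v then l else w u].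
Definition avg v f w : R := \sum_l p l * f (upd w v l).
Definition avgs s f : W -> R := foldr avg f s.

Definition incr f := forall w w', (forall v, w v <= w' v)%N -> f w <= f w'.
Definition dep A f := forall w w', {in A, w =1 w'} -> f w = f w'.

Lemma wt_ge0 w : 0 <= wt w.
Proof. exact: prodr_ge0. Qed.

Lemma Ex_prod (h : V -> L -> R) :
  Ex (fun w => \prod_v h v (w v)) = \prod_v \sum_l p l * h v l.
Proof. by rewrite bigA_distr_bigA; apply: eq_bigr => w _; rewrite -big_split. Qed.

Lemma wt_sum : \sum_w wt w = 1.
Proof. by rewrite /wt -(bigA_distr_bigA (fun _ => p)) big1. Qed.

Lemma Ex_cst (c : R) : Ex (fun=> c) = c.
Proof. by rewrite /Ex -mulr_suml wt_sum mul1r. Qed.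

Lemma eq_Ex f g : f =1 g -> Ex f = Ex g.
Proof. by move=> fg; apply: eq_bigr => w _; rewrite fg. Qed.

Lemma le_Ex f g : (forall w, f w <= g w) -> Ex f <= Ex g.
Proof. by move=> fg; apply: ler_sum => w _; rewrite ler_wpM2l// wt_ge0. Qed.

Lemma ExD f g : Ex (fun w => f w + g w) = Ex f + Ex g.
Proof. by rewrite /Ex -big_split; apply: eq_bigr => w _; rewrite mulrDr. Qed.

Lemma ExZ c f : Ex (fun w => c * f w) = c * Ex f.
Proof. by rewrite /Ex mulr_sumr; apply: eq_bigr => w _; rewrite mulrCA. Qed.

Lemma ExB f g : Ex (fun w => f w - g w) = Ex f - Ex g.
Proof.
rewrite -mulN1r -ExZ -ExD; apply: eq_Ex => w; by rewrite mulN1r.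
Qed.

Lemma Ex_sum (I : Type) (r : seq I) (P : pred I) (F : I -> W -> R) :
  Ex (fun w => \sum_(i <- r | P i) F i w) = \sum_(i <- r | P i) Ex (F i).
Proof.
rewrite /Ex exchange_big /=; apply: eq_bigr => w _; exact: mulr_sumr.
Qed.

Lemma Ex_ge0 f : (forall w, 0 <= f w) -> 0 <= Ex f.
Proof. by move=> f0; apply: sumr_ge0 => w _; rewrite mulr_ge0 ?wt_ge0. Qed.

Lemma ler_norm_Ex f : `|Ex f| <= Ex (fun w => `|f w|).
Proof.
apply: le_trans (ler_norm_sum _ _ _) _; apply: ler_sum => w _.
by rewrite normrM ger0_norm// wt_ge0.
Qed.

Lemma upd_upd w v l l' : upd (upd w v l) v l' = upd w v l'.
Proof. by apply/ffunP => u; rewrite !ffunE; case: eqP. Qed.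

Lemma upd_id w v : upd w v (w v) = w.
Proof. by apply/ffunP => u; rewrite !ffunE; case: eqP => [->|]. Qed.

Lemma wt_upd w v l : wt (upd w v l) * p (w v) = wt w * p l.
Proof.
rewrite /wt (bigD1 v)//= [X in _ = X * _](bigD1 v)//= ffunE eqxx.
rewrite (eq_bigr (fun u => p (w u))); first by ring.
by move=> u /negbTE uv; rewrite ffunE uv.
Qed.

(** Exchanging w v with the fresh value l is an involution of the pairs (w, l), and by [wt_upd] it
    preserves the weight [wt w * p l]. *)
Lemma Ex_avg v f : Ex (avg v f) = Ex f.
Proof.
rewrite /Ex /avg; under eq_bigr do rewrite mulr_sumr.
rewrite pair_big /=.
pose h (x : W * L) := (upd x.1 v x.2, x.1 v).
have hK : cancel h h by case=> w l; rewrite /h/= upd_upd upd_id ffunE eqxx.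
rewrite (reindex h); last exact: (onW_bij _ (Bijective hK hK)).
rewrite -(pair_big xpredT xpredT (fun w l => wt (upd w v l) *
  (p (w v) * f (upd (upd w v l) v (w v))))) /=.
apply: eq_bigr => w _; under eq_bigr do rewrite upd_upd upd_id mulrA wt_upd.
by rewrite -mulr_suml -mulr_sumr p_sum mulr1.
Qed.

Lemma Ex_avgs s f : Ex (avgs s f) = Ex f.
Proof. by elim: s => //= v s <-; exact: Ex_avg. Qed.

Lemma le_avg v f g : (forall w, f w <= g w) -> forall w, avg v f w <= avg v g w.
Proof. by move=> fg w; apply: ler_sum => l _; rewrite ler_wpM2l. Qed.

Lemma incr_avg v f : incr f -> incr (avg v f).
Proof.
move=> fi w w' ww; apply: ler_sum => l _; rewrite ler_wpM2l//; apply: fi => u.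
by rewrite !ffunE; case: eqP.
Qed.

Lemma incr_avgs s f : incr f -> incr (avgs s f).
Proof. by move=> fi; elim: s => //= v s; exact: incr_avg. Qed.

(** Chebyshev's sum inequality on the chain of values of coordinate v: the increments of two
    increasing functions have the same sign, so the symmetrized double sum, which is twice the
    covariance, is nonnegative. *)
Lemma avgM_ge v f g w : incr f -> incr g ->
  avg v f w * avg v g w <= avg v (fun w => f w * g w) w.
Proof.
move=> fi gi; rewrite /avg.
set F := fun l => f (upd w v l); set H := fun l => g (upd w v l).
have mono h (hi : incr h) (l l' : L) : (l <= l')%N -> h (upd w v l) <= h (upd w v l').
  by move=> ll; apply: hi => u; rewrite !ffunE; case: eqP.
have : 0 <= \sum_l \sum_l' p l * p l' * ((F l - F l') * (H l - H l')).
  apply: sumr_ge0 => l _; apply: sumr_ge0 => l' _.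
  apply: mulr_ge0; first exact: mulr_ge0.
  have [ll|/ltnW ll] := leqP l l'.
    by rewrite -mulrNN !opprB mulr_ge0// subr_ge0 mono.
  by rewrite mulr_ge0// subr_ge0 mono.
have -> : \sum_l \sum_l' p l * p l' * ((F l - F l') * (H l - H l')) =
  2 * (\sum_l p l * (F l * H l) - (\sum_l p l * F l) * (\sum_l p l * H l)).
  have E1 : \sum_l \sum_l' p l * p l' * (F l * H l) = \sum_l p l * (F l * H l).
    apply: eq_bigr => l _; rewrite -mulr_suml -mulr_sumr p_sum; by rewrite mulr1.
  have E2 : \sum_l \sum_l' p l * p l' * (F l' * H l') = \sum_l p l * (F l * H l).
    rewrite exchange_big /= -E1; apply: eq_bigr => l _; apply: eq_bigr => l' _.
    by rewrite [p l * _]mulrC.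
  have E3 : \sum_l \sum_l' p l * p l' * (F l * H l') =
      (\sum_l p l * F l) * (\sum_l p l * H l).
    rewrite mulr_suml; apply: eq_bigr => l _; rewrite mulr_sumr.
    by apply: eq_bigr => l' _; ring.
  have E4 : \sum_l \sum_l' p l * p l' * (F l' * H l) =
      (\sum_l p l * F l) * (\sum_l p l * H l).
    rewrite exchange_big /= -E3; apply: eq_bigr => l _; apply: eq_bigr => l' _.
    by rewrite [p l * _]mulrC.
  rewrite mulrBr mulr_natl mulr2n mulr_natl mulr2n -{1}E1 -E2 -{1}E3 -E4.
  rewrite opprD !addrA -!sumrN -!big_split /=; apply: eq_bigr => l _.
  by rewrite -!sumrN -!big_split /=; apply: eq_bigr => l' _; ring.
by rewrite pmulr_rge0// subr_ge0.
Qed.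

Lemma avgsM_ge s f g w : (forall w, 0 <= f w) -> (forall w, 0 <= g w) ->
  incr f -> incr g ->
  avgs s f w * avgs s g w <= avgs s (fun w => f w * g w) w.
Proof.
move=> f0 g0 fi gi; elim: s w => //= v s IH w.
apply: le_trans (le_avg _ IH _).
by apply: avgM_ge; exact: incr_avgs.
Qed.

Lemma avgs_agree s f w w' : (forall v, v \notin s -> w v = w' v) ->
  avgs s f w = avgs s f w'.
Proof.
elim: s w w' => [|v s IH] w w' ww /=.
  by congr f; apply/ffunP => v; exact: ww.
apply: eq_bigr => l _; congr (_ * _); apply: IH => u us; rewrite !ffunE.
by have [//|uv] := eqVneq u v; apply: ww; rewrite inE negb_or uv.
Qed.

(** Once every coordinate is averaged out the function is constant, so pointwise statements about
    [avgs] become statements about [Ex]. *)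
Lemma ExE f w : Ex f = avgs (enum V) f w.
Proof.
rewrite -(Ex_avgs (enum V)) -[RHS]Ex_cst; apply: eq_Ex => w'.
by apply: avgs_agree => v; rewrite mem_enum.
Qed.

(* Integrating out one coordinate preserves monotonicity, so Chebyshev's sum
   inequality can be applied one coordinate at a time. *)
Lemma harris f g : (forall w, 0 <= f w) -> (forall w, 0 <= g w) ->
  incr f -> incr g -> Ex f * Ex g <= Ex (fun w => f w * g w).
Proof.
move=> f0 g0 fi gi; rewrite !(ExE _ [ffun=> ord0]); exact: avgsM_ge.
Qed.

(** Form for a decreasing f and an increasing g, from [harris] for 1 - f and g; the bound f <= 1
    keeps 1 - f nonnegative. *)
Lemma harris_opp f g : (forall w, 0 <= f w <= 1) -> (forall w, 0 <= g w) ->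
  incr (fun w => 1 - f w) -> incr g -> Ex (fun w => f w * g w) <= Ex f * Ex g.
Proof.
move=> f01 g0 fi gi.
have : Ex (fun w => 1 - f w) * Ex g <= Ex (fun w => (1 - f w) * g w).
  apply: harris => // w; have /andP[_ f1] := f01 w; by rewrite subr_ge0.
rewrite ExB Ex_cst (@eq_Ex (fun w => (1 - f w) * g w) (fun w => g w - f w * g w)).
  by rewrite ExB mulrBl mul1r lerD2l lerN2.
by move=> w; rewrite mulrBl mul1r.
Qed.

Lemma dep_avg A v f : dep A f -> dep A (avg v f).
Proof.
move=> fA w w' ww; apply: eq_bigr => l _; congr (_ * _); apply: fA => u uA.
by rewrite !ffunE; case: eqP => // _; exact: ww.
Qed.

Lemma dep_avgs A s f : dep A f -> dep A (avgs s f).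
Proof. by move=> fA; elim: s => //= v s; exact: dep_avg. Qed.

Lemma avg_indep A v f w : dep A f -> v \notin A -> forall l, f (upd w v l) = f w.
Proof.
move=> fA vA l; apply: fA => u uA; rewrite ffunE; case: eqP => // uv.
by move: vA; rewrite -uv uA.
Qed.

(** Each coordinate matters to at most one of the two factors, so the other one leaves the average
    as a constant. *)
Lemma avgsM A B s f g w : dep A f -> dep B g -> [disjoint A & B] ->
  avgs s (fun w => f w * g w) w = avgs s f w * avgs s g w.
Proof.
move=> fA gB AB; elim: s w => //= v s IH w; rewrite /avg.
under eq_bigr do rewrite IH.
have fA' := dep_avgs s fA; have gB' := dep_avgs s gB.
have [vA|vA] := boolP (v \in A).
  have vB : v \notin B by rewrite (disjointFr AB).
  under eq_bigr do rewrite (avg_indep _ gB' vB) mulrA.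
  under [X in _ = _ * X]eq_bigr do rewrite (avg_indep _ gB' vB).
  by rewrite -!mulr_suml p_sum mul1r.
under eq_bigr do rewrite (avg_indep _ fA' vA) mulrCA.
under [X in _ = X * _]eq_bigr do rewrite (avg_indep _ fA' vA).
by rewrite -mulr_suml -mulr_sumr p_sum mul1r.
Qed.

Lemma ExM_indep A B f g : dep A f -> dep B g -> [disjoint A & B] ->
  Ex (fun w => f w * g w) = Ex f * Ex g.
Proof.
by move=> fA gB AB; rewrite !(ExE _ [ffun=> ord0]) (avgsM _ _ fA gB AB).
Qed.

Section Janson.
Variables (I : eqType) (S : I -> {set V}) (b : I -> W -> bool).
Hypothesis b_decr : forall a w w', (forall v, w v <= w' v)%N -> b a w' -> b a w.
Hypothesis b_dep : forall a w w', {in S a, w =1 w'} -> b a w = b a w'.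
Implicit Types (a c : I) (t : seq I).

Local Notation beta a := (fun w => (b a w)%:R : R).
Definition none t w : R := \prod_(a <- t) (1 - (b a w)%:R).
Definition meet a c := ~~ [disjoint S a & S c].

Lemma none01 t w : 0 <= none t w <= 1.
Proof.
rewrite /none; elim: t => [|a t /andP[h0 h1]]; first by rewrite big_nil ler01 lexx.
rewrite big_cons; case: (b a w) => /=; first by rewrite subrr mul0r lexx ler01.
by rewrite subr0 mul1r h0.
Qed.

Lemma none_ge0 t w : 0 <= none t w. Proof. by case/andP: (none01 t w). Qed.

Lemma noneE t w : none t w = (all (fun a => ~~ b a w) t)%:R.
Proof.
rewrite /none; elim: t => [|a t IH]; first by rewrite big_nil.
by rewrite big_cons IH /=; case: (b a w) => /=; rewrite ?subrr ?mul0r ?subr0 ?mul1r.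
Qed.

Lemma none_ge t w : 1 - \sum_(a <- t) (b a w)%:R <= none t w.
Proof.
rewrite /none; elim: t => [|c t IH]; first by rewrite !big_nil subr0.
rewrite !big_cons; case: (b c w) => /=.
  rewrite subrr mul0r opprD addrA subrr add0r oppr_le0.
  by apply: sumr_ge0 => ? _; exact: ler0n.
by rewrite add0r subr0 mul1r.
Qed.

Lemma incr_none t : incr (none t).
Proof.
move=> w w' ww; rewrite !noneE ler_nat.
case: (boolP (all _ _)) => // /allP h; rewrite (_ : all _ _ = true)//.
apply/allP => a at_; apply: contra (h _ at_); exact: b_decr.
Qed.

Lemma incr_beta a : incr (fun w => 1 - beta a w).
Proof.
move=> w w' /(b_decr (a := a)) h; rewrite lerD2l lerN2 ler_nat.
by move: h; case: (b a w') => // ->.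
Qed.

Lemma harris_none t : \prod_(a <- t) (1 - Ex (beta a)) <= Ex (none t).
Proof.
elim: t => [|a t IH].
  by rewrite big_nil (@eq_Ex _ (fun=> 1)) ?Ex_cst// => w; rewrite /none big_nil.
rewrite big_cons (@eq_Ex (none (a :: t)) (fun w => (1 - beta a w) * none t w)); last first.
  by move=> w; rewrite /none big_cons.
have b0 w : 0 <= 1 - beta a w by rewrite subr_ge0; case: (b a w).
apply: le_trans (harris b0 (none_ge0 t) (@incr_beta a) (@incr_none t)).
by rewrite ExB Ex_cst ler_wpM2l// -[X in X - _]Ex_cst -ExB; exact: Ex_ge0.
Qed.

(** Janson's correlation term: every unordered pair of entries with meeting supports is counted
    once. The recursion matches the one-event-at-a-time induction in [janson]. *)
Fixpoint delta t : R := if t is a :: t' then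
  \sum_(c <- t' | meet a c) Ex (fun w => beta a w * beta c w) + delta t' else 0.

(* The events of t that do not share a class with a are independent of b a; the
   others are handled by a union bound and [harris_opp]. *)
Lemma janson_step a t :
  Ex (none (a :: t)) <= Ex (none t) * (1 - Ex (beta a) +
    \sum_(c <- t | meet a c) Ex (fun w => beta a w * beta c w)).
Proof.
set D := \sum_(c <- t | _) _.
pose ci := none [seq c <- t | ~~ meet a c].
pose cd := none [seq c <- t | meet a c].
have noneM w : none t w = cd w * ci w.
  rewrite /none /cd /ci /none !big_filter.
  by rewrite (bigID (meet a)).
have -> : Ex (none (a :: t)) = Ex (none t) - Ex (fun w => beta a w * none t w).
  by rewrite -ExB; apply: eq_Ex => w; rewrite /none big_cons mulrBl mul1r.
rewrite -addrA mulrDr mulr1 lerD2l mulrDr mulrN -lerN2 opprK opprD opprK -mulrBr.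
(* A nonpositive factor makes the inequality trivial; a positive one allows [Ex (none t)] to be
   replaced by the larger [Ex ci]. *)
have [neg|pos] := leP (Ex (beta a) - D) 0.
  apply: (@le_trans _ _ 0); last first.
    by apply: Ex_ge0 => w; rewrite mulr_ge0// none_ge0.
  by rewrite mulr_ge0_le0// Ex_ge0// => w; exact: none_ge0.
have leci : Ex (none t) <= Ex ci.
  apply: le_Ex => w; rewrite noneM ler_piMl//; first exact: none_ge0.
  by case/andP: (none01 [seq c <- t | meet a c] w).
apply: le_trans (ler_wpM2r (ltW pos) leci) _.
have cd_ge w : 1 - \sum_(c <- t | meet a c) beta c w <= cd w.
  by have := none_ge [seq c <- t | meet a c] w; rewrite big_filter.
apply: (@le_trans _ _ (Ex (fun w => beta a w * ci w -
    \sum_(c <- t | meet a c) (beta a w * beta c w) * ci w))); last first.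
  apply: le_Ex => w; rewrite noneM -mulr_suml mulrA -mulrBl ler_wpM2r//.
    exact: none_ge0.
  rewrite -mulr_sumr -[X in X - _]mulr1 -mulrBr ler_wpM2l//.
rewrite ExB Ex_sum mulrBr; apply: lerB.
  rewrite (@ExM_indep (S a) (~: S a)) 1?mulrC//.
  - by move=> w w' ww; rewrite (b_dep ww).
  - move=> w w' ww; rewrite /ci /none !big_filter; apply: eq_big => // c.
    rewrite /meet negbK => ac; congr (1 - (nat_of_bool _)%:R); apply: b_dep => v vc.
    by apply: ww; rewrite inE (disjointFl ac).
  - by rewrite -setI_eq0 finset.setICr.
rewrite mulr_sumr; apply: ler_sum => c _; rewrite mulrC; apply: harris_opp.
- by move=> w; case: (b a w); case: (b c w); rewrite ?mulr0 ?mulr1 ?lexx ?ler01.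
- exact: none_ge0.
- move=> w w' ww; have := b_decr (a := a) ww; have := b_decr (a := c) ww.
  rewrite lerD2l lerN2 -!natrM !mulnb ler_nat.
  case: (b a w'); case: (b c w') => //= h1 h2; by rewrite h1 ?h2.
- exact: incr_none.
Qed.

Lemma janson t : Ex (none t) <= expR (- \sum_(a <- t) Ex (beta a) + delta t).
Proof.
elim: t => [|a t IH] /=.
  rewrite big_nil oppr0 addr0 expR0 (@eq_Ex _ (fun=> 1)) ?Ex_cst// => w.
  by rewrite /none big_nil.
apply: le_trans (janson_step a t) _; rewrite big_cons.
set D := \sum_(c <- t | _) _.
have h0 : 0 <= Ex (none t) by apply: Ex_ge0; exact: none_ge0.
have := ler_wpM2l h0 (expR_ge1Dx (- Ex (beta a) + D)); rewrite addrA => /le_trans; apply.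
rewrite (_ : - _ + (D + _) = (- \sum_(a <- t) Ex (beta a) + delta t) + (- Ex (beta a) + D));
  last by ring.
by rewrite [leRHS]expRD ler_wpM2r// expR_ge0.
Qed.

Lemma delta_le t : uniq t -> delta t <= \sum_(a <- t) \sum_(c <- t | (c != a) && meet a c)
  Ex (fun w => beta a w * beta c w).
Proof.
have E0 a c : 0 <= Ex (fun w => beta a w * beta c w).
  by apply: Ex_ge0 => w; rewrite mulr_ge0.
elim: t => [|a t IH] /=; first by rewrite big_nil.
case/andP => at_ ut; rewrite big_cons; apply: lerD; last first.
  apply: le_trans (IH ut) _; apply: ler_sum => c _.
  by rewrite big_cons; case: ifP => // _; rewrite ler_wpDl.
rewrite big_cons eqxx /= big_seq_cond [leRHS]big_seq_cond.
rewrite le_eqVlt; apply/orP; left; apply/eqP; apply: eq_bigl => c.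
by case: (boolP (c \in t)) => //= ct; case: eqP => // ca; rewrite -ca ct in at_.
Qed.

End Janson.
End ProductModel.

(** * Coverage by sums of at most d generators *)

Section Classes.
Variable G : finZmodType.
Implicit Types (a b x y : G) (s : seq G) (S : {set G}) (xi : invQ G) (A : {set invQ G}).

Lemma mulrn_card x : x *+ #|G| = 0.
Proof.
have := @cyclic.expg_cardG _ (fingroup.setT_group _) x (finset.in_setT x).
by rewrite cardsT FinRing.zmodXgE.
Qed.

Lemma odd_addrr_eq0 : odd #|G| -> forall x, x + x = 0 -> x = 0.
Proof.
move=> oG x xx; have := mulrn_card x.
rewrite -(odd_double_half #|G|) oG add1n mulrS -mul2n mulrnA mulr2n xx mul0rn.
by rewrite addr0.
Qed.

Lemma odd_addrr_inj : odd #|G| -> forall x y, x + x = y + y -> x = y.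
Proof.
move=> oG x y xy; apply/eqP; rewrite -subr_eq0; apply/eqP/(odd_addrr_eq0 oG).
by rewrite addrACA -opprD xy subrr.
Qed.

(** Since 0 lies in no class, zero summands require no active class. *)
Definition cl (B : {pred G}) : {set invQ G} := [set xi : invQ G | [exists a in B, a \in val xi]].

Lemma clP (B : {pred G}) xi : reflect (exists2 a, a \in B & a \in val xi) (xi \in cl B).
Proof. by rewrite inE; exact: exists_inP. Qed.

Lemma eq_cl (B B' : {pred G}) : B =i B' -> cl B = cl B'.
Proof.
by move=> BB; apply/setP => xi; rewrite !inE; apply: eq_existsb => a; rewrite BB.
Qed.

Lemma val_invQ_mem a b xi : a \in val xi -> b \in val xi -> b = a \/ b = - a.
Proof.
by move=> /invQE[-> _]; rewrite !inE => /orP[] /eqP; [left|right].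
Qed.

Lemma val_invQN a xi : (- a \in val xi) = (a \in val xi).
Proof.
by apply/idP/idP => /invQE[-> _]; rewrite !inE ?opprK eqxx ?orbT.
Qed.

Lemma mem_val_inj a xi xi' : a \in val xi -> a \in val xi' -> xi = xi'.
Proof. by move=> /invQE[h _] /invQE[h' _]; apply: val_inj; rewrite h h'. Qed.

Lemma class_repr_neq0 xi : class_repr xi != 0.
Proof. by have [] := invQE (class_reprP xi). Qed.

Definition fresh s a := [&& a != 0, a \notin s & - a \notin s].

Lemma card_cl_cons a s : #|cl (mem (a :: s))| = (#|cl (mem s)| + fresh s a)%N.
Proof.
have sub : cl (mem s) \subset cl (mem (a :: s)).
  apply/fintype.subsetP => xi /clP[b bs bxi]; apply/clP; exists b => //.
  by rewrite /= inE; move: bs => /= ->; rewrite orbT.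
have [fr|nf] := boolP (fresh s a); last first.
  rewrite addn0; congr #|pred_of_set _|; apply/eqP; rewrite eq_sym finset.eqEsubset sub /=.
  apply/fintype.subsetP => xi /clP[b]; rewrite /= inE => /orP[/eqP -> axi|bs bxi].
    have [_ a0] := invQE axi.
    move: nf; rewrite /fresh a0 /= -negb_or negbK => /orP[as_|as_]; apply/clP.
      by exists a.
    by exists (- a) => //; rewrite val_invQN.
  by apply/clP; exists b.
have /and3P[a0 as_ nas] := fr.
have [xi xia] := invQ_class a0; have axi : a \in val xi by rewrite xia !inE eqxx.
rewrite addn1 (_ : cl (mem (a :: s)) = xi |: cl (mem s)).
  rewrite cardsU1; suff -> : xi \notin cl (mem s) by [].
  apply/clP => -[b /= bs bxi]; move: as_ nas.
  by have [<-|<-] := val_invQ_mem axi bxi; rewrite bs.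
apply/setP => xi'; rewrite in_setU1; apply/clP/orP.
  move=> [b]; rewrite /= inE => /orP[/eqP ->|bs] bxi.
    by left; apply/eqP; exact: mem_val_inj bxi axi.
  by right; apply/clP; exists b.
move=> [/eqP ->|/clP[b bs bxi]]; first by exists a; rewrite //= mem_head.
by exists b => //; move: bs; rewrite /= inE => ->; rewrite orbT.
Qed.

(** Sequence version of [indep]; by [card_cl_full] it says that s meets as many classes as it has
    entries, which is the form that counting provides. *)
Fixpoint indeps s := if s is a :: s' then fresh s' a && indeps s' else true.

Lemma cl_nil : cl (mem [::]) = finset.set0.
Proof. by apply/setP => xi; rewrite !inE; apply/negbTE/exists_inPn => a. Qed.

Lemma card_cl_le s : (#|cl (mem s)| <= size s)%N.
Proof.
elim: s => [|a s IH]; first by rewrite cl_nil cards0.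
by rewrite card_cl_cons; apply: leq_trans (leq_add IH (leq_b1 _)) _; rewrite addn1.
Qed.

Lemma card_cl_full s : (size s <= #|cl (mem s)|)%N = indeps s.
Proof.
elim: s => [|a s IH] //; rewrite card_cl_cons [indeps _]/=.
rewrite -IH; have := card_cl_le s; case: (fresh s a) => /=; lia.
Qed.

Lemma indepsP s : odd #|G| ->
  reflect (uniq s /\ {in s &, forall a b, a + b != 0}) (indeps s).
Proof.
move=> oG; elim: s => [|a s IH] /=; first by apply: ReflectT.
apply: (iffP andP) => [[/and3P[a0 as_ nas] /IH[us hs]]|[/andP[as_ us] hs]].
  split; first by rewrite as_.
  move=> b c; rewrite !inE => /orP[/eqP ->|bs] /orP[/eqP ->|cs].
  - by apply: contra a0 => /eqP /(odd_addrr_eq0 oG) ->.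
  - by rewrite addr_eq0; apply: contra nas => /eqP ->; rewrite opprK.
  - by rewrite addrC addr_eq0; apply: contra nas => /eqP ->; rewrite opprK.
  - exact: hs.
split; last by apply/IH; split => // b c bs cs; apply: hs; rewrite inE ?bs ?cs orbT.
apply/and3P; split => //.
  by have := hs a a (mem_head _ _) (mem_head _ _); apply: contra => /eqP ->; rewrite addr0.
apply/negP => nas; have := hs a (- a) (mem_head _ _); rewrite inE nas orbT subrr eqxx.
by move=> /(_ isT).
Qed.

(* When N is odd: the elements of S are nonzero and lie in distinct inversion
   classes (the case b = a excludes 0). *)
Definition indep S := [forall a in S, forall b in S, a + b != 0].

Lemma indep_cl S : odd #|G| -> indep S -> #|cl (mem S)| = #|S|.
Proof.
move=> oG /forall_inP iS; rewrite [RHS]cardE (@eq_cl _ (mem (enum S))); last first.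
  by move=> a /=; rewrite mem_enum.
apply/eqP; rewrite eqn_leq card_cl_le card_cl_full; apply/(indepsP _ oG).
split; first exact: enum_uniq.
by move=> a b; rewrite !mem_enum => aS bS; have /forall_inP := iS _ aS; apply.
Qed.

Section Cover.
Variable d : nat.

(* Summands equal to 0 are allowed, so this also accounts for walks of length
   less than d. *)
Definition cov A x := [exists q : d.-tuple G, (\sum_(a <- q) a == x) && (cl (mem q) \subset A)].

Definition rep_sets x : {set {set G}} :=
  [set S : {set G} | [&& #|S| == d, \sum_(a in S) a == x & indep S]].

(* The remaining ways to cover x use fewer than d classes; they are of lower order. *)
Definition degen x (q : d.-tuple G) :=
  (\sum_(a <- q) a == x) && (#|cl (mem q)| < d)%N.

Lemma cov_mono A A' x : A \subset A' -> cov A x -> cov A' x.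
Proof.
move=> AA /existsP[q /andP[qx qA]]; apply/existsP; exists q.
by rewrite qx (fintype.subset_trans qA AA).
Qed.

Lemma cov_rep_set A x S : S \in rep_sets x -> cl (mem S) \subset A -> cov A x.
Proof.
rewrite inE => /and3P[/eqP Sd Sx _] SA; apply/existsP.
have sz : size (enum S) == d by rewrite -cardE Sd.
exists (Tuple sz); rewrite /= big_enum Sx /=.
by rewrite (@eq_cl _ (mem S))// => a /=; rewrite mem_enum.
Qed.

(** The dichotomy is whether the d summands meet d classes. If they do, they are pairwise distinct
    and form a d-set in [rep_sets]; if not, the tuple is degenerate. *)
Lemma covE A x : odd #|G| -> cov A x ->
  (exists2 S, S \in rep_sets x & cl (mem S) \subset A) \/
  (exists2 q, degen x q & cl (mem (q : d.-tuple G)) \subset A).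
Proof.
move=> oG /existsP[q /andP[qx qA]].
have [lt|ge] := ltnP #|cl (mem q)| d; first by right; exists q => //; rewrite /degen qx.
left; move: ge; rewrite -[d in (d <= _)%N](size_tuple q) card_cl_full.
move=> /(indepsP _ oG)[uq hq]; exists [set a in q]%SET; last first.
  by rewrite (@eq_cl _ (mem q))// => a; rewrite /= inE.
rewrite inE; apply/and3P; split.
- by rewrite cardsE (card_uniqP uq) size_tuple.
- rewrite -(eqP qx); apply/eqP; rewrite [RHS]big_uniq//=; apply: eq_bigl => a.
  by rewrite inE.
- by apply/forall_inP => a; rewrite inE => aq; apply/forall_inP => b; rewrite inE => bq; exact: hq.
Qed.

Lemma gdist_le_path (R : realType) (e : rel G) x y :
  (gdist R e x y <= d%:R%:E)%E <-> exists p, [/\ path e x p, last x p = y & (size p <= d)%N].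
Proof.
split=> [h|[p [pp lp sp]]].
  have : (gdist R e x y < d.+1%:R%:E)%E.
    by apply: le_lt_trans h _; rewrite lte_fin ltr_nat.
  move/ereal_inf_lt => [_ [p [pp lp] <-]]; rewrite lte_fin ltr_nat ltnS => sp.
  by exists p.
apply: le_trans (ereal_inf_lbound _) _; first by exists p.
by rewrite lee_fin ler_nat.
Qed.

(** A walk from 0 is the list of its increments, padded with zeros to length d; conversely the
    partial sums of a tuple form a walk once zero summands are skipped. *)
Lemma tau_lt_cov (R : realType) (t : invQ G -> R) x r : (0 < d)%N -> x != 0 ->
  tau_at d t x < r <-> cov [set xi : invQ G | t xi < r] x.
Proof.
move=> d0 x0; rewrite (tau_at_lt d0)//; split.
- move=> [S /gdist_le_path[p [pp lp sp]] St].
  have steps : forall (p : seq G) z k, path (cayley (\bigcup_(xi in S) val xi)) z p ->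
      (size p <= k)%N -> exists q : seq G,
      [/\ (size q <= k)%N, \sum_(a <- q) a = last z p - z
        & {in q, forall a, exists2 xi, xi \in S & a \in val xi}].
    elim=> [|y p' IH] z k /=.
      by move=> _ _; exists [::]; split=> //; rewrite big_nil subrr.
    case: k => // k /andP[zy /IH h] /h[q [sq qx qS]].
    exists ((y - z) :: q); split => //; first by rewrite big_cons qx addrC addrA subrK.
    move=> a; rewrite inE => /orP[/eqP ->|/qS//].
    by case/finset.bigcupP: zy => xi; exists xi.
  have [q [sq qx qS]] := steps _ _ _ pp sp.
  have szq : size (q ++ nseq (d - size q) 0) == d by rewrite size_cat size_nseq subnKC.
  apply/existsP; exists (Tuple szq); rewrite /= big_cat /= qx lp subr0.
  rewrite big_nseq iter_addr_0 mul0rn addr0 eqxx /=.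
  apply/fintype.subsetP => xi /clP[a]; rewrite /= mem_cat mem_nseq => /orP[aq axi|/andP[_ /eqP ->]].
    have [xi' xiS axi'] := qS _ aq; rewrite inE (mem_val_inj axi axi'); exact: St.
  by move=> /invQE[_]; rewrite eqxx.
- move=> /existsP[q /andP[/eqP qx qS]]; exists (cl (mem q)); last first.
    by move=> xi /(fintype.subsetP qS); rewrite inE.
  apply/gdist_le_path.
  have walk : forall (s : seq G) z, {subset s <= q} -> exists p : seq G,
      [/\ path (cayley (\bigcup_(xi in cl (mem q)) val xi)) z p,
        last z p = z + \sum_(a <- s) a & (size p <= size s)%N].
    elim=> [|a s IH] z sq; first by exists [::]; rewrite big_nil addr0.
    have [|p [pp lp sp]] := IH (z + a); first by move=> b bs; apply: sq; rewrite inE bs orbT.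
    rewrite big_cons addrA; have [a0|a0] := eqVneq a 0.
      by exists p; rewrite a0 addr0 in pp lp *; split => //; exact: leqW.
    exists (z + a :: p); split => //=; rewrite pp andbT /cayley addrAC subrr add0r.
    have [xi xia] := invQ_class a0; have axi : a \in val xi by rewrite xia !inE eqxx.
    by apply/finset.bigcupP; exists xi => //; apply/clP; exists a => //; apply: sq; rewrite mem_head.
  have [p [pp lp sp]] := walk q 0 (fun _ => id).
  by exists p; rewrite lp add0r qx; split => //; rewrite -[d](size_tuple q).
Qed.

End Cover.
End Classes.

(** * Counting representations and their overlaps *)

Section TupleCounting.
Variables (G : finZmodType) (d : nat).
Hypothesis oG : odd #|G|.
Local Notation Q := {ffun 'I_d -> G}.
Implicit Types (q : Q) (x y : G) (S : {set G}).

(** Overwriting the coordinates in Z by 0 is injective on A, and its values are supported outside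
    Z. *)
Lemma card_determined (A : {set Q}) (Z : {set 'I_d}) :
  (forall q q', q \in A -> q' \in A -> (forall j, j \notin Z -> q j = q' j) -> q = q') ->
  (#|A| <= #|G| ^ (d - #|Z|))%N.
Proof.
move=> hA; pose h q : Q := [ffun j => if j \in Z then 0 else q j].
have hinj : {in A &, injective h}.
  move=> q q' qA qA' hq; apply: hA => // j jZ.
  by have := congr1 (fun f : Q => f j) hq; rewrite !ffunE (negbTE jZ).
rewrite -(card_in_imset hinj).
have -> : (d - #|Z|)%N = #|~: Z|%SET by rewrite [RHS]finset.cardsCs finset.setCK card_ord.
rewrite -(card_pffun_on 0 (mem (~: Z)%SET) (mem G)).
apply/subset_leq_card/fintype.subsetP => _ /imsetP[q _ ->].
apply/pffun_onP; split; last by [].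
apply/fintype.subsetP => j; rewrite !inE ffunE; case: ifP => //.
by rewrite eqxx.
Qed.

Lemma sum_determined (j0 : 'I_d) q q' : \sum_j q j = \sum_j q' j ->
  (forall j, j != j0 -> q j = q' j) -> q = q'.
Proof.
move=> sq qq; apply/ffunP => j; have [->|/qq//] := eqVneq j j0.
move: sq; rewrite (bigD1 j0)//= [RHS](bigD1 j0)//= => sq.
apply: (addIr (\sum_(i < d | i != j0) q i)); rewrite sq; congr (_ + _); apply: eq_bigr => i ij; exact/esym/qq.
Qed.

(** All coordinates but j0 are free, and j0 is solved for; [pffun_on] with default 0 at j0 encodes
    the free choices. *)
Lemma card_sum_ge x : (0 < d)%N -> (#|G| ^ d.-1 <= #|[set q : Q | \sum_j q j == x]%R|)%N.
Proof.
case: (d) => // d' _; pose j0 : 'I_d'.+1 := ord0.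
have -> : d'.+1.-1 = #|~: [set j0]|%SET by rewrite [RHS]finset.cardsCs finset.setCK card_ord cards1 subn1.
rewrite -(card_pffun_on 0 (mem (~: [set j0])%SET) (mem G)).
pose h (q : {ffun 'I_d'.+1 -> G}) : {ffun 'I_d'.+1 -> G} :=
  [ffun j => if j == j0 then x - \sum_(i | i != j0) q i else q j].
have hinj : {in pffun_on 0 (mem (~: [set j0])%SET) (mem G) &, injective h}.
  move=> q q' /pffun_onP[qs _] /pffun_onP[qs' _] hq; apply/ffunP => j.
  have [->|jj] := eqVneq j j0.
    have z (p : {ffun 'I_d'.+1 -> G}) :
        support p \subset mem (~: [set j0])%SET -> p j0 = 0.
      move=> /fintype.subsetP/(_ j0); rewrite !inE eqxx /= => ps.
      by apply/eqP; move: ps; case: (p j0 == 0) => //= /(_ isT).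
    by rewrite !z.
  by have := congr1 (fun f : {ffun 'I_d'.+1 -> G} => f j) hq; rewrite !ffunE (negbTE jj).
rewrite -(card_in_imset hinj).
apply/subset_leq_card/fintype.subsetP => _ /imsetP[q _ ->]; rewrite inE.
have hs : \sum_(i | i != j0) h q i = \sum_(i | i != j0) q i.
  by apply: eq_bigr => i /negbTE ij; rewrite ffunE ij.
by rewrite (bigD1 j0)//= hs ffunE eqxx subrK.
Qed.

Definition rep_tuples x : {set Q} := [set q : Q | [&& \sum_j q j == x, injectiveb q &
  [forall i, forall j, q i + q j != 0]]].

Lemma card_rep_tuples_le x : (0 < d)%N -> (#|rep_tuples x| <= #|G| ^ d.-1)%N.
Proof.
move=> d0; pose j0 : 'I_d := Ordinal d0.
rewrite -subn1 -(cards1 j0); apply: card_determined => q q'.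
rewrite !inE => /and3P[/eqP qx _ _] /and3P[/eqP qx' _ _] qq.
apply: (@sum_determined j0); first by rewrite qx qx'.
by move=> j jj; apply: qq; rewrite inE.
Qed.

Lemma card2_determined (A : {set Q}) (a b : 'I_d) : a != b ->
  (forall q q', q \in A -> q' \in A -> (forall j, j != a -> j != b -> q j = q' j) -> q = q') ->
  (#|A| <= #|G| ^ (d - 2))%N.
Proof.
move=> ab hA; have <- : #|[set a; b]| = 2%N by rewrite cards2 ab.
by apply: card_determined => q q' qA qA' qq; apply: hA => // j ja jb; apply: qq; rewrite !inE negb_or ja.
Qed.

(** The sum determines q i + q i from the other coordinates, and odd order recovers q i. *)
Lemma card_eq_le x (i j : 'I_d) : i != j ->
  (#|[set q : Q | (\sum_k q k == x) && (q i == q j)]%R| <= #|G| ^ (d - 2))%N.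
Proof.
move=> ij; apply: (card2_determined ij) => q q'.
rewrite !inE => /andP[/eqP qx /eqP qij] /andP[/eqP qx' /eqP qij'] qq.
have e : q i = q' i.
  apply: (odd_addrr_inj oG); move: qx; rewrite -qx'.
  rewrite (bigD1 i)//= [RHS](bigD1 i)//= (bigD1 j) 1?eq_sym//= [X in _ = _ + X](bigD1 j) 1?eq_sym//=.
  rewrite -qij -qij' !addrA => h.
  apply: (addIr (\sum_(k < d | (k != i) && (k != j)) q k)); rewrite h; congr (_ + _).
  by apply: eq_bigr => k /andP[ki kj]; rewrite qq.
apply/ffunP => k; have [->//|ki] := eqVneq k i; have [->|kj] := eqVneq k j.
  by rewrite -qij -qij'.
exact: qq.
Qed.

(** The condition fixes coordinate j (for i = j it says q i = 0, as N is odd), and a third index k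
    absorbs the sum constraint. If i and j are distinct and there is no third index, the sum is 0,
    which x != 0 excludes. *)
Lemma card_opp_le x (i j : 'I_d) : x != 0 -> (1 < d)%N ->
  (#|[set q : Q | (\sum_k q k == x) && (q i + q j == 0)]%R| <= #|G| ^ (d - 2))%N.
Proof.
move=> x0 d1; set A := finset _.
have [/existsP[k /andP[ki kj]]|/existsPn nk] := boolP [exists k, (k != i) && (k != j)].
  apply: (card2_determined kj) => q q'.
  rewrite !inE => /andP[/eqP qx /eqP qij] /andP[/eqP qx' /eqP qij'] qq.
  have e : q j = q' j.
    have [ij|ij] := eqVneq i j.
      by rewrite !ij in qij qij'; rewrite (odd_addrr_eq0 oG qij) (odd_addrr_eq0 oG qij').
    by apply: (addrI (q i)); rewrite qij [q i]qq// 1?eq_sym.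
  apply: (@sum_determined k); first by rewrite qx qx'.
  by move=> l lk; have [->//|lj] := eqVneq l j; exact: qq.
have [ij|ij] := eqVneq i j.
  have [k ki] : exists k, k != i.
    by apply/existsP; rewrite -[[exists _, _]]negbK negb_exists; apply/negP => /forallP h;
      move: d1; rewrite -[d in (1 < d)%N]card_ord (cardD1 i) (eq_card0 (A := _)) ?addn0 ?leq_b1 //;
      move=> k; rewrite !inE andbT; apply/negbTE; exact: h.
  by have := nk k; rewrite -ij ki.
rewrite (_ : A = finset.set0) ?cards0//; apply/setP => q; rewrite !inE.
apply/negbTE/andP => -[/eqP qx /eqP qij]; move: x0; rewrite -qx (bigD1 i)//=.
rewrite (bigD1 j) 1?eq_sym//= big_pred0 ?addr0 ?qij ?eqxx// => k.
exact/negbTE/nk.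
Qed.
End TupleCounting.

Lemma leq_card_bigcup (T I : finType) (P : pred I) (F : I -> {set T}) :
  (#|\bigcup_(i | P i) F i|%SET <= \sum_(i | P i) #|F i|)%N.
Proof.
elim/big_ind2: _ => [|a A b B hA hB|//]; first by rewrite cards0.
apply: leq_trans (leq_add hA hB); exact: leq_card_setU.
Qed.

Section RepresentingSets.
Variables (G : finZmodType) (d : nat).
Hypothesis oG : odd #|G|.
Local Notation Q := {ffun 'I_d -> G}.
Implicit Types (q : Q) (x y : G) (S : {set G}).

(** A solution of the sum equation that is not in [rep_tuples] has two equal coordinates or a
    vanishing pair sum. Each of the d^2 index pairs spoils at most N^(d-2) solutions in each of
    these two ways. *)
Lemma card_rep_tuples_ge x : x != 0 -> (1 < d)%N ->
  (#|G| ^ d.-1 <= #|rep_tuples d x| + 2 * d ^ 2 * #|G| ^ (d - 2))%N.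
Proof.
move=> x0 d1; apply: leq_trans (card_sum_ge x (ltnW d1)) _.
pose E (p : 'I_d * 'I_d) := [set q : Q | (\sum_k q k == x) && (q p.1 == q p.2)].
pose O (p : 'I_d * 'I_d) := [set q : Q | (\sum_k q k == x) && (q p.1 + q p.2 == 0)].
have sub : [set q : Q | \sum_j q j == x] \subset
    (rep_tuples d x :|: (\bigcup_(p | p.1 != p.2) E p :|: \bigcup_p O p))%SET.
  apply/fintype.subsetP => q; rewrite !inE => qx; rewrite qx /=.
  have [qi|/injectivePn[i [j ij qij]]] := boolP (injectiveb q); last first.
    apply/orP; right; apply/orP; left; apply/finset.bigcupP; exists (i, j) => //.
    by rewrite inE qx /= qij.
  have [//|] := boolP [forall i, forall j, q i + q j != 0].
  rewrite negb_forall => /existsP[i]; rewrite negb_forall => /existsP[j]; rewrite negbK => qij.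
  apply/orP; right; apply/orP; right; apply/finset.bigcupP; exists (i, j) => //.
  by rewrite inE qx.
apply: leq_trans (subset_leq_card sub) _.
apply: leq_trans (leq_card_setU _ _) _; rewrite leq_add2l.
apply: leq_trans (leq_card_setU _ _) _.
have cP : #|{: 'I_d * 'I_d}| = (d ^ 2)%N by rewrite card_prod card_ord.
rewrite mul2n -addnn mulnDl; apply: leq_add; apply: leq_trans (leq_card_bigcup _ _) _.
  rewrite -cP -sum_nat_const big_mkcond /=; apply: leq_sum => p _.
  by case: ifP => // pp; exact: card_eq_le.
by rewrite -cP -sum_nat_const; apply: leq_sum => p _; exact: card_opp_le.
Qed.

Definition im q : {set G} := [set q j | j : 'I_d].

Lemma card_im q : injective q -> #|im q| = d.
Proof. by move=> qi; rewrite card_imset// card_ord. Qed.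

Lemma big_im (R : Type) (idx : R) (op : Monoid.com_law idx) (F : G -> R) q :
  injective q -> \big[op/idx]_(a in im q) F a = \big[op/idx]_j F (q j).
Proof. by move=> qi; rewrite big_imset//= => i j _ _; exact: qi. Qed.

Lemma im_rep_sets x q : q \in rep_tuples d x -> im q \in rep_sets d x.
Proof.
rewrite !inE => /and3P[/eqP qx /injectiveP qi /forallP qq].
rewrite card_im// eqxx big_im// qx eqxx /=.
apply/forall_inP => _ /imsetP[i _ ->]; apply/forall_inP => _ /imsetP[j _ ->].
by have /forallP := qq i; apply.
Qed.

Lemma card_fibre x S : S \in rep_sets d x -> #|[set q in rep_tuples d x | im q == S]| = d`!.
Proof.
rewrite inE => /and3P[/eqP Sd /eqP Sx /forall_inP Si].
transitivity #|[set f : Q in ffun_on (mem S) | injectiveb f]|; last first.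
  by rewrite card_inj_ffuns_on Sd card_ord ffactnn.
apply: eq_card => q; rewrite !inE; apply/andP/andP.
  move=> [/and3P[_ qi _] /eqP qS]; split => //; apply/ffun_onP => j.
  by rewrite -qS; apply: imset_f.
move=> [/ffun_onP qS qi]; have /injectiveP qi' := qi.
have e : im q = S.
  apply/eqP; rewrite eqEcard card_im// Sd leqnn andbT.
  by apply/fintype.subsetP => _ /imsetP[j _ ->]; exact: qS.
have sx : \sum_j q j = x by rewrite -Sx -e big_im.
rewrite e eqxx qi sx eqxx; split => //=.
apply/forallP => i; apply/forallP => j.
by have /forall_inP := Si _ (qS i); apply; exact: qS.
Qed.

(** Every d-set has d! orderings. Tuples are preferred for estimates because their coordinates can
    be summed one by one. *)
Lemma sum_rep_tuples (R : pzSemiRingType) x (phi : {set G} -> R) :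
  \sum_(q in rep_tuples d x) phi (im q) = d`!%:R * \sum_(S in rep_sets d x) phi S.
Proof.
rewrite (partition_big im (mem (rep_sets d x))) /=; last exact: im_rep_sets.
rewrite mulr_sumr; apply: eq_bigr => S SP; rewrite -(card_fibre SP).
rewrite (eq_bigr (fun=> phi S)); last by move=> q /andP[_ /eqP ->].
rewrite sumr_const mulr_natl; congr (_ *+ _); apply: eq_card => q.
by rewrite [RHS]inE unfold_in.
Qed.

Lemma card_rep_sets x : (d`! * #|rep_sets d x|)%N = #|rep_tuples d x|.
Proof.
have := @sum_rep_tuples int x (fun=> 1); rewrite !sumr_const -natrM => /eqP.
by rewrite eqr_nat => /eqP <-.
Qed.

Section Overlap.
Variable R : realFieldType.

(* The coordinate j1 is determined by the others through the value of the sum. *)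
Lemma sum_constraint_le (j1 : 'I_d) (w : 'I_d -> G -> R) (r : R) y :
  (forall j a, 0 <= w j a) -> (forall a, w j1 a <= r) ->
  \sum_(q : Q | \sum_j q j == y) \prod_j w j (q j) <=
  r * \prod_(j | j != j1) \sum_a w j a.
Proof.
move=> w0 wr.
pose h q : Q := [ffun j => if j == j1 then y - \sum_(i | i != j1) q i else q j].
pose z q : Q := [ffun j => if j == j1 then 0 else q j].
have hs q : \sum_(i | i != j1) h q i = \sum_(i | i != j1) q i.
  by apply: eq_bigr => i /negbTE ij; rewrite ffunE ij.
have zs q : \sum_(i | i != j1) z q i = \sum_(i | i != j1) q i.
  by apply: eq_bigr => i /negbTE ij; rewrite ffunE ij.
rewrite (reindex_onto h z); last first.
  move=> q; rewrite (bigD1 j1)//= => /eqP qy; apply/ffunP => j; rewrite /h ffunE zs.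
  case: eqVneq => [->|jj]; first by rewrite -qy addrK.
  by rewrite /z ffunE (negbTE jj).
pose w' j a := if j == j1 then (a == 0)%:R else w j a.
have -> : r * \prod_(j | j != j1) \sum_a w j a =
    r * \prod_j \sum_a w' j a.
  congr (_ * _); rewrite [RHS](bigD1 j1)//= (eq_bigr (fun a => (a == 0)%:R)); last first.
    by move=> a _; rewrite /w' eqxx.
  have -> : \sum_(a : G) (a == 0)%:R = 1 :> R.
    by rewrite (bigD1 0)//= eqxx big1 ?addr0// => a /negbTE ->.
  rewrite mul1r.
  apply: eq_bigr => j /negbTE jj; apply: eq_bigr => a _; by rewrite /w' jj.
rewrite bigA_distr_bigA /= mulr_sumr [leLHS]big_mkcond /=; apply: ler_sum => q _.
have w'0 : 0 <= \prod_j w' j (q j).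
  by apply: prodr_ge0 => j _; rewrite /w'; case: ifP => // _; case: eqP.
have r0 : 0 <= r by apply: le_trans (wr 0).
case: ifP => [/andP[_ /eqP hq]|_]; last exact: mulr_ge0.
have q0 : q j1 = 0 by rewrite -hq /z ffunE eqxx.
rewrite (bigD1 j1)//= [X in _ <= _ * X](bigD1 j1)//= /w' eqxx q0 eqxx mul1r.
apply: ler_pM => //; first exact: prodr_ge0.
apply: ler_prod => j /negbTE jj; rewrite w0 /= jj /h ffunE jj lexx //.
Qed.

Variable S : {set G}.
Hypothesis Sd : (#|S| <= d)%N.
Definition pm : {set G} := (S :|: [set - a | a in S])%SET.

Lemma card_pm : (#|pm| <= 2 * d)%N.
Proof.
rewrite mul2n -addnn; apply: leq_trans (leq_card_setU _ _) _.
by apply: leq_add => //; apply: leq_trans (leq_imset_card _ _) _.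
Qed.

Lemma mem_pm a (xi : invQ G) : a \in val xi -> (a \in pm) = (xi \in cl (mem S)).
Proof.
move=> axi; rewrite !inE; apply/orP/exists_inP.
  move=> [aS|/imsetP[b bS ab]]; first by exists a.
  by exists b => //; rewrite -val_invQN -ab.
move=> [b bS bxi]; have [bE|bE] := val_invQ_mem axi bxi; first by left; rewrite -bE.
by right; apply/imsetP; exists b => //; rewrite bE opprK.
Qed.

(** Cost of a summand once the classes of S are already active. *)
Definition wgt (r : R) a : R := if a \in pm then 1 else r.

(** The elements of P outside [pm] are still independent, so each of them opens one further
    class. *)
Lemma expr_cl_union (r : R) (P : {set G}) : 0 <= r -> r <= 1 -> indep P ->
  r ^+ #|cl (mem S) :|: cl (mem P)|%SET <= r ^+ #|cl (mem S)| * \prod_(a in P) wgt r a.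
Proof.
move=> r0 r1 iP; pose T := [set a in P | a \notin pm].
have -> : \prod_(a in P) wgt r a = r ^+ #|T|.
  rewrite (bigID (fun a => a \in pm)) /= big1 ?mul1r; last first.
    by move=> a /andP[_ ap]; rewrite /wgt ap.
  rewrite (eq_bigr (fun=> r)); last by move=> a /andP[_ /negbTE ap]; rewrite /wgt ap.
  rewrite prodr_const; congr (_ ^+ _); apply: eq_card => a; by rewrite [RHS]inE unfold_in.
rewrite -exprD; apply: ler_wiXn2l => //.
have iT : indep T.
  apply/forall_inP => a; rewrite inE => /andP[aP _]; apply/forall_inP => b.
  rewrite inE => /andP[bP _]; have /forall_inP h := forall_inP iP _ aP; exact: h.
rewrite -(indep_cl oG iT).
suff dis : cl (mem S) :&: cl (mem T) = finset.set0.
  rewrite -cardsUI dis cards0 addn0.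
  apply/subset_leq_card/finset.setUS/fintype.subsetP => xi /clP[a]; rewrite /= inE => /andP[aP _] axi.
  by apply/clP; exists a.
apply/setP => xi; rewrite finset.in_setI finset.in_set0; apply/negbTE/andP => -[xS /clP[a]].
by rewrite /= inE => /andP[_ ap] axi; rewrite (mem_pm axi) xS in ap.
Qed.

(** Order P as a tuple. Sharing a class with S gives a coordinate j0 in [pm], and having different
    classes gives a coordinate j1 outside; there are at most d^2 such pairs of positions. Coordinate
    j0 has at most 2 d values, j1 is fixed by the sum and costs r, and each of the d - 2 others
    contributes at most N r + 2 d in total weight. *)
Lemma overlap_partial (r : R) y : 0 <= r -> r <= 1 -> indep S -> #|S| = d ->
  \sum_(P in rep_sets d y | ~~ [disjoint cl (mem S) & cl (mem P)] && (cl (mem P) != cl (mem S)))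
     r ^+ #|cl (mem S) :|: cl (mem P)|%SET <=
  r ^+ d * ((d ^ 2)%:R * ((2 * d)%:R * r * (#|G|%:R * r + (2 * d)%:R) ^+ (d - 2))).
Proof.
move=> r0 r1 iS cS.
pose phi (P : {set G}) : R := (~~ [disjoint cl (mem S) & cl (mem P)] && (cl (mem P) != cl (mem S)))%:R *
  \prod_(a in P) wgt r a.
have wgt0 a : 0 <= wgt r a by rewrite /wgt; case: ifP.
have phi0 P : 0 <= phi P by rewrite mulr_ge0// prodr_ge0.
apply: (@le_trans _ _ (r ^+ d * \sum_(P in rep_sets d y) phi P)).
  rewrite mulr_sumr big_mkcondr /=; apply: ler_sum => P.
  rewrite inE => /and3P[_ _ iP]; rewrite /phi; case: ifP => _ /=; last by rewrite mul0r mulr0.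
  rewrite mul1r -[X in _ ^+ X * _]cS -(indep_cl oG iS); exact: expr_cl_union.
apply: ler_wpM2l; first exact: exprn_ge0.
apply: (@le_trans _ _ (\sum_(q in rep_tuples d y) phi (im q))).
  rewrite sum_rep_tuples ler_peMl ?sumr_ge0// ler1n; exact: fact_gt0.
pose v (p : 'I_d * 'I_d) j a : R := if j == p.1 then (a \in pm)%:R else
   if j == p.2 then r else wgt r a.
apply: (@le_trans _ _ (\sum_(q : Q | \sum_j q j == y)
    \sum_(p : 'I_d * 'I_d | p.1 != p.2) \prod_j v p j (q j))).
  rewrite big_mkcond [leRHS]big_mkcond /=; apply: ler_sum => q _.
  have v0 p : 0 <= \prod_j v p j (q j).
    by apply: prodr_ge0 => j _; rewrite /v; case: ifP => // _; case: ifP.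
  case: ifP => [|_]; last by case: ifP => // _; exact: sumr_ge0.
  rewrite inE => /and3P[qy /injectiveP qi /forallP qq]; rewrite qy /phi.
  case: andP => [[meets diff]|_]; last by rewrite mul0r sumr_ge0.
  rewrite mul1r.
  have iq : indep (im q).
    apply/forall_inP => _ /imsetP[i _ ->]; apply/forall_inP => _ /imsetP[j _ ->].
    by have /forallP := qq i; apply.
  have [j0 j0p] : exists j0, q j0 \in pm.
    move: meets; rewrite -setI_eq0 => /set0Pn[xi]; rewrite finset.in_setI => /andP[xS /clP[a]].
    move=> /imsetP[j _ ->] jxi; exists j; by rewrite (mem_pm jxi).
  have [j1 j1p] : exists j1, q j1 \notin pm.
    apply/existsP; rewrite -[[exists _, _]]negbK negb_exists; apply: contra diff => /forallP h.
    rewrite eqEcard (indep_cl oG iS) (indep_cl oG iq) card_im// cS leqnn andbT.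
    apply/fintype.subsetP => xi /clP[_ /imsetP[j _ ->] jxi].
    by rewrite -(mem_pm jxi); have := h j; rewrite negbK.
  have j01 : j0 != j1 by apply: contra j1p => /eqP <-.
  rewrite (bigD1 (j0, j1))//= big_im//=; apply: ler_wpDr; first exact: sumr_ge0.
  rewrite le_eqVlt; apply/orP; left; apply/eqP; apply: eq_bigr => j _; rewrite /v /=.
  have [->|_] := eqVneq j j0; first by rewrite /wgt j0p.
  by have [->|_] := eqVneq j j1; first by rewrite /wgt (negbTE j1p).
rewrite exchange_big /=.
have -> : (d ^ 2)%:R = \sum_(p : 'I_d * 'I_d) (1 : R).
  by rewrite sumr_const card_prod card_ord.
rewrite mulr_suml [leLHS]big_mkcond /=; apply: ler_sum => p _.
rewrite mul1r; case: ifP => [p12|_]; last by rewrite !mulr_ge0// exprn_ge0// addr_ge0// mulr_ge0.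
apply: le_trans (@sum_constraint_le p.2 (v p) r y _ _) _.
- by move=> j a; rewrite /v; case: ifP => // _; case: ifP.
- by move=> a; rewrite /v eq_sym (negbTE p12) eqxx.
rewrite (bigD1 p.1)//= mulrA; apply: ler_pM.
- by rewrite mulr_ge0// sumr_ge0// => a _; rewrite /v eqxx.
- by apply: prodr_ge0 => j _; apply: sumr_ge0 => a _; rewrite /v; case: ifP => // _; case: ifP.
- rewrite mulrC ler_wpM2r// (eq_bigr (fun a => (a \in pm)%:R)); last by move=> a _; rewrite /v eqxx.
  by rewrite -natr_sum ler_nat -big_mkcond sum1_card card_pm.
- rewrite (eq_bigr (fun=> \sum_a wgt r a)); last first.
    by move=> j /andP[/negbTE h2 /negbTE h1]; apply: eq_bigr => a _; rewrite /v h1 h2.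
  rewrite prodr_const.
  have -> : #|[pred j : 'I_d | (j != p.2) && (j != p.1)]| = (d - 2)%N.
    have <- : #|~: [set p.1; p.2]|%SET = (d - 2)%N.
      by rewrite finset.cardsCs finset.setCK card_ord cards2 p12.
    by apply: eq_card => j; rewrite !inE negb_or andbC.
  apply: lerXn2r; rewrite ?nnegrE ?addr_ge0 ?mulr_ge0 ?sumr_ge0//.
  rewrite (bigID (mem pm)) /= addrC; apply: lerD.
    rewrite (eq_bigr (fun=> r)); last by move=> a /negbTE h; rewrite /wgt h.
    rewrite sumr_const mulr_natl; apply: ler_wpMn2l => //; exact: max_card.
  rewrite (eq_bigr (fun=> 1)); last by move=> a h; rewrite /wgt h.
  by rewrite sumr_const ler_nat card_pm.
Qed.
End Overlap.

End RepresentingSets.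

Section SameClasses.
Variables (G : finZmodType) (d : nat).
Hypothesis oG : odd #|G|.
Local Notation Q := {ffun 'I_d -> G}.
Implicit Types (q : Q) (x y : G) (P S : {set G}) (D : {set 'I_d}).

(* Sets with the same classes as the image of q arise by changing signs in q. *)
Definition flip D q : Q := [ffun j => if j \in D then q j else - q j].

(** P contains exactly one of q j and - q j for each j, and D records where it is q j. *)
Lemma cl_eq_flip x y q P : q \in rep_tuples d x -> P \in rep_sets d y -> cl (mem P) = cl (mem (im q)) ->
  let D := [set j | q j \in P] in P = im (flip D q) /\ \sum_j flip D q j = y.
Proof.
rewrite !inE => /and3P[_ /injectiveP qi /forallP qq] /and3P[/eqP Pd /eqP Py _] cP D.
have qn i j : q i + q j != 0 by have /forallP := qq i; apply.
have fi : injective (flip D q).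
  move=> i j; rewrite !ffunE; case: ifP => _; case: ifP => _ /eqP.
  - by move/eqP/qi.
  - by rewrite -addr_eq0 (negbTE (qn _ _)).
  - by rewrite eq_sym -addr_eq0 (negbTE (qn _ _)).
  - by rewrite eqr_opp => /eqP/qi.
have PE : P = im (flip D q).
  apply/eqP; rewrite eq_sym eqEcard card_im// Pd leqnn andbT.
  apply/fintype.subsetP => _ /imsetP[j _ ->]; rewrite ffunE inE; case: ifP => // qjP.
  have qj0 : q j != 0.
    by apply: contra (qn j j) => /eqP ->; rewrite addr0.
  have [xi xiE] := invQ_class qj0; have qxi : q j \in val xi by rewrite xiE !inE eqxx.
  have : xi \in cl (mem P) by rewrite cP; apply/clP; exists (q j) => //; exact: imset_f.
  by move=> /clP[b /= bP bxi]; have [bE|<-//] := val_invQ_mem qxi bxi; rewrite -bE bP in qjP.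
by split => //; rewrite -Py [in RHS]PE big_im.
Qed.

(** The sign pattern D = setT gives back [im q], and D = set0 would give y = - x; both are excluded,
    so only mixed sign patterns remain. *)
Lemma card_same_classes x q y : q \in rep_tuples d x -> x != 0 -> y != - x ->
  (#|[set P in rep_sets d y | (cl (mem P) == cl (mem (im q))) && (P != im q)]| <=
   #|[set D | [&& D != finset.setT, D != finset.set0 & (\sum_j flip D q j)%R == y]]|)%N.
Proof.
move=> qU x0 yx.
apply: leq_trans (leq_imset_card (fun D => im (flip D q)) _).
apply/subset_leq_card/fintype.subsetP => P; rewrite inE => /and3P[PS /eqP cP Pq].
have [PE sy] := cl_eq_flip qU PS cP; apply/imsetP; exists [set j | q j \in P] => //.
rewrite inE sy eqxx andbT; apply/andP; split.
  apply: contra Pq => /eqP DT; apply/eqP; rewrite PE DT; congr im.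
  by apply/ffunP => j; rewrite ffunE inE.
apply: contra yx => /eqP D0; rewrite -sy D0; move: qU; rewrite inE => /and3P[/eqP <- _ _].
by rewrite -sumrN; apply/eqP; apply: eq_bigr => j _; rewrite ffunE inE.
Qed.

(* The two sums of q and of its flip determine the sum of q over D, hence two
   coordinates, one inside D and one outside. *)
Lemma card_flip_le x y D : D != finset.setT -> D != finset.set0 ->
  (#|[set q in rep_tuples d x | (\sum_j flip D q j)%R == y]| <= #|G| ^ (d - 2))%N.
Proof.
move=> DT /set0Pn[a aD].
have [b bD] : exists b, b \notin D.
  apply/existsP; rewrite -[[exists _, _]]negbK negb_exists; apply: contra DT => /forallP h.
  by apply/eqP/setP => j; rewrite inE; have := h j; rewrite negbK.
have ab : a != b by apply: contra bD => /eqP <-.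
apply: (card2_determined ab) => q q'.
rewrite 2!inE => /andP[/and3P[/eqP qx _ _] /eqP qy].
rewrite 2!inE => /andP[/and3P[/eqP qx' _ _] /eqP qy'] qq.
have dbl (p : Q) : \sum_j p j + \sum_j flip D p j = \sum_(j in D) p j + \sum_(j in D) p j.
  rewrite -!big_split [RHS]big_mkcond /=; apply: eq_bigr => j _; rewrite ffunE.
  by case: ifP; rewrite ?subrr.
have : \sum_(j in D) q j = \sum_(j in D) q' j.
  by apply: (odd_addrr_inj oG); rewrite -!dbl qx qx' qy qy'.
rewrite (bigD1 a)//= [RHS](bigD1 a)//= => h.
have qa : q a = q' a.
  apply: (addIr (\sum_(i in D | i != a) q i)); rewrite h; congr (_ + _).
  apply: eq_bigr => i /andP[iD ia]; rewrite qq//.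
  by apply: contra bD => /eqP <-.
apply: (@sum_determined _ _ b); first by rewrite qx qx'.
by move=> j jb; have [->//|ja] := eqVneq j a; exact: qq.
Qed.

(** After passing to orderings, the two sums are exchanged: each of the at most 2^d mixed patterns D
    is realized by at most N^(d-2) tuples. *)
Lemma overlap_full x y : x != 0 -> y != - x ->
  (\sum_(S in rep_sets d x) #|[set P in rep_sets d y | (cl (mem P) == cl (mem S)) && (P != S)]| <=
   2 ^ d * #|G| ^ (d - 2))%N.
Proof.
move=> x0 yx.
pose phi S := #|[set P in rep_sets d y | (cl (mem P) == cl (mem S)) && (P != S)]|.
rewrite -/(\sum_(S in rep_sets d x) phi S)%N.
have h : (\sum_(S in rep_sets d x) phi S <= \sum_(q in rep_tuples d x) phi (im q))%N.
  have := @sum_rep_tuples G d int x (fun S => (phi S)%:R).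
  rewrite -!natr_sum -natrM => /eqP; rewrite eqr_nat => /eqP ->.
  by rewrite leq_pmull// fact_gt0.
apply: leq_trans h _.
apply: (@leq_trans (\sum_(q in rep_tuples d x) \sum_(D : {set 'I_d} |
    [&& D != finset.setT, D != finset.set0 & (\sum_j flip D q j)%R == y]) 1)).
  apply: leq_sum => q qU; rewrite sum1_card; apply: leq_trans (card_same_classes qU x0 yx) _.
  by apply: subset_leq_card; apply/fintype.subsetP => D; rewrite inE.
rewrite (exchange_big_dep (fun D => (D != finset.setT) && (D != finset.set0))) /=; last first.
  by move=> q D _ /and3P[-> ->].
have -> : (2 ^ d)%N = #|{: {set 'I_d}}|.
  by rewrite -cardsT -powersetT card_powerset cardsT card_ord.
rewrite -sum_nat_const [leqLHS]big_mkcond /=; apply: leq_sum => D _.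
case: ifP => // /andP[DT D0]; rewrite sum1_card.
apply: leq_trans (card_flip_le x y DT D0); apply: subset_leq_card.
by apply/fintype.subsetP => q; rewrite unfold_in DT D0 /= [in X in _ -> X]inE.
Qed.
End SameClasses.

Lemma big_tuple_cons (R : Type) (idx : R) (op : Monoid.com_law idx) (T : finType)
    (m : nat) (F : m.+1.-tuple T -> R) :
  \big[op/idx]_t F t = \big[op/idx]_a \big[op/idx]_(t : m.-tuple T) F [tuple of a :: t].
Proof.
rewrite pair_big /=.
rewrite (reindex (fun x : T * m.-tuple T => [tuple of x.1 :: x.2])) //=.
exists (fun t => (thead t, [tuple of behead t])) => [[a t] _|t _] /=.
  by congr pair; apply/val_inj.
by rewrite [RHS]tuple_eta; apply/val_inj.
Qed.

Section Degenerate.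
Variables (R : realFieldType) (G : finZmodType) (r : R) (d : nat).
Hypotheses (r0 : 0 <= r) (r1 : r <= 1).
Let A : R := #|G|%:R * r + (2 * d + 1)%:R.

Definition stale (s : seq G) : pred G := [pred a | ~~ fresh s a].

Lemma card_stale s : (#|stale s| <= 2 * size s + 1)%N.
Proof.
apply: (@leq_trans (size (0 :: s ++ map -%R s))).
  apply: leq_trans (card_size _); apply: subset_leq_card; apply/fintype.subsetP => a.
  rewrite !inE mem_cat /fresh !negb_and !negbK => /or3P[->//|->|h]; first by rewrite orbT.
  by rewrite -{3}[a]opprK map_f ?orbT.
by rewrite /= size_cat size_map; lia.
Qed.

Let wl (s : seq G) : R := r ^+ #|cl (mem s)|.

(** A further entry costs r when it opens a new class and nothing otherwise. The second case
    concerns 0 and the elements of s up to sign, at most 2 d + 1 in all, which explains A. *)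
Lemma sum_wl_cons s : (size s <= d)%N -> \sum_a wl (a :: s) <= wl s * A.
Proof.
move=> sd; apply: (@le_trans _ _ (\sum_a wl s * (r + (a \in stale s)%:R))).
  apply: ler_sum => a _; rewrite /wl card_cl_cons inE.
  case: fresh => /=; first by rewrite addn1 exprSr addr0.
  by rewrite addn0 ler_peMr ?exprn_ge0// lerDr.
rewrite -mulr_sumr ler_wpM2l ?exprn_ge0// big_split /= sumr_const /A mulr_natl lerD2l.
rewrite -natr_sum ler_nat -big_mkcond sum1_card; apply: leq_trans (card_stale s) _.
by rewrite leq_add2r leq_mul2l sd orbT.
Qed.

Lemma sum_wl_le m : (m <= d)%N -> \sum_(s : m.-tuple G) wl s <= A ^+ m.
Proof.
elim: m => [|m IH] md.
  rewrite (big_pred1 [tuple]); last by move=> t; rewrite [t]tuple0; symmetry; apply/eqP.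
  by rewrite /wl cl_nil cards0.
rewrite big_tuple_cons exchange_big /= exprSr.
apply: (@le_trans _ _ (\sum_(t : m.-tuple G) wl t * A)).
  by apply: ler_sum => t _; apply: sum_wl_cons; rewrite size_tuple ltnW.
rewrite -mulr_suml ler_wpM2r ?IH ?(ltnW md)//.
by rewrite /A addr_ge0// mulr_ge0.
Qed.

(** A degenerate tuple has a degenerate tail or a first entry that is stale for its tail; a stale
    entry contributes at most 2 d + 1 where a free one contributes A. Multiplying the left side by A
    replaces the exponent m - 1, which would be awkward at m = 0. *)
Lemma sum_wl_degen m : (m <= d)%N ->
  (\sum_(s : m.-tuple G | (#|cl (mem s)| < m)%N) wl s) * A <= (m * (2 * d + 1))%:R * A ^+ m.
Proof.
have A0 : 0 <= A by rewrite /A addr_ge0// mulr_ge0.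
have wl0 s : 0 <= wl s by exact: exprn_ge0.
elim: m => [|m IH] md; first by rewrite big_pred0 ?mul0r// mul0n mul0r.
rewrite big_mkcond big_tuple_cons exchange_big /=.
apply: (@le_trans _ _ ((\sum_(t : m.-tuple G) ((if (#|cl (mem t)| < m)%N then wl t else 0) * A +
   wl t * (2 * d + 1)%:R)) * A)).
  rewrite ler_wpM2r//; apply: ler_sum => t _.
  apply: (@le_trans _ _ (\sum_a ((if (#|cl (mem t)| < m)%N then wl (a :: t) else 0) +
     (a \in stale t)%:R * wl t))).
    apply: ler_sum => a _; rewrite [in X in X <= _]card_cl_cons inE.
    case: ifP => h; last by rewrite addr_ge0 ?mulr_ge0//; case: ifP.
    have fr : wl (a :: t) <= wl t.
      by rewrite /wl ler_wiXn2l// card_cl_cons leq_addr.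
    case: ifP => h'; first by rewrite lerDl mulr_ge0.
    rewrite add0r; move: h h'; case: fresh => /=; last by rewrite mul1r.
    by rewrite addn1 ltnS => ->.
  rewrite big_split /=; apply: lerD; last first.
    rewrite -mulr_suml mulrC ler_wpM2l// -natr_sum ler_nat -big_mkcond sum1_card.
    apply: leq_trans (card_stale t) _.
    by rewrite size_tuple leq_add2r leq_mul2l (ltnW md) orbT.
  case: ifP => _; last by rewrite big1 ?mul0r.
  by apply: sum_wl_cons; rewrite size_tuple ltnW.
rewrite big_split /= -!mulr_suml -big_mkcond /= exprSr mulrA ler_wpM2r//.
rewrite (mulSnr m) (natrD _ (m * _)) mulrDl lerD ?IH ?(ltnW md)//.
by rewrite mulrC ler_wpM2l// sum_wl_le// ltnW.
Qed.

End Degenerate.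

(** Summing over all targets x removes the constraint on the sum of the tuple. The resulting bound
    on average over x suffices, because the factorial moments sum over targets anyway. *)
Lemma sum_degen_le (R : realFieldType) (G : finZmodType) (r : R) (d : nat) :
  0 <= r -> r <= 1 -> (0 < d)%N ->
  \sum_x \sum_(q : d.-tuple G | degen x q) r ^+ #|cl (mem q)| <=
  (d * (2 * d + 1))%:R * (#|G|%:R * r + (2 * d + 1)%:R) ^+ d.-1.
Proof.
move=> r0 r1 d0.
have A0 : 0 < #|G|%:R * r + (2 * d + 1)%:R.
  by rewrite ltr_wpDl ?mulr_ge0// ltr0n addn1.
have -> : \sum_x \sum_(q : d.-tuple G | degen x q) r ^+ #|cl (mem q)| =
    \sum_(q : d.-tuple G | (#|cl (mem q)| < d)%N) r ^+ #|cl (mem q)|.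
  rewrite [RHS](partition_big (fun q : d.-tuple G => \sum_(a <- q) a) xpredT)//=.
  by apply: eq_bigr => x _; apply: eq_bigl => q; rewrite /degen andbC.
have := sum_wl_degen G r0 r1 (leqnn d).
have -> : (#|G|%:R * r + (2 * d + 1)%:R) ^+ d =
  (#|G|%:R * r + (2 * d + 1)%:R) ^+ d.-1 * (#|G|%:R * r + (2 * d + 1)%:R).
  by rewrite -exprSr prednK.
by rewrite mulrA ler_pM2r.
Qed.

Lemma big_enum_pair (R : Type) (idx : R) (op : Monoid.com_law idx) (I J : finType)
    (P : I -> pred J) (F : I * J -> R) :
  \big[op/idx]_(a <- enum [pred a : I * J | P a.1 a.2]) F a =
  \big[op/idx]_i \big[op/idx]_(j | P i j) F (i, j).
Proof.
by rewrite big_enum pair_big_dep /=; apply: eq_big => -[i j].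
Qed.

(** * Probability that prescribed classes are uncovered *)

Section Activity.
Variables (R : realType) (V : finType) (n : nat) (p : 'I_n.+1 -> R) (r : nat -> R).
Hypotheses (p_ge0 : forall l, 0 <= p l) (p_sum : \sum_l p l = 1).
Hypothesis p_r : forall i, (i < n)%N -> \sum_(l < n.+1 | (l <= i)%N) p l = r i.
Local Notation W := ({ffun V -> 'I_n.+1}).
Implicit Types (w : W) (C : {set V}) (i j : nat).

Definition all_le C i w := [forall v in C, (w v <= i)%N].

Lemma all_le_decr C i w w' : (forall v, w v <= w' v)%N -> all_le C i w' -> all_le C i w.
Proof.
move=> ww /forall_inP h; apply/forall_inP => v vC; exact: leq_trans (ww v) (h v vC).
Qed.

Lemma all_le_dep C i w w' : {in C, w =1 w'} -> all_le C i w = all_le C i w'.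
Proof.
by move=> ww; apply/eq_forallb => v; case: (boolP (v \in C)) => //= vC; rewrite ww.
Qed.

Lemma all_leE C i w : (all_le C i w)%:R = \prod_v (if v \in C then (w v <= i)%N%:R else 1) :> R.
Proof.
rewrite -big_mkcond /=; have [/forall_inP h|] := boolP (all_le C i w).
  by rewrite big1// => v vC; rewrite h.
rewrite negb_forall => /existsP[v]; rewrite negb_imply => /andP[vC wv].
by rewrite (bigD1 v)//= (negbTE wv) mul0r.
Qed.

Lemma sum_le_level i : (i < n)%N -> \sum_l p l * (l <= i)%N%:R = r i.
Proof.
move=> ii; rewrite -p_r// [RHS]big_mkcond; apply: eq_bigr => l _.
by case: ifP; rewrite ?mulr1 ?mulr0.
Qed.

Lemma Ex_all_le C i : (i < n)%N -> Ex p (fun w => (all_le C i w)%:R) = r i ^+ #|C|.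
Proof.
move=> ii; rewrite (eq_Ex _ (fun w => all_leE C i w)).
rewrite (Ex_prod p (fun v (l : 'I_n.+1) => if v \in C then (l <= i)%N%:R else 1)).
rewrite -prodr_const [RHS]big_mkcond /=; apply: eq_bigr => v _.
case: ifP => _; first exact: sum_le_level.
by under eq_bigr do rewrite mulr1; rewrite p_sum.
Qed.

Lemma Ex_all_le2 C C' i j rm : (i < n)%N -> (j < n)%N -> r i <= rm -> r j <= rm ->
  Ex p (fun w => (all_le C i w)%:R * (all_le C' j w)%:R) <= rm ^+ #|C :|: C'|%SET.
Proof.
move=> ii jj ri rj.
pose h v (l : 'I_n.+1) : R := if v \in C then (l <= i)%N%:R else
  if v \in C' then (l <= j)%N%:R else 1.
have h0 v l : 0 <= h v l by rewrite /h; case: ifP => // _; case: ifP.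
apply: (@le_trans _ _ (Ex p (fun w => \prod_v h v (w v)))).
  apply: le_Ex => // w; rewrite !all_leE -big_split /=; apply: ler_prod => v _.
  rewrite /h mulr_ge0 /=; do ?by case: ifP.
  by do 2?case: ifP; rewrite ?mulr1 ?mul1r// => _ _; do 2?case: (_ <= _)%N; rewrite ?mulr1 ?mulr0.
rewrite Ex_prod -prodr_const [leRHS]big_mkcond /=; apply: ler_prod => v _.
apply/andP; split; first by apply: sumr_ge0 => l _; exact: mulr_ge0.
rewrite finset.in_setU /h; case: (v \in C) => /=; first by rewrite sum_le_level.
case: (v \in C'); first by rewrite sum_le_level.
by under eq_bigr do rewrite mulr1; rewrite p_sum.
Qed.

End Activity.

(** The first term bounds pairs that share some but not all classes ([overlap_partial], with at most
    m^(d-1) sets S), the second pairs with the same classes ([overlap_full]). *)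
Definition overlap_bound (R : realType) (d m : nat) (rm : R) : R :=
  m%:R ^+ d.-1 * (rm ^+ d * ((d ^ 2)%:R *
    ((2 * d)%:R * rm * (m%:R * rm + (2 * d)%:R) ^+ (d - 2)))) +
  (2 ^ d)%:R * m%:R ^+ (d - 2) * rm ^+ d.

Section Uncovered.
Variables (R : realType) (G : finZmodType) (d n : nat) (p : 'I_n.+1 -> R) (r : nat -> R).
Hypotheses (oG : odd #|G|) (d1 : (1 < d)%N).
Hypotheses (p_ge0 : forall l, 0 <= p l) (p_sum : \sum_l p l = 1).
Hypothesis p_r : forall i, (i < n)%N -> \sum_(l < n.+1 | (l <= i)%N) p l = r i.
Local Notation V := (invQ G).
Local Notation W := ({ffun V -> 'I_n.+1}).
Implicit Types (w : W).

Definition uncov i w (xi : V) : bool :=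
  ~~ cov d [set eta : V | (w eta <= i)%N] (class_repr xi).

Lemma subset_all_le (C : {set V}) i w : (C \subset [set eta : V | (w eta <= i)%N]) = all_le C i w.
Proof.
apply/fintype.subsetP/forall_inP => h v vC; first by have := h v vC; rewrite inE.
by rewrite inE h.
Qed.

Variables (k : nat) (xs : 'I_k -> V) (e : 'I_k -> nat) (rm : R).
Hypotheses (xs_inj : injective xs) (e_lt : forall j, (e j < n)%N).
Hypotheses (r_le : forall j, r (e j) <= rm) (rm1 : rm <= 1).
Let x j : G := class_repr (xs j).

Lemma x_inj : injective x.
Proof.
move=> i j xij; apply: xs_inj; apply: (@mem_val_inj _ (x i)); first exact: class_reprP.
rewrite xij; exact: class_reprP.
Qed.

(** This is what excludes the global change of sign when [overlap_full] is applied, including the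
    case i = j. *)
Lemma x_neqN i j : x j != - x i.
Proof.
apply/eqP => xji; have ij : i = j.
  apply: xs_inj; apply: (@mem_val_inj _ (x i)); first exact: class_reprP.
  rewrite -val_invQN -xji; exact: class_reprP.
have : x i != 0 := class_repr_neq0 (xs i); rewrite -ij in xji; apply/negP; rewrite negbK; apply/eqP.
by apply: (odd_addrr_eq0 oG); rewrite {1}xji addNr.
Qed.

Lemma r_ge0 j : 0 <= r (e j).
Proof. by rewrite -p_r// sumr_ge0. Qed.

Let fam : seq ('I_k * {set G}) := enum [pred a : 'I_k * {set G} | a.2 \in rep_sets d (x a.1)].
Let b (a : 'I_k * {set G}) w := all_le (cl (mem a.2)) (e a.1) w.

Lemma rep_setsP y (S : {set G}) : S \in rep_sets d y -> [/\ #|S| = d, indep S & \sum_(a in S) a = y].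
Proof. by rewrite inE => /and3P[/eqP ? /eqP ? ?]. Qed.

Lemma overlap_pair i j : 0 <= rm ->
  \sum_(S in rep_sets d (x i)) \sum_(P in rep_sets d (x j) |
     ((j, P) != (i, S)) && ~~ [disjoint cl (mem S) & cl (mem P)])
     rm ^+ #|cl (mem S) :|: cl (mem P)|%SET <= overlap_bound d #|G| rm.
Proof.
move=> rm0; pose same (S P : {set G}) := (cl (mem P) == cl (mem S)) && (P != S).
apply: (@le_trans _ _ (\sum_(S in rep_sets d (x i)) (
   \sum_(P in rep_sets d (x j) | ~~ [disjoint cl (mem S) & cl (mem P)] && (cl (mem P) != cl (mem S)))
      rm ^+ #|cl (mem S) :|: cl (mem P)|%SET +
   \sum_(P in rep_sets d (x j) | same S P) rm ^+ d))).
  apply: ler_sum => S SP; rewrite big_mkcondr [X in _ <= X + _]big_mkcondr.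
  rewrite [X in _ <= _ + X]big_mkcondr -big_split /=; apply: ler_sum => P PP'.
  have e0 m : 0 <= rm ^+ m by exact: exprn_ge0.
  have [Sd Si Ss] := rep_setsP SP; have [Pd Pi Ps] := rep_setsP PP'.
  case: (boolP [disjoint _ & _]) => dis /=; first by rewrite andbF add0r; case: ifP.
  rewrite andbT /same; case: (eqVneq (cl (mem P)) (cl (mem S))) => [cPS|cPS] /=; last first.
    by rewrite addr0; case: ifP.
  rewrite add0r; have [PS|PS] := eqVneq P S; last first.
    by rewrite cPS finset.setUid indep_cl// Sd /=; case: ifP.
  (* Equal sets have equal sums, so a set belongs to one index only, and P = S is the excluded
     diagonal pair. *)
  have -> : j = i by apply: x_inj; rewrite -Ps PS Ss.
  by rewrite PS eqxx.
rewrite big_split /=; apply: lerD.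
  apply: (@le_trans _ _ (\sum_(S in rep_sets d (x i)) (rm ^+ d * ((d ^ 2)%:R *
    ((2 * d)%:R * rm * (#|G|%:R * rm + (2 * d)%:R) ^+ (d - 2)))))).
    apply: ler_sum => S SP; have [Sd Si Ss] := rep_setsP SP.
    by apply: overlap_partial => //; rewrite Sd.
  rewrite sumr_const -[leLHS]mulr_natl ler_wpM2r//.
    by rewrite !mulr_ge0// ?exprn_ge0// addr_ge0// mulr_ge0.
  rewrite -natrX ler_nat; apply: leq_trans (card_rep_tuples_le (x i) (ltnW d1)).
  by rewrite -card_rep_sets leq_pmull ?fact_gt0.
under eq_bigr do rewrite sumr_const -mulr_natl.
rewrite -mulr_suml ler_wpM2r ?exprn_ge0// -natr_sum -natrX -natrM ler_nat.
apply: leq_trans (overlap_full d oG (class_repr_neq0 (xs i)) (x_neqN i j)).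
apply: leq_sum => S _; apply: subset_leq_card; apply/fintype.subsetP => P.
by rewrite unfold_in [in X in _ -> X]inE.
Qed.

(* Janson's inequality over the pairs (j, S) with S a d-set summing to x j. *)
Lemma uncov_upper :
  Ex p (fun w => \prod_j (uncov (e j) w (xs j))%:R) <=
  expR (- \sum_j #|rep_sets d (x j)|%:R * r (e j) ^+ d + (k ^ 2)%:R * overlap_bound d #|G| rm).
Proof.
have bdecr a w w' : (forall v, w v <= w' v)%N -> b a w' -> b a w by exact: all_le_decr.
have bdep (a : 'I_k * {set G}) w w' : {in cl (mem a.2), w =1 w'} -> b a w = b a w' by exact: all_le_dep.
apply: (@le_trans _ _ (Ex p (none R b fam))).
  apply: le_Ex => // w; rewrite noneE.
  have [/allP h|/allPn[[j S]]] := boolP (all _ _).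
    by apply: prodr_ile1 => j _; case: uncov; rewrite ler01 lexx.
  rewrite mem_enum negbK /= => SP bS; rewrite (bigD1 j)//= /uncov.
  rewrite (_ : cov _ _ _) ?mul0r//; apply: cov_rep_set SP _; by rewrite subset_all_le.
apply: le_trans (janson p_ge0 p_sum bdecr bdep fam) _.
rewrite ler_expR; apply: lerD.
  rewrite lerN2 /fam (big_enum_pair _ (fun j S => S \in rep_sets d (x j))) /=.
  rewrite le_eqVlt; apply/orP; left; apply/eqP.
  apply: eq_bigr => j _; rewrite mulr_natl -sumr_const; apply: eq_bigr => S SP.
  by have [Sd Si _] := rep_setsP SP; rewrite /b /= (Ex_all_le p_sum p_r)// indep_cl// Sd.
apply: le_trans (delta_le p_ge0 _ _ _) _; first exact: enum_uniq.
rewrite {1}/fam (big_enum_pair _ (fun j S => S \in rep_sets d (x j))) /=.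
have -> : (k ^ 2)%:R * overlap_bound d #|G| rm = \sum_(i < k) \sum_(j < k) overlap_bound d #|G| rm.
  by rewrite !sumr_const card_ord -mulrnA mulr_natl -mulnn.
apply: ler_sum => i _.
have rm0 : 0 <= rm by apply: le_trans (r_ge0 i) (r_le i).
apply: (@le_trans _ _ (\sum_(S in rep_sets d (x i)) \sum_j \sum_(P in rep_sets d (x j) |
     ((j, P) != (i, S)) && ~~ [disjoint cl (mem S) & cl (mem P)])
     rm ^+ #|cl (mem S) :|: cl (mem P)|%SET)).
  apply: ler_sum => S SP; rewrite big_mkcond /= /fam.
  rewrite (big_enum_pair _ (fun j S => S \in rep_sets d (x j))) /=.
  apply: ler_sum => j _; rewrite [leRHS]big_mkcondr /=; apply: ler_sum => P _.
  by rewrite /meet /=; case: ifP => // _; exact: (Ex_all_le2 p_ge0 p_sum p_r).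
rewrite exchange_big /=; apply: ler_sum => j _; exact: overlap_pair.
Qed.

(* Harris' inequality for the d-sets, and a union bound for the degenerate tuples. *)
Lemma uncov_lower :
  (\prod_j (1 - r (e j) ^+ d) ^+ #|rep_sets d (x j)|) *
   (1 - \sum_j \sum_(q : d.-tuple G | degen (x j) q) r (e j) ^+ #|cl (mem q)|) <=
  Ex p (fun w => \prod_j (uncov (e j) w (xs j))%:R).
Proof.
have bdecr a w w' : (forall v, w v <= w' v)%N -> b a w' -> b a w by exact: all_le_decr.
pose fam' : seq ('I_k * d.-tuple G) := enum [pred a : 'I_k * d.-tuple G | degen (x a.1) a.2].
pose b' (a : 'I_k * d.-tuple G) w := all_le (cl (mem a.2)) (e a.1) w.
have bdecr' a w w' : (forall v, w v <= w' v)%N -> b' a w' -> b' a w by exact: all_le_decr.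
have rj01 j : 0 <= r (e j) <= 1 by rewrite r_ge0 (le_trans (r_le j)).
apply: (@le_trans _ _ (Ex p (none R b fam) * Ex p (none R b' fam'))).
  have -> : \prod_j (1 - r (e j) ^+ d) ^+ #|rep_sets d (x j)| =
      \prod_(a <- fam) (1 - Ex p (fun w => (b a w)%:R)).
    rewrite /fam (big_enum_pair _ (fun j S => S \in rep_sets d (x j))) /=.
    apply: eq_bigr => j _; rewrite -prodr_const; apply: eq_bigr => S SP.
    by have [Sd Si _] := rep_setsP SP; rewrite /b /= (Ex_all_le p_sum p_r)// indep_cl// Sd.
  apply: (@le_trans _ _ (\prod_(a <- fam) (1 - Ex p (fun w => (b a w)%:R)) * Ex p (none R b' fam'))).
    apply: ler_wpM2l.
      rewrite big_enum; apply: prodr_ge0 => -[j S] _.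
      rewrite /b /= (Ex_all_le p_sum p_r)// subr_ge0; apply: exprn_ile1; by case/andP: (rj01 j).
    apply: (@le_trans _ _ (Ex p (fun w => 1 - \sum_(a <- fam') (b' a w)%:R))); last first.
      by apply: le_Ex => // w; exact: none_ge.
    rewrite ExB Ex_cst// Ex_sum lerD2l lerN2 /fam' (big_enum_pair _ (fun j q => degen (x j) q)) /=.
    apply: ler_sum => j _; apply: ler_sum => q _; by rewrite /b' /= (Ex_all_le p_sum p_r).
  apply: ler_wpM2r; first by apply: Ex_ge0 => // w; exact: none_ge0.
  exact: harris_none.
apply: le_trans (harris p_ge0 p_sum (none_ge0 R b fam) (none_ge0 R b' fam') _ _) _.
- exact: incr_none.
- exact: incr_none.
apply: le_Ex => // w; rewrite !noneE -natrM mulnb.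
have [/andP[/allP h /allP h']|_] := boolP (_ && _); last by rewrite prodr_ge0.
rewrite big1// => j _; rewrite /uncov; case: (boolP (cov _ _ _)) => // /(covE oG)[].
  move=> [S SP]; rewrite subset_all_le => bS.
  by have := h (j, S); rewrite mem_enum unfold_in /= SP => /(_ isT); rewrite /b /= bS.
move=> [q qd]; rewrite subset_all_le => bq.
by have := h' (j, q); rewrite mem_enum unfold_in /= qd => /(_ isT); rewrite /b' /= bq.
Qed.

End Uncovered.

(** * Factorial moments and Bonferroni inequalities *)

Section DistinctSums.
Variables (R : realType) (V : finType).
Implicit Types (g f : V -> R) (gs : seq (V -> R)) (U : {set V}).

(* [isum [:: g1; ...; gk] set0] is the sum of g1 v1 * ... * gk vk over tuples of
   distinct vi; with indicator functions this is a product of falling factorials. *)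
Fixpoint isum gs U : R :=
  if gs is g :: gs' then \sum_(v | v \notin U) g v * isum gs' (v |: U)%SET else 1.

(** Linearity in each slot is what turns moments of tail counts into moments of interval counts. *)
Lemma isum_sub gs f g gs' U :
  isum (gs ++ (fun v => f v - g v) :: gs') U = isum (gs ++ f :: gs') U - isum (gs ++ g :: gs') U.
Proof.
elim: gs U => [|h gs IH] U /=.
  by rewrite -sumrB; apply: eq_bigr => v _; rewrite mulrBl.
by rewrite -sumrB; apply: eq_bigr => v _; rewrite IH mulrBr.
Qed.

Lemma isum_tuple (g : nat -> V -> R) (es : seq nat) U :
  isum [seq g e | e <- es] U =
  \sum_(t : (size es).-tuple V | uniq t && [disjoint t & U])
    \prod_(j < size es) g (nth 0%N es j) (tnth t j).
Proof.
elim: es U => [|e es IH] U /=.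
  rewrite (big_pred1 [tuple]) ?big_ord0// => t.
  rewrite [t]tuple0 /=; transitivity true; last by symmetry; apply/eqP.
  by apply/pred0P => v; rewrite inE.
rewrite [RHS]big_mkcond big_tuple_cons [LHS]big_mkcond /=; apply: eq_bigr => v _.
case: ifPn => vU; last first.
  rewrite big1// => t _; case: ifP => // /andP[_ /disjointFr h].
  by have := h v; rewrite mem_head => /(_ isT) vU'; rewrite vU' in vU.
rewrite IH mulr_sumr big_mkcond /=; apply: eq_bigr => t _.
have -> : (v \notin t) && uniq t && [disjoint v :: t & U] =
          uniq t && [disjoint t & (v |: U)%SET].
  rewrite disjoint_cons vU /= [(v \notin t) && _]andbC -andbA; congr (_ && _).
  rewrite ![[disjoint t & _]]disjoint_sym; apply/andP/idP.
    move=> [vt dU]; rewrite disjoint_subset; apply/fintype.subsetP => u.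
    rewrite !inE => /orP[/eqP ->//|uU]; by rewrite (disjointFr dU).
  move=> h; split; first by rewrite (disjointFr h)// !inE eqxx.
  by apply: disjointWl h; apply/fintype.subsetP => u uU; rewrite !inE uU orbT.
case: ifP => // _; rewrite big_ord_recl /= (tnth_nth v) /=; congr (_ * _).
by apply: eq_bigr => j _; rewrite !(tnth_nth v).
Qed.

Section Cells.
Variables (J : finType) (A : J -> {set V}) (W : {set V}).
Hypothesis A_disj : forall i j v, v \in A i -> v \in A j -> i = j.
Hypothesis A_sub : forall j, A j \subset W.
Local Notation gA j := (fun v => (v \in A j)%:R : R).
Local Notation gW := (fun v => (v \in W)%:R : R).

Lemma cardsD_add v U (B : {set V}) : v \in B -> v \notin U ->
  #|(B :\: (v |: U))%SET| = #|(B :\: U)%SET|.-1.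
Proof.
move=> vB vU; rewrite [in RHS](cardsD1 v) !inE vB vU /=; congr #|pred_of_set _|.
by apply/setP => u; rewrite !inE negb_or -andbA andbCA; case: (u == v); rewrite /= ?andbF.
Qed.

Lemma sum_const_set (B : {set V}) U (h : V -> R) c :
  (forall v, v \in B -> v \notin U -> h v = c) ->
  \sum_(v | v \notin U) (v \in B)%:R * h v = #|(B :\: U)%SET|%:R * c.
Proof.
move=> hc; rewrite mulr_natl -sumr_const big_mkcond [RHS]big_mkcond /=.
apply: eq_bigr => v _; rewrite inE; case: (boolP (v \in U)) => //= vU.
by case: (boolP (v \in B)) => vB; rewrite ?mul1r ?mul0r//; exact: hc.
Qed.

Lemma isum_window l U : isum (nseq l gW) U = (#|(W :\: U)%SET| ^_ l)%:R.
Proof.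
elim: l U => [|l IH] U //=.
rewrite (sum_const_set (c := (#|(W :\: U)%SET|.-1 ^_ l)%:R)).
  by rewrite -natrM -ffactnS.
by move=> v vW vU; rewrite IH cardsD_add.
Qed.

(** Choosing an element of a cell lowers the count of that cell and of the window by one and leaves
    the other cells alone, whence the falling factorials. *)
Lemma isum_cells (js : seq J) l U :
  isum ([seq gA j | j <- js] ++ nseq l gW) U =
  ((\prod_j #|(A j :\: U)%SET| ^_ (count_mem j js)) *
    (#|(W :\: U)%SET| - size js) ^_ l)%:R.
Proof.
elim: js U => [|i js IH] U; first by rewrite /= isum_window subn0 big1 ?mul1n.
rewrite [LHS]/= (sum_const_set (c := ((\prod_j (#|(A j :\: U)%SET| - (j == i)) ^_ (count_mem j js)) *
    (#|(W :\: U)%SET| - (size js).+1) ^_ l)%:R)).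
  rewrite -natrM mulnA; congr ((_ * _)%:R).
  rewrite (bigD1 i)//= [RHS](bigD1 i)//= !eqxx subn1 mulnA add1n ffactnS; congr muln.
  by apply: eq_bigr => j ji; rewrite (negbTE ji) [i == j]eq_sym (negbTE ji) subn0.
move=> v vA vU; rewrite IH cardsD_add//; last by move/fintype.subsetP: (A_sub i); apply.
congr ((_ * _ ^_ _)%:R); last by rewrite -subn1 -subnDA add1n.
apply: eq_bigr => j _; have [->|ji] := eqVneq j i; first by rewrite cardsD_add// subn1.
rewrite subn0; congr (#|pred_of_set _| ^_ _); apply/setP => u; rewrite !inE negb_or.
case: (boolP (u \in A j)) => //= uA; last by rewrite !andbF.
by rewrite !andbT; case: eqP => //= uv; rewrite uv in uA; rewrite (A_disj uA vA) eqxx in ji.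
Qed.

Hypothesis W_card : #|W| = (\sum_j #|A j|)%N.

Definition label_seq (c : J -> nat) : seq J := flatten [seq nseq (c j) j | j <- enum J].

Lemma count_label_seq c j : count_mem j (label_seq c) = c j.
Proof.
rewrite /label_seq count_flatten -map_comp.
rewrite (eq_map (g := fun i => if i == j then c i else 0%N)); last first.
  by move=> i /=; rewrite count_nseq /= eq_sym; case: eqP; rewrite ?mul1n ?mul0n.
by rewrite sumnE big_map big_enum /= -big_mkcond /= big_pred1_eq.
Qed.

Lemma size_label_seq c : size (label_seq c) = (\sum_j c j)%N.
Proof.
rewrite /label_seq size_flatten /shape -map_comp sumnE big_map big_enum /=.
by apply: eq_bigr => j _; rewrite /= size_nseq.
Qed.

(** For positive n the truncated alternating sum collapses, by Pascal's rule, to a single signed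
    binomial coefficient of n - 1. *)
Lemma bonferroni (n k : nat) :
  `|(n == 0)%:R - \sum_(l < k) (-1) ^+ l * 'C(n, l)%:R| <= 'C(n, k)%:R :> R.
Proof.
case: k => [|k]; first by rewrite big_ord0 subr0 bin0 normr_nat lern1 leq_b1.
case: n => [|n].
  rewrite big_ord_recl bin0 expr0 mul1r big1 ?addr0 ?subrr ?normr0 ?ler0n//.
  by move=> i _; rewrite bin0n mulr0.
have -> : \sum_(l < k.+1) (-1) ^+ l * 'C(n.+1, l)%:R = (-1) ^+ k * 'C(n, k)%:R :> R.
  elim: k => [|k IH]; first by rewrite big_ord_recr big_ord0 /= !bin0 add0r.
  by rewrite big_ord_recr /= IH binS natrD exprS; ring.
by rewrite sub0r normrN normrM normrX normrN1 expr1n mul1r normr_nat ler_nat binS leq_addl.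
Qed.

(** Let F be the product of the falling factorials of the cell counts and m the number of window
    elements beyond the total of c. F vanishes unless every count is at least c j, and then m = 0
    exactly when all counts are equal to c. So the event is detected by F and m = 0, and one
    alternating sum in m replaces one per cell. *)
Lemma pmf_bonferroni (c : J -> nat) (k : nat) :
  `|(\prod_j (c j)`!)%:R * [forall j, #|A j| == c j]%:R -
    \sum_(l < k) (-1) ^+ l / l`!%:R *
      isum ([seq gA j | j <- label_seq c] ++ nseq l gW) finset.set0|
  <= isum ([seq gA j | j <- label_seq c] ++ nseq k gW) finset.set0 / k`!%:R.
Proof.
set F := (\prod_j #|A j| ^_ (c j))%N; set m := (#|W| - \sum_j c j)%N.
have isE l : isum ([seq gA j | j <- label_seq c] ++ nseq l gW) finset.set0 = (F * m ^_ l)%:R.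
  rewrite isum_cells size_label_seq finset.setD0; congr ((_ * _)%:R).
  by apply: eq_bigr => j _; rewrite finset.setD0 count_label_seq.
have binE l : (m ^_ l)%:R / l`!%:R = 'C(m, l)%:R :> R.
  by rewrite -bin_ffact natrM mulfK// pnatr_eq0 -lt0n fact_gt0.
rewrite isE natrM -mulrA binE.
have -> : \sum_(l < k) (-1) ^+ l / l`!%:R *
    isum ([seq gA j | j <- label_seq c] ++ nseq l gW) finset.set0 =
    F%:R * \sum_(l < k) (-1) ^+ l * 'C(m, l)%:R.
  rewrite mulr_sumr; apply: eq_bigr => l _; rewrite isE -binE natrM; ring.
have -> : (\prod_j (c j)`!)%:R * [forall j, #|A j| == c j]%:R = F%:R * (m == 0%N)%:R :> R.
  rewrite -!natrM; congr (_%:R).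
  have [/forallP h|] := boolP [forall j, c j <= #|A j|]%N; last first.
    rewrite negb_forall => /existsP[j]; rewrite -ltnNge => hj.
    have -> : F = 0%N by rewrite /F (bigD1 j)//= ffact_small// mul0n.
    rewrite !mul0n.
    have [/forallP h|_] := boolP [forall j, #|A j| == c j]; last by rewrite muln0.
    by rewrite (eqP (h j)) ltnn in hj.
  have -> : (m == 0%N) = [forall j, #|A j| == c j].
    rewrite /m W_card subn_eq0; apply/idP/forallP => [le j|e]; last first.
      by apply: leq_sum => j _; rewrite (eqP (e j)).
    have : (\sum_j c j <= \sum_j #|A j|)%N by apply: leq_sum.
    move=> ge; rewrite eqn_leq h andbT; apply: contraTT le; rewrite -!ltnNge => hj.
    rewrite (bigD1 j)//= [X in (_ < X)%N](bigD1 j)//= -addSn; apply: leq_add => //.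
    exact: leq_sum.
  have [/forallP e|_] := boolP [forall j, #|A j| == c j]; last by rewrite !muln0.
  by rewrite !muln1 /F; apply: eq_bigr => j _; rewrite (eqP (e j)) ffactnn.
rewrite -mulrBr normrM normr_nat ler_wpM2l//; exact: bonferroni.
Qed.

End Cells.
End DistinctSums.

Section PoissonLimit.
Local Open Scope classical_set_scope.
Variable R : realType.

Lemma cvg_sumr (I : Type) (r : seq I) (u : I -> nat -> R) (l : I -> R) :
  (forall i, u i n @[n --> \oo] --> l i) ->
  \sum_(i <- r) u i n @[n --> \oo] --> \sum_(i <- r) l i.
Proof.
move=> ul; elim: r => [|i r IH].
  rewrite big_nil; under eq_fun do rewrite big_nil; exact: cvg_cst.
by rewrite big_cons; under eq_fun do rewrite big_cons; apply: cvgD.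
Qed.

(** The truncation order k is chosen first, so that both the remainder of the exponential series and
    its kth term are small; only then does n grow. Of the four errors eps / 4, two go to the bound
    on [s k n / k!]. *)
Lemma bonferroni_limit (a : nat -> R) (s : nat -> nat -> R) (C L : R) :
  (forall n k, `|a n - \sum_(l < k) (-1) ^+ l / l`!%:R * s l n| <= s k n / k`!%:R) ->
  (forall l, s l n @[n --> \oo] --> C * L ^+ l) ->
  a n @[n --> \oo] --> C * expR (- L).
Proof.
move=> ha hs; apply/cvgrPdist_le => eps eps0.
have cs : C * (exp_coeff L k) @[k --> \oo] --> C * 0.
  by apply: cvgM; [exact: cvg_cst|exact: cvg_exp_coeff].
have ce : C * (series (exp_coeff (- L)) k) @[k --> \oo] --> C * expR (- L).
  by apply: cvgM; [exact: cvg_cst|exact: is_cvg_series_exp_coeff].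
have e4 : 0 < eps / 4 by rewrite divr_gt0.
rewrite mulr0 in cs.
move/cvgrPdist_le : cs => /(_ _ e4) [k1 _ hk1].
move/cvgrPdist_le : ce => /(_ _ e4) [k2 _ hk2].
pose k := maxn k1 k2.
have := hk1 k (leq_maxl _ _); have := hk2 k (leq_maxr _ _); rewrite /= => H2 H1.
have c1 : \sum_(l < k) (-1) ^+ l / l`!%:R * s l n @[n --> \oo] -->
    \sum_(l < k) (-1) ^+ l / l`!%:R * (C * L ^+ l).
  by apply: cvg_sumr => l; apply: cvgM; [exact: cvg_cst|exact: hs].
have c2 : s k n / k`!%:R @[n --> \oo] --> C * L ^+ k / k`!%:R.
  by apply: cvgM; [exact: hs|exact: cvg_cst].
have E : \sum_(l < k) (-1) ^+ l / l`!%:R * (C * L ^+ l) = C * series (exp_coeff (- L)) k.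
  rewrite /series /= big_mkord mulr_sumr; apply: eq_bigr => l _.
  rewrite /exp_coeff /= [(- L) ^+ l]exprNn; by ring.
rewrite E in c1.
have E2 : C * L ^+ k / k`!%:R = C * exp_coeff L k by rewrite /exp_coeff /= mulrA.
rewrite E2 in c2.
move/cvgrPdist_le : c1 => /(_ _ e4) c1; move/cvgrPdist_le : c2 => /(_ _ e4) c2.
near=> n.
have B1 : `|C * series (exp_coeff (- L)) k - \sum_(l < k) (-1) ^+ l / l`!%:R * s l n| <= eps / 4.
  by near: n.
have B2 : `|C * exp_coeff L k - s k n / k`!%:R| <= eps / 4 by near: n.
have B3 := ha n k.
rewrite sub0r normrN in H1.
have B4 : s k n / k`!%:R <= eps / 4 + eps / 4.
  rewrite -lerBlDl; apply: le_trans B2; rewrite distrC.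
  apply: le_trans (ler_norm _).
  by rewrite lerD2l lerN2 (le_trans (ler_norm _)).
apply: (le_trans (ler_distD (C * series (exp_coeff (- L)) k) _ _)).
have -> : eps = eps / 4 + (eps / 4 + (eps / 4 + eps / 4)) by field.
apply: lerD; first by rewrite distrC in H2; rewrite distrC.
apply: (le_trans (ler_distD (\sum_(l < k) (-1) ^+ l / l`!%:R * s l n) _ _)).
apply: lerD => //.
by rewrite distrC; apply: le_trans B3 B4.
Unshelve. all: by end_near.
Qed.

Lemma cvg0_of_expr (u : nat -> R) (d : nat) : (0 < d)%N -> (forall n, 0 <= u n) ->
  u n ^+ d @[n --> \oo] --> 0 -> u n @[n --> \oo] --> 0.
Proof.
move=> d0 u0 /cvgrPdist_lt h; apply/cvgrPdist_lt => eps eps0.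
have := h _ (exprn_gt0 d eps0); apply: filterS => n.
rewrite !sub0r !normrN !ger0_norm ?exprn_ge0//.
by rewrite ltr_pXn2r// nnegrE// ltW.
Qed.

Lemma cvg0_le (u v : nat -> R) : (\forall n \near \oo, 0 <= u n <= v n) ->
  v n @[n --> \oo] --> 0 -> u n @[n --> \oo] --> 0.
Proof.
move=> uv v0; apply: (@squeeze_cvgr _ _ _ _ (fun=> 0) v) => //; exact: cvg_cst.
Qed.

(** * Asymptotics of the thresholds *)

Section Asymptotics.
Variables (d : nat) (z : R) (N : nat -> nat).
Hypotheses (d1 : (1 < d)%N) (N_oo : N n @[n --> \oo] --> \oo).

(* For m = #|G|: Z < z iff tau^d < rho z, i.e. iff tau < thr z.  [thr] is junk
   when [rho] is negative, which happens only for small m. *)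
Definition nclass (m : nat) : R := (m%:R - 1) / 2.
Definition alpha (m : nat) : R := z + ln (nclass m).
Definition rho (m : nat) : R := alpha m * d`!%:R / m%:R ^+ d.-1.
Definition thr (m : nat) : R := rho m `^ d%:R^-1.

Local Notation M n := (nclass (N n)).
Local Notation a n := (alpha (N n)).

Lemma near_N (c : R) : \forall n \near \oo, c <= (N n)%:R.
Proof. by move/cvgrnyP : N_oo => /(_ R)/cvgryPge. Qed.

Lemma alpha_oo : a n @[n --> \oo] --> +oo.
Proof.
apply/cvgryPge => A; near=> n.
have hN : 2 * expR (A - z) + 1 <= (N n)%:R by near: n; exact: near_N.
have hM : expR (A - z) <= M n by rewrite /nclass ler_pdivlMr// mulrC lerBrDr.
rewrite /alpha -lerBlDl -[leLHS](expRK) ler_ln ?posrE ?expR_gt0//.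
exact: lt_le_trans (expR_gt0 _) hM.
Unshelve. all: by end_near.
Qed.

Lemma near_alpha (c : R) : \forall n \near \oo, c <= a n.
Proof. by move/cvgryPge : alpha_oo. Qed.

Lemma near_nclass : \forall n \near \oo, 0 < M n.
Proof.
near=> n; have : 2 <= (N n)%:R :> R by near: n; exact: near_N.
by rewrite /nclass => h; rewrite divr_gt0// subr_gt0; apply: lt_le_trans h; rewrite ltr1n.
Unshelve. all: by end_near.
Qed.

(** The exponential of alpha is a constant times M, and it dominates the Taylor term of degree k +
    1. One spare power of alpha remains in the denominator. *)
Lemma alpha_expr_cvg0 k : a n ^+ k / (N n)%:R @[n --> \oo] --> 0.
Proof.
pose C : R := k.+1`!%:R * expR z.
apply: (@cvg0_le _ (fun n => C * (a n)^-1)); last first.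
  rewrite -[X in _ --> X](mulr0 C); apply: cvgM; first exact: cvg_cst.
  apply/gtr0_cvgV0; last exact: alpha_oo.
  by apply: filterS (near_alpha 1) => n; exact: lt_le_trans.
near=> n.
have a1 : 1 <= a n by near: n; exact: near_alpha.
have a0 : 0 < a n by exact: lt_le_trans a1.
have M0 : 0 < M n by near: n; exact: near_nclass.
have N1 : 1 <= (N n)%:R :> R by near: n; exact: near_N.
have N0 : 0 < (N n)%:R :> R by exact: lt_le_trans N1.
rewrite divr_ge0 ?exprn_ge0 ?(ltW a0)//=.
rewrite ler_pdivlMr// mulrAC ler_pdivrMr// -exprSr /C.
have := expR_ge1Dxn k (ltW a0); rewrite {2}/alpha expRD lnK ?posrE// => h.
have : a n ^+ k.+1 / k.+1`!%:R <= expR z * M n by apply: le_trans h; rewrite lerDr.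
rewrite ler_pdivrMr ?ltr0n ?fact_gt0// => /le_trans; apply.
rewrite mulrC mulrA ler_wpM2l// ?mulr_ge0 ?expR_ge0//.
rewrite /nclass ler_pdivrMr//; lra.
Unshelve. all: by end_near.
Qed.

Lemma near_thr_expr : \forall n \near \oo, thr (N n) ^+ d = rho (N n).
Proof.
near=> n.
have a1 : 1 <= a n by near: n; exact: near_alpha.
have r0 : 0 <= rho (N n).
  by rewrite /rho divr_ge0 ?exprn_ge0// mulr_ge0// (le_trans _ a1).
rewrite /thr -powR_mulrn ?powR_ge0// -powRrM mulVf ?powRr1//.
by rewrite pnatr_eq0 -lt0n ltnW.
Unshelve. all: by end_near.
Qed.

Lemma thr_ge0 m : 0 <= thr m. Proof. exact: powR_ge0. Qed.

(** The common scale of the partial overlaps and of the degenerate tuples, N^(-1/d) up to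
    logarithms. *)
Let y n : R := a n * ((N n)%:R * thr (N n)) ^+ d.-1 / (N n)%:R.

Lemma near_Nthr : \forall n \near \oo, ((N n)%:R * thr (N n)) ^+ d = (N n)%:R * a n * d`!%:R.
Proof.
near=> n.
have N1 : 1 <= (N n)%:R :> R by near: n; exact: near_N.
have N0 : (N n)%:R != 0 :> R by rewrite gt_eqF// (lt_le_trans _ N1).
rewrite exprMn (near near_thr_expr n)// /rho.
case: (d) d1 => // d' _; rewrite [d'.+1.-1]/= exprS; field.
by rewrite expf_neq0.
Unshelve. all: by end_near.
Qed.

(** The dth power removes the root in [thr] and is a constant times alpha^(2d-1) / N. *)
Lemma y_cvg0 : y n @[n --> \oo] --> 0.
Proof.
have d0 : (0 < d)%N by exact: ltnW.
apply: (@cvg0_le _ (fun n => `|y n|)).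
  near=> n; rewrite ler_norm andbT /y divr_ge0// mulr_ge0//.
    by apply: le_trans (_ : 1 <= _) => //; near: n; exact: near_alpha.
  by rewrite exprn_ge0// mulr_ge0// thr_ge0.
apply: (cvg0_of_expr d0) => //.
have h : d`!%:R ^+ d.-1 * (a n ^+ (d + d.-1) / (N n)%:R) @[n --> \oo] --> 0.
  rewrite -[X in _ --> X](mulr0 (d`!%:R ^+ d.-1)).
  by apply: cvgM; [exact: cvg_cst|exact: alpha_expr_cvg0].
apply: cvg_trans h; apply: near_eq_cvg; near=> n.
have N1 : 1 <= (N n)%:R :> R by near: n; exact: near_N.
have N0 : (N n)%:R != 0 :> R by rewrite gt_eqF// (lt_le_trans _ N1).
have a1 : 1 <= a n by near: n; exact: near_alpha.
have e := near near_Nthr n.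
rewrite ger0_norm; last first.
  rewrite /y divr_ge0// mulr_ge0//; first exact: le_trans a1.
  by rewrite exprn_ge0// mulr_ge0// thr_ge0.
have -> : y n ^+ d = a n ^+ d * ((N n)%:R * a n * d`!%:R) ^+ d.-1 / (N n)%:R ^+ d.
  by rewrite -e// /y expr_div_n exprMn -!exprM mulnC.
rewrite !exprMn exprD.
move: d0 N0; case: (d) => // d' _ N0; rewrite [d'.+1.-1]/= [(N n)%:R ^+ d'.+1]exprS; field.
by rewrite N0 expf_neq0.
Unshelve. all: by end_near.
Qed.

(** Used to absorb additive constants: X + c <= (1 + c) X for X >= 1. *)
Lemma near_Nthr_ge1 : \forall n \near \oo, 1 <= (N n)%:R * thr (N n).
Proof.
near=> n.
have N1 : 1 <= (N n)%:R :> R by near: n; exact: near_N.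
have a1 : 1 <= a n by near: n; exact: near_alpha.
have x0 : 0 <= (N n)%:R * thr (N n) by rewrite mulr_ge0// thr_ge0.
rewrite leNgt; apply/negP => lt1.
have : ((N n)%:R * thr (N n)) ^+ d < 1 by rewrite exprn_ilt1// -lt0n ltnW.
rewrite (near near_Nthr n)// ltNge => /negP; apply.
by rewrite -[leLHS]mulr1 -[leLHS]mulr1 !ler_pM// ?mulr_ge0// ler1n fact_gt0.
Unshelve. all: by end_near.
Qed.

Lemma alpha_rho_cvg0 : a n * rho (N n) @[n --> \oo] --> 0.
Proof.
apply: (@cvg0_le _ (fun n => d`!%:R * (a n ^+ 2 / (N n)%:R))); last first.
  rewrite -[X in _ --> X](mulr0 (d`!%:R)).
  by apply: cvgM; [exact: cvg_cst|exact: alpha_expr_cvg0].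
near=> n.
have N1 : 1 <= (N n)%:R :> R by near: n; exact: near_N.
have a1 : 1 <= a n by near: n; exact: near_alpha.
have a0 : 0 <= a n by exact: le_trans a1.
rewrite /rho mulr_ge0 ?divr_ge0 ?exprn_ge0 ?mulr_ge0//=.
rewrite mulrA [leRHS]mulrA [d`!%:R * _]mulrC mulrA -expr2 ler_wpM2l ?mulr_ge0 ?exprn_ge0//.
rewrite lef_pV2 ?posrE ?exprn_gt0 ?(lt_le_trans _ N1)//.
by rewrite -[leLHS]expr1; apply: ler_weXn2l => //; rewrite -ltnS prednK// ltnW.
Unshelve. all: by end_near.
Qed.

Lemma rho_cvg0 : rho (N n) @[n --> \oo] --> 0.
Proof.
apply: (@cvg0_le _ (fun n => a n * rho (N n))); last exact: alpha_rho_cvg0.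
near=> n.
have a1 : 1 <= a n by near: n; exact: near_alpha.
have r0 : 0 <= rho (N n).
  by rewrite /rho divr_ge0 ?exprn_ge0// mulr_ge0// (le_trans _ a1).
by rewrite r0 /= ler_peMl.
Unshelve. all: by end_near.
Qed.

Lemma near_thr_le1 : \forall n \near \oo, thr (N n) <= 1.
Proof.
have /cvgrPdist_lt/(_ _ ltr01) h := rho_cvg0.
near=> n; rewrite leNgt; apply/negP => lt1.
have : 1 < thr (N n) ^+ d by rewrite exprn_egt1// -lt0n ltnW.
rewrite (near near_thr_expr n)//; apply/negP; rewrite -leNgt.
apply: le_trans (ler_norm _) _; rewrite -normrN -sub0r.
by apply/ltW; near: n.
Unshelve. all: by end_near.
Qed.

Lemma overlap_bound_cvg0 : overlap_bound d (N n) (thr (N n)) @[n --> \oo] --> 0.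
Proof.
(* C y bounds the partial overlaps, and C' alpha / N the pairs that differ by sign changes. *)
pose C : R := d`!%:R * (d ^ 2)%:R * (2 * d)%:R * (1 + (2 * d)%:R) ^+ (d - 2).
pose C' : R := (2 ^ d)%:R * d`!%:R.
apply: (@cvg0_le _ (fun n => C * y n + C' * (a n ^+ 1 / (N n)%:R))); last first.
  have h : C * y n + C' * (a n ^+ 1 / (N n)%:R) @[n --> \oo] --> C * 0 + C' * 0.
    apply: cvgD.
      by apply: cvgM; [exact: cvg_cst|exact: y_cvg0].
    by apply: cvgM; [exact: cvg_cst|exact: alpha_expr_cvg0].
  by rewrite !mulr0 addr0 in h.
near=> n.
have N1 : 1 <= (N n)%:R :> R by near: n; exact: near_N.
have N0 : (N n)%:R != 0 :> R by rewrite gt_eqF// (lt_le_trans _ N1).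
have a1 : 1 <= a n by near: n; exact: near_alpha.
have a0 : 0 <= a n by exact: le_trans a1.
have t0 := thr_ge0 (N n).
have x1 : 1 <= (N n)%:R * thr (N n) by near: n; exact: near_Nthr_ge1.
have x0 : 0 <= (N n)%:R * thr (N n) by exact: le_trans x1.
have e := near near_thr_expr n.
rewrite /overlap_bound e//.
have r0 : 0 <= rho (N n) by rewrite /rho divr_ge0 ?exprn_ge0// mulr_ge0.
apply/andP; split.
  by rewrite addr_ge0// !mulr_ge0// ?exprn_ge0// addr_ge0.
have rE : (N n)%:R ^+ d.-1 * rho (N n) = a n * d`!%:R.
  by rewrite /rho mulrC divfK// expf_neq0.
apply: lerD; last first.
  have -> : (2 ^ d)%:R * (N n)%:R ^+ (d - 2) * rho (N n) = C' * (a n ^+ 1 / (N n)%:R).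
    rewrite /C' /rho expr1; case: (d) d1 => [//|[//|d']] _.
    rewrite [d'.+2.-1]/= subSS subSS subn0 exprS; field.
    by rewrite N0 expf_neq0.
  exact: lexx.
rewrite mulrA rE /C /y.
have -> : a n * d`!%:R * ((d ^ 2)%:R * ((2 * d)%:R * thr (N n) *
    ((N n)%:R * thr (N n) + (2 * d)%:R) ^+ (d - 2))) =
    d`!%:R * (d ^ 2)%:R * (2 * d)%:R * (a n * (thr (N n) *
    ((N n)%:R * thr (N n) + (2 * d)%:R) ^+ (d - 2))) by ring.
rewrite -[leRHS]mulrA ler_wpM2l ?mulr_ge0//.
rewrite -[a n * _ / _]mulrA [leRHS]mulrCA ler_wpM2l//.
have -> : ((N n)%:R * thr (N n)) ^+ d.-1 / (N n)%:R =
    thr (N n) * ((N n)%:R * thr (N n)) ^+ (d - 2).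
  case: (d) d1 => [//|[//|d']] _; rewrite [d'.+2.-1]/= subSS subSS subn0 exprS.
  by field.
rewrite [leRHS]mulrCA ler_wpM2l// -exprMn lerXn2r ?nnegrE ?addr_ge0 ?mulr_ge0//.
by rewrite mulrDl mul1r lerD2l ler_peMr.
Unshelve. all: by end_near.
Qed.

Lemma degen_cvg0 : ((N n)%:R * thr (N n) + (2 * d + 1)%:R) ^+ d.-1 / M n @[n --> \oo] --> 0.
Proof.
(* The factor 3 comes from N <= 3 M, valid for N >= 3. *)
pose C : R := 3 * (1 + (2 * d + 1)%:R) ^+ d.-1.
apply: (@cvg0_le _ (fun n => C * y n)); last first.
  rewrite -[X in _ --> X](mulr0 C); apply: cvgM; [exact: cvg_cst|exact: y_cvg0].
near=> n.
have N1 : 3 <= (N n)%:R :> R by near: n; exact: near_N.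
have N0 : 0 < (N n)%:R :> R by rewrite (lt_le_trans _ N1).
have a1 : 1 <= a n by near: n; exact: near_alpha.
have a0 : 0 <= a n by exact: le_trans a1.
have M0 : 0 < M n by near: n; exact: near_nclass.
have t0 := thr_ge0 (N n).
have x1 : 1 <= (N n)%:R * thr (N n) by near: n; exact: near_Nthr_ge1.
have x0 : 0 <= (N n)%:R * thr (N n) by exact: le_trans x1.
rewrite divr_ge0 ?exprn_ge0 ?addr_ge0 ?(ltW M0)//= /C /y.
rewrite ler_pdivrMr//.
have h1 : ((N n)%:R * thr (N n) + (2 * d + 1)%:R) ^+ d.-1 <=
   (1 + (2 * d + 1)%:R) ^+ d.-1 * ((N n)%:R * thr (N n)) ^+ d.-1.
  rewrite -exprMn lerXn2r ?nnegrE ?addr_ge0 ?mulr_ge0//.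
  by rewrite mulrDl mul1r lerD2l ler_peMr.
apply: le_trans h1 _.
have h2 : 1 <= 3 * a n * M n / (N n)%:R.
  rewrite ler_pdivlMr// mul1r; apply: (@le_trans _ _ (3 * M n)).
    rewrite /nclass; lra.
  by rewrite -mulrA ler_wpM2l// ler_peMl// ltW.
have -> : 3 * (1 + (2 * d + 1)%:R) ^+ d.-1 *
   (a n * ((N n)%:R * thr (N n)) ^+ d.-1 / (N n)%:R) * M n =
   (1 + (2 * d + 1)%:R) ^+ d.-1 * ((N n)%:R * thr (N n)) ^+ d.-1 *
   (3 * a n * M n / (N n)%:R) by field; rewrite gt_eqF.
by rewrite ler_peMr// mulr_ge0// exprn_ge0// addr_ge0.
Unshelve. all: by end_near.
Qed.

End Asymptotics.
End PoissonLimit.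

(** * Factorial moments of the tail counts *)

Section ClassCount.
Variable G : finZmodType.
Hypothesis oG : odd #|G|.

Lemma card_invQ : #|G| = (2 * #|{: invQ G}|).+1.
Proof.
have h2 (xi : invQ G) : #|val xi| = 2%N.
  have [a a0 ->] := invQP xi; rewrite cards2; case: eqP => // aN.
  by rewrite (odd_addrr_eq0 oG (x := a)) ?eqxx// in a0; rewrite {1}aN addNr.
have h1 (x : G) : #|[set xi : invQ G | x \in val xi]%SET| = (x != 0).
  have := card_cl_cons x [::]; rewrite cl_nil cards0 add0n /fresh !andbT => <-.
  apply: eq_card => xi; rewrite inE; apply/idP/clP => [h|[b]]; first by exists x; rewrite ?inE.
  by rewrite !inE => /eqP ->.
rewrite mulnC -sum_nat_const (eq_bigr (fun xi : invQ G => #|val xi|)); last by move=> xi _; rewrite h2.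
under eq_bigr do rewrite -sum1_card big_mkcond.
rewrite exchange_big /= (eq_bigr (fun x : G => (x != 0) : nat)); last first.
  move=> x _; rewrite -h1 -sum1_card [RHS]big_mkcond; apply: eq_bigr => xi _.
  by rewrite inE.
by rewrite (bigD1 0)//= eqxx add0n -[LHS]sum1_card (bigD1 0)//= add1n;
   congr S; apply: eq_bigr => x ->.
Qed.

Lemma nclass_card (R : realType) : nclass R #|G| = #|{: invQ G}|%:R.
Proof. by rewrite /nclass card_invQ -addn1 natrD addrK natrM mulrC mulKf. Qed.

Lemma sum_class_repr_le (R : realType) (h : G -> R) : (forall x, 0 <= h x) ->
  \sum_(v : invQ G) h (class_repr v) <= \sum_x h x.
Proof.
move=> h0; have inj : injective (@class_repr G).
  move=> u v uv; apply: (@mem_val_inj _ (class_repr u)); first exact: class_reprP.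
  rewrite uv; exact: class_reprP.
rewrite (eq_bigl (fun v => v \in [set: invQ G]%SET)); last by move=> v; rewrite inE.
rewrite -(big_imset h (h := @class_repr G)) /=; last by move=> u v _ _; exact: inj.
by rewrite big_mkcond; apply: ler_sum => x _; case: ifP.
Qed.
End ClassCount.

(** Each of the k coordinates of a uniform tuple is uniform on V; denominators are cleared. *)
Lemma sum_tuple_coord (R : comPzRingType) (V : finType) (h : V -> R) k :
  #|V|%:R * \sum_(t : k.-tuple V) \sum_(v <- t) h v = k%:R * #|V|%:R ^+ k * \sum_v h v.
Proof.
elim: k => [|k IH].
  rewrite (big_pred1 [tuple]) => [|t]; last by rewrite [t]tuple0; symmetry; apply/eqP.
  by rewrite big_nil mulr0 !mul0r.
rewrite big_tuple_cons /=; set T := \sum_t _ in IH.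
rewrite (eq_bigr (fun a => h a * #|V|%:R ^+ k + T)); last first.
  move=> a _; under eq_bigr do rewrite big_cons.
  by rewrite big_split /= sumr_const card_tuple -[h a *+ _]mulr_natr natrX.
rewrite big_split /= -mulr_suml sumr_const -[T *+ _]mulr_natl IH -natr1 exprS; ring.
Qed.

Section TailSums.
Variables (R : realType) (G : finZmodType) (d K : nat) (p : 'I_K.+1 -> R) (z : nat -> R) (zm : R).
Hypotheses (oG : odd #|G|) (d1 : (1 < d)%N).
Local Notation N := #|G|.
Local Notation V := (invQ G).
Local Notation r i := (thr d (z i) N).
Local Notation rm := (thr d zm N).
Hypotheses (p_ge0 : forall l, 0 <= p l) (p_sum : \sum_l p l = 1).
Hypothesis p_r : forall i, (i < K)%N -> \sum_(l < K.+1 | (l <= i)%N) p l = r i.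
Variable es : seq nat.
Local Notation k := (size es).
Local Notation e j := (nth 0%N es j).
Hypothesis es_lt : forall j, (j < k)%N -> (e j < K)%N.
Hypothesis z_le : forall j, (j < k)%N -> z (e j) <= zm.
Hypothesis rm1 : rm <= 1.
Hypothesis alpha_ge0 : forall j, (j < k)%N -> 0 <= alpha (z (e j)) N.
Hypothesis r_expr : forall j, (j < k)%N -> r (e j) ^+ d = rho d (z (e j)) N.
Hypothesis rho_lt1 : forall j, (j < k)%N -> rho d (z (e j)) N < 1.

Definition tail_fun (w : {ffun V -> 'I_K.+1}) (i : nat) (xi : V) : R := (uncov d i w xi)%:R.
Local Notation S := (Ex p (fun w => isum [seq tail_fun w i | i <- es] finset.set0)).

Lemma N_gt0 : 0 < N%:R :> R. Proof. by rewrite (card_invQ oG) ltr0n. Qed.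

Lemma rho_ge0 j : (j < k)%N -> 0 <= rho d (z (e j)) N.
Proof. by move=> jk; rewrite /rho divr_ge0 ?exprn_ge0// mulr_ge0// alpha_ge0. Qed.

Lemma thr_le j : (j < k)%N -> r (e j) <= rm.
Proof.
move=> jk; apply: ge0_ler_powR; rewrite ?nnegrE ?invr_ge0 ?rho_ge0//.
  apply: le_trans (rho_ge0 jk) _.
  by rewrite ler_wpM2r ?invr_ge0 ?exprn_ge0// ler_wpM2r// lerD2r z_le.
by rewrite ler_wpM2r ?invr_ge0 ?exprn_ge0// ler_wpM2r// lerD2r z_le.
Qed.

Lemma tail_isumE : S = \sum_(t : k.-tuple V | uniq t)
  Ex p (fun w : {ffun V -> 'I_K.+1} => \prod_(j < k) (uncov d (e j) w (tnth t j))%:R).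
Proof.
rewrite -Ex_sum; apply: eq_Ex => w; rewrite isum_tuple; apply: eq_bigl => t.
by rewrite (_ : [disjoint t & _] = true) ?andbT//; apply/pred0P => v /=; rewrite !inE andbF.
Qed.

Lemma card_rep_sets_lower (x : G) : x != 0 ->
  (N%:R ^+ d.-1 - (2 * d ^ 2)%:R * N%:R ^+ (d - 2)) / d`!%:R <= #|rep_sets d x|%:R :> R.
Proof.
move=> x0; rewrite ler_pdivrMr ?ltr0n ?fact_gt0// lerBlDr -!natrX -!natrM -natrD ler_nat.
by rewrite mulnC card_rep_sets card_rep_tuples_ge.
Qed.

Lemma card_rep_sets_upper (x : G) : #|rep_sets d x|%:R <= N%:R ^+ d.-1 / d`!%:R :> R.
Proof.
rewrite ler_pdivlMr ?ltr0n ?fact_gt0// -natrX -natrM ler_nat.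
by rewrite mulnC card_rep_sets card_rep_tuples_le// ltnW.
Qed.

(** There are at most M^k tuples, and M^k = exp (k ln M) cancels the ln M in each alpha, leaving
    only the z (e j). The two correction terms account for the d-sets missing from N^(d-1) / d! and
    for the overlaps. *)
Lemma tail_upper : S <= expR (- \sum_(j < k) z (e j) +
  (2 * d ^ 2)%:R * \sum_(j < k) (alpha (z (e j)) N / N%:R) + (k ^ 2)%:R * overlap_bound d N rm).
Proof.
have M0 : 0 < #|{: V}|%:R :> R \/ #|{: V}| = 0%N.
  by case: #|{: V}| => [|m]; [right|left; rewrite ltr0n].
rewrite tail_isumE.
pose B := expR (- \sum_(j < k) alpha (z (e j)) N +
  (2 * d ^ 2)%:R * \sum_(j < k) (alpha (z (e j)) N / N%:R) + (k ^ 2)%:R * overlap_bound d N rm).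
apply: (@le_trans _ _ (\sum_(t : k.-tuple V | uniq t) B)).
  apply: ler_sum => t ut; have := uncov_upper oG d1 p_ge0 p_sum p_r (xs := tnth t)
    (e := fun j => e j) (rm := rm) _ _ _ rm1.
  move=> /(_ (elimT (tuple_uniqP _) ut)) /(_ (fun j => es_lt (ltn_ord j))).
  move=> /(_ (fun j => thr_le (ltn_ord j))) /le_trans; apply.
  rewrite ler_expR lerD2r mulr_sumr -sumrN -sumrN -big_split /=; apply: ler_sum => j _.
  rewrite lerNl opprD opprK.
  rewrite r_expr//.
  have := ler_wpM2r (rho_ge0 (ltn_ord j)) (card_rep_sets_lower (class_repr_neq0 (tnth t j))).
  apply: le_trans; rewrite le_eqVlt; apply/orP; left; apply/eqP.
  rewrite /rho; have N0 := gt_eqF N_gt0.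
  case: (d) d1 => [//|[//|d']] _; rewrite [d'.+2.-1]/= subSS subSS subn0 exprS; field.
  by rewrite N0 expf_neq0 ?N0// pnatr_eq0 -lt0n fact_gt0.
case: (posnP k) => [k0|kpos].
  rewrite sumr_const; apply: (@le_trans _ _ (B *+ 1)).
    apply: ler_wpMn2l; first exact: expR_ge0.
    apply: leq_trans (max_card _) _; by rewrite card_tuple k0 expn0.
  rewrite mulr1n ler_expR 2!lerD2r lerN2 !big1// => j; by move: (ltn_ord j); rewrite {2}k0.
case: M0 => [M0|M0]; last first.
  rewrite big_pred0 ?expR_ge0// => t.
  have /card0_eq := M0; case: (t : seq V) (size_tuple t) => [|v s] /=; first by move=> h; rewrite -h in kpos.
  by move=> _ /(_ v).
rewrite sumr_const; apply: (@le_trans _ _ (B *+ #|{: k.-tuple V}|)).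
  by apply: ler_wpMn2l; [exact: expR_ge0|exact: max_card].
rewrite card_tuple -[B *+ _]mulr_natr natrX.
have -> : #|{: V}|%:R ^+ k = expR (ln (nclass R N) * k%:R).
  by rewrite expRM_natr nclass_card// lnK ?posrE.
rewrite -expRD ler_expR.
have -> : \sum_(j < k) alpha (z (e j)) N = \sum_(j < k) z (e j) + ln (nclass R N) * k%:R.
  by rewrite big_split /= sumr_const card_ord mulr_natr.
by rewrite le_eqVlt; apply/orP; left; apply/eqP; ring.
Qed.

(** From 1 / (1 - x) = 1 + x / (1 - x) <= exp (x / (1 - x)). *)
Lemma expR_le_onem (x : R) (m : nat) : x < 1 -> expR (- (m%:R * x / (1 - x))) <= (1 - x) ^+ m.
Proof.
move=> x1; have y0 : 0 < 1 - x by rewrite subr_gt0.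
have -> : - (m%:R * x / (1 - x)) = - (x / (1 - x)) * m%:R by ring.
rewrite expRM_natr lerXn2r ?nnegrE ?expR_ge0 ?(ltW y0)//.
rewrite expRN -[leRHS]invrK lef_pV2 ?posrE ?expR_gt0 ?invr_gt0//.
apply: le_trans (expR_ge1Dx _); rewrite le_eqVlt; apply/orP; left; apply/eqP.
by field; rewrite gt_eqF.
Qed.

Let h (v : V) : R := \sum_(q : d.-tuple G | degen (class_repr v) q) rm ^+ #|cl (mem q)|.
Let L : R := expR (- \sum_(j < k) (alpha (z (e j)) N / (1 - rho d (z (e j)) N))).

Lemma h_ge0 v : 0 <= h v.
Proof. by apply: sumr_ge0 => q _; rewrite exprn_ge0// thr_ge0. Qed.

Lemma tail_tuple_lower (t : k.-tuple V) : L * (1 - \sum_(v <- t) h v) <=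
  Ex p (fun w : {ffun V -> 'I_K.+1} => \prod_(j < k) (uncov d (e j) w (tnth t j))%:R).
Proof.
have E0 : 0 <= Ex p (fun w : {ffun V -> 'I_K.+1} => \prod_(j < k) (uncov d (e j) w (tnth t j))%:R).
  by apply: Ex_ge0 => // w; apply: prodr_ge0.
have [neg|pos] := leP (1 - \sum_(v <- t) h v) 0.
  by apply: le_trans E0; rewrite mulr_ge0_le0// expR_ge0.
apply: le_trans (uncov_lower d oG p_ge0 p_sum p_r (tnth t) (e := fun j => e j) (rm := rm)
    (fun j => es_lt (ltn_ord j)) (fun j => thr_le (ltn_ord j)) rm1).
apply: ler_pM; [exact: expR_ge0|exact: ltW| |].
  rewrite /L -sumrN expR_sum; apply: ler_prod => j _; rewrite expR_ge0 /= r_expr//.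
  have rj1 := rho_lt1 (ltn_ord j).
  apply: le_trans (expR_le_onem _ rj1); rewrite ler_expR lerN2 ler_wpM2r//.
    by rewrite invr_ge0 subr_ge0 ltW.
  apply: le_trans (ler_wpM2r (rho_ge0 (ltn_ord j)) (card_rep_sets_upper _)) _.
  rewrite le_eqVlt /rho; apply/orP; left; apply/eqP; field.
  by rewrite expf_neq0 ?gt_eqF// ?N_gt0// ltr0n fact_gt0.
rewrite lerD2l lerN2 big_tuple; apply: ler_sum => j _; apply: ler_sum => q _.
by apply: lerXn2r; rewrite ?nnegrE ?thr_ge0// thr_le.
Qed.

(** Three losses appear: replacing 1 - rho by an exponential, restricting to tuples with distinct
    entries (the ratio (M - k) / M), and the degenerate tuples, averaged over all k-tuples of
    targets. The second alternative covers groups too small for k distinct classes. *)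
Lemma tail_lower : (0 < #|{: V}|)%N ->
  expR (- \sum_(j < k) z (e j) -
     \sum_(j < k) (alpha (z (e j)) N * rho d (z (e j)) N / (1 - rho d (z (e j)) N))) *
  (((nclass R N - k%:R) / nclass R N) ^+ k -
    k%:R * (d * (2 * d + 1))%:R * ((N%:R * rm + (2 * d + 1)%:R) ^+ d.-1 / nclass R N)) <= S
  \/ nclass R N < k%:R.
Proof.
move=> V0; have [kM|] := leP k%:R (nclass R N); last by right.
left; rewrite nclass_card// in kM *; set M : R := #|{: V}|%:R in kM *.
have M0 : 0 < M by rewrite ltr0n.
have L0 : 0 <= L by exact: expR_ge0.
have -> : expR (- \sum_(j < k) z (e j) -
     \sum_(j < k) (alpha (z (e j)) N * rho d (z (e j)) N / (1 - rho d (z (e j)) N))) = L * M ^+ k.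
  have -> : M ^+ k = expR (ln M * k%:R) by rewrite expRM_natr lnK ?posrE.
  rewrite -expRD; congr expR.
  have -> : ln M * k%:R = \sum_(j < k) ln M by rewrite sumr_const card_ord mulr_natr.
  rewrite -!sumrN -!big_split /=; apply: eq_bigr => j _.
  have rj1 := rho_lt1 (ltn_ord j).
  have -> : ln M = alpha (z (e j)) N - z (e j) by rewrite /alpha nclass_card// addrC addKr.
  by field; rewrite gt_eqF// subr_gt0.
apply: (@le_trans _ _ (\sum_(t : k.-tuple V | uniq t) L * (1 - \sum_(v <- t) h v))); last first.
  by rewrite tail_isumE; apply: ler_sum => t _; exact: tail_tuple_lower.
under eq_bigr do rewrite mulrBr mulr1.
rewrite sumrB sumr_const -mulr_sumr -[L *+ _]mulr_natr -mulrBr -mulrA ler_wpM2l//.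
rewrite mulrBr; apply: lerB.
  rewrite expr_div_n mulrCA divff ?mulr1 ?expf_neq0 ?gt_eqF//.
  have -> : #|[pred t : k.-tuple V | uniq t]| = (#|{: V}| ^_ k)%N.
    have := card_uniq_tuples (T := V) k predT; rewrite cardsE => <-.
    by apply: eq_card => t; rewrite !inE [RHS]unfold_in all_predT.
  rewrite /M -natrB; last by rewrite -(ler_nat R).
  rewrite -natrX ler_nat ffact_prod -[X in (_ ^ X <= _)%N]card_ord -prod_nat_const.
  by apply: leq_prod => i _; rewrite leq_sub2l// ltnW.
apply: (@le_trans _ _ (\sum_(t : k.-tuple V) \sum_(v <- t) h v)).
  rewrite [leLHS]big_mkcond; apply: ler_sum => t _; case: ifP => // _.
  by apply: sumr_ge0 => v _; exact: h_ge0.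
rewrite -(ler_pM2l M0) sum_tuple_coord -/M.
have hD : \sum_v h v <= (d * (2 * d + 1))%:R * (N%:R * rm + (2 * d + 1)%:R) ^+ d.-1.
  apply: le_trans (sum_degen_le G (thr_ge0 _ _ _) rm1 (ltnW d1)).
  apply: (sum_class_repr_le (h := fun x => \sum_(q : d.-tuple G | degen x q) rm ^+ #|cl (mem q)|)).
  by move=> x; apply: sumr_ge0 => q _; rewrite exprn_ge0// thr_ge0.
apply: (@le_trans _ _ (k%:R * M ^+ k * ((d * (2 * d + 1))%:R * (N%:R * rm + (2 * d + 1)%:R) ^+ d.-1))).
  by rewrite ler_wpM2l// mulr_ge0// exprn_ge0// ltW.
rewrite le_eqVlt; apply/orP; left; apply/eqP; field.
by rewrite gt_eqF.
Qed.
End TailSums.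

Local Open Scope classical_set_scope.

Lemma cvg_expR_seq (R : realType) (u : nat -> R) (l : R) :
  u n @[n --> \oo] --> l -> expR (u n) @[n --> \oo] --> expR l.
Proof. by move=> ul; apply: (cvg_comp _ _ ul (@continuous_expR R l)). Qed.

Lemma cvg_exprn_seq (R : realType) (u : nat -> R) (l : R) k :
  u n @[n --> \oo] --> l -> u n ^+ k @[n --> \oo] --> l ^+ k.
Proof. by move=> ul; apply: (cvg_comp _ _ ul (@exprn_continuous R k l)). Qed.

Section TailLimit.
Variables (R : realType) (G : nat -> finZmodType) (d K : nat) (p : nat -> 'I_K.+1 -> R) (z : nat -> R).
Hypotheses (oG : forall n, odd #|G n|) (d1 : (1 < d)%N).
Hypothesis G_oo : #|G n| @[n --> \oo] --> \oo.
Hypotheses (p_ge0 : forall n l, 0 <= p n l) (p_sum : forall n, \sum_l p n l = 1).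
Hypothesis p_r : \forall n \near \oo, forall i, (i < K)%N ->
  \sum_(l < K.+1 | (l <= i)%N) p n l = thr d (z i) #|G n|.

Lemma tail_isum_cvg (es : seq nat) : {in es, forall i, (i < K)%N} ->
  Ex (p n) (fun w : {ffun invQ (G n) -> 'I_K.+1} =>
    isum [seq tail_fun R d w i | i <- es] finset.set0) @[n --> \oo] -->
    expR (- \sum_(i <- es) z i).
Proof.
move=> esK; pose k := size es; pose e (j : 'I_k) := nth 0%N es j.
have eE : \sum_(i <- es) z i = \sum_(j < k) z (e j) by rewrite (big_nth 0%N) big_mkord.
(* A common upper bound of the levels that also makes sense when [es] is empty. *)
pose zm := \sum_(j < k) `|z (e j)|.
have zle j : z (e j) <= zm.
  apply: le_trans (ler_norm _) _; rewrite /zm (bigD1 j)//= lerDl; exact: sumr_ge0.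
pose N n := #|G n|.
pose up n := expR (- \sum_(j < k) z (e j) +
  (2 * d ^ 2)%:R * \sum_(j < k) (alpha (z (e j)) (N n) / (N n)%:R) +
  (k ^ 2)%:R * overlap_bound d (N n) (thr d zm (N n))).
pose lo n := expR (- \sum_(j < k) z (e j) -
     \sum_(j < k) (alpha (z (e j)) (N n) * rho d (z (e j)) (N n) / (1 - rho d (z (e j)) (N n)))) *
  (((nclass R (N n) - k%:R) / nclass R (N n)) ^+ k -
    k%:R * (d * (2 * d + 1))%:R *
   (((N n)%:R * thr d zm (N n) + (2 * d + 1)%:R) ^+ d.-1 / nclass R (N n))).
have upc : up n @[n --> \oo] --> expR (- \sum_(j < k) z (e j)).
  apply: cvg_expR_seq.
  have : - \sum_(j < k) z (e j) +
    (2 * d ^ 2)%:R * \sum_(j < k) (alpha (z (e j)) (N n) / (N n)%:R) +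
    (k ^ 2)%:R * overlap_bound d (N n) (thr d zm (N n)) @[n --> \oo] -->
    - \sum_(j < k) z (e j) + (2 * d ^ 2)%:R * (\sum_(j < k) 0) + (k ^ 2)%:R * 0.
    apply: cvgD; [apply: cvgD; [exact: cvg_cst|]|]; apply: cvgM; try exact: cvg_cst.
      by apply: cvg_sumr => j; exact: (alpha_expr_cvg0 _ G_oo 1).
    exact: overlap_bound_cvg0.
  by rewrite big1_eq !mulr0 !addr0.
have inv0 : (nclass R (N n))^-1 @[n --> \oo] --> 0.
  apply/gtr0_cvgV0; first exact: near_nclass.
  apply/cvgryPge => A; near=> n.
  have : 2 * A + 1 <= (N n)%:R by near: n; exact: near_N.
  rewrite /nclass; lra.
have loc : lo n @[n --> \oo] --> expR (- \sum_(j < k) z (e j)).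
  have c1 : expR (- \sum_(j < k) z (e j) -
     \sum_(j < k) (alpha (z (e j)) (N n) * rho d (z (e j)) (N n) / (1 - rho d (z (e j)) (N n))))
     @[n --> \oo] --> expR (- \sum_(j < k) z (e j)).
    apply: cvg_expR_seq.
    rewrite -[X in _ --> X]subr0; apply: cvgB; first exact: cvg_cst.
    have : \sum_(j < k) (alpha (z (e j)) (N n) * rho d (z (e j)) (N n) / (1 - rho d (z (e j)) (N n)))
       @[n --> \oo] --> \sum_(j < k) (0 * (1 - 0)^-1 : R).
      apply: cvg_sumr => j; apply: cvgM; first exact: alpha_rho_cvg0.
      apply: cvgV; first by rewrite subr0 oner_neq0.
      by apply: cvgB; [exact: cvg_cst|exact: rho_cvg0].
    by rewrite big1// => j _; rewrite mul0r.
  have c2 : (1 - k%:R * (nclass R (N n))^-1) ^+ k @[n --> \oo] --> (1 - k%:R * 0 : R) ^+ k.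
    apply: cvg_exprn_seq.
    apply: cvgB; first exact: cvg_cst.
    by apply: cvgM; [exact: cvg_cst|].
  have c3 : k%:R * (d * (2 * d + 1))%:R *
   (((N n)%:R * thr d zm (N n) + (2 * d + 1)%:R) ^+ d.-1 / nclass R (N n)) @[n --> \oo] -->
   (k%:R * (d * (2 * d + 1))%:R * 0 : R).
    by apply: cvgM; [exact: cvg_cst|exact: degen_cvg0].
  have c2' : ((nclass R (N n) - k%:R) / nclass R (N n)) ^+ k @[n --> \oo] -->
      (1 - k%:R * 0 : R) ^+ k.
    apply: cvg_trans c2; apply: near_eq_cvg; near=> n.
    have M0 : 0 < nclass R (N n) by near: n; exact: near_nclass.
    by rewrite mulrBl divff// gt_eqF.
  have := cvgM c1 (cvgB c2' c3).
  rewrite !mulr0 !subr0 expr1n mulr1 => h; exact: h.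
rewrite eE; apply: (squeeze_cvgr _ loc upc).
have near_a : \forall n \near \oo, forall j : 'I_k, 0 <= alpha (z (e j)) (N n).
  by apply: filter_forall => j; exact: near_alpha.
have near_r : \forall n \near \oo, forall j : 'I_k, thr d (z (e j)) (N n) ^+ d = rho d (z (e j)) (N n).
  by apply: filter_forall => j; exact: near_thr_expr.
have near_1 : \forall n \near \oo, forall j : 'I_k, rho d (z (e j)) (N n) < 1.
  apply: filter_forall => j.
  have /cvgrPdist_lt/(_ _ ltr01) := rho_cvg0 (z (e j)) d1 G_oo.
  apply: filterS => n; rewrite sub0r normrN; exact: le_lt_trans (ler_norm _).
near=> n.
have A1 : forall i, (i < K)%N -> \sum_(l < K.+1 | (l <= i)%N) p n l = thr d (z i) #|G n| by near: n.
have A2 : thr d zm (N n) <= 1 by near: n; exact: near_thr_le1.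
have A3 j : (j < k)%N -> 0 <= alpha (z (nth 0%N es j)) (N n).
  by move=> jk; have := near near_a n => /(_ _ (Ordinal jk)); apply.
have A4 j : (j < k)%N -> thr d (z (nth 0%N es j)) (N n) ^+ d = rho d (z (nth 0%N es j)) (N n).
  by move=> jk; have := near near_r n => /(_ _ (Ordinal jk)); apply.
have A5 j : (j < k)%N -> rho d (z (nth 0%N es j)) (N n) < 1.
  by move=> jk; have := near near_1 n => /(_ _ (Ordinal jk)); apply.
have A6 : k%:R + 1 <= nclass R (N n).
  have : 2 * (k%:R + 1) + 1 <= (N n)%:R :> R by near: n; exact: near_N.
  rewrite /nclass; lra.
have A7 : (0 < #|{: invQ (G n)}|)%N.
  by rewrite -(ltr_nat R) -(nclass_card (oG n)); apply: lt_le_trans A6; rewrite ltr_wpDl.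
have A8 j : (j < k)%N -> (nth 0%N es j < K)%N by move=> jk; apply: esK; exact: mem_nth.
have A9 j : (j < k)%N -> z (nth 0%N es j) <= zm by move=> jk; exact: (zle (Ordinal jk)).
apply/andP; split; last exact: (tail_upper (oG n) d1 (p_ge0 n) (p_sum n) A1 A8 A9 A2 A3 A4).
have [//|] := tail_lower (oG n) d1 (p_ge0 n) (p_sum n) A1 A8 A9 A2 A3 A4 A5 A7.
by rewrite ltNge; move: A6 => /(le_trans _) -> //; rewrite lerDl.
Unshelve. all: by end_near.
Qed.
End TailLimit.

(** * Joint law of the counts in consecutive intervals *)

Section CellCounts.
Variables (R : realType) (G : finZmodType) (d m K : nat).
Local Notation V := (invQ G).
Implicit Types (w : {ffun V -> 'I_K.+1}) (v : V).

(** These correspond to the classes with z j <= Z < z j.+1, as [count_of_cell] shows. *)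
Definition cell w (j : 'I_m) : {set V} := [set v : V | uncov d j w v && ~~ uncov d j.+1 w v]%SET.
Definition window w : {set V} := [set v : V | uncov d 0 w v && ~~ uncov d m w v]%SET.

Lemma uncov_anti w v i j : (i <= j)%N -> uncov d j w v -> uncov d i w v.
Proof.
move=> ij; apply: contra; apply: cov_mono; apply/fintype.subsetP => u.
by rewrite !inE => /leq_trans; apply.
Qed.

Lemma indic_diff w v i j : (i <= j)%N ->
  (uncov d i w v && ~~ uncov d j w v)%:R = tail_fun R d w i v - tail_fun R d w j v.
Proof.
move=> /(uncov_anti (w := w) (v := v)); rewrite /tail_fun.
by case: (uncov d j w v) => [->|_]; rewrite ?andbF ?subrr// andbT subr0.
Qed.

Lemma cell_indic w j : (fun v => (v \in cell w j)%:R : R) =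
  (fun v => tail_fun R d w j v - tail_fun R d w j.+1 v).
Proof. by apply/funext => v; rewrite inE indic_diff. Qed.

Lemma window_indic w : (fun v => (v \in window w)%:R : R) =
  (fun v => tail_fun R d w 0 v - tail_fun R d w m v).
Proof. by apply/funext => v; rewrite inE indic_diff. Qed.

Lemma cell_disj w i j v : v \in cell w i -> v \in cell w j -> i = j.
Proof.
rewrite !inE => /andP[ui nui] /andP[uj nuj]; apply: val_inj => /=.
case: (ltngtP i j) => // ij; first by rewrite (uncov_anti ij uj) in nui.
by rewrite (uncov_anti ij ui) in nuj.
Qed.

Lemma cell_sub w j : cell w j \subset window w.
Proof.
apply/fintype.subsetP => v; rewrite !inE => /andP[uj nuj].
rewrite (uncov_anti (leq0n j) uj) /=; apply: contra nuj; exact: uncov_anti.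
Qed.

Lemma card_window w : #|window w| = (\sum_j #|cell w j|)%N.
Proof.
apply/eqP; rewrite -(eqr_nat R) natr_sum; apply/eqP.
have cE (A : {set V}) : #|A|%:R = \sum_v (v \in A)%:R :> R.
  by rewrite -natr_sum -sum1_card big_mkcond.
rewrite cE; under [RHS]eq_bigr do rewrite cE.
rewrite exchange_big /=; apply: eq_bigr => v _.
have -> : (v \in window w)%:R = tail_fun R d w 0 v - tail_fun R d w m v :> R.
  by rewrite inE indic_diff.
rewrite (eq_bigr (fun j : 'I_m => tail_fun R d w j v - tail_fun R d w j.+1 v)); last first.
  by move=> j _; rewrite inE indic_diff.
rewrite -(big_mkord xpredT (fun j => tail_fun R d w j v - tail_fun R d w j.+1 v)).
rewrite -opprB -(telescope_sumr (fun j => tail_fun R d w j v) (leq0n m)) -sumrN.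
by apply: eq_bigr => j _; rewrite opprB.
Qed.

End CellCounts.

Section CellLimit.
Variables (R : realType) (G : nat -> finZmodType) (d m : nat).
Local Notation K := (m.+1).
Variables (p : nat -> 'I_K.+1 -> R) (z : nat -> R).
Hypotheses (oG : forall n, odd #|G n|) (d1 : (1 < d)%N).
Hypothesis G_oo : #|G n| @[n --> \oo] --> \oo.
Hypotheses (p_ge0 : forall n l, 0 <= p n l) (p_sum : forall n, \sum_l p n l = 1).
Hypothesis p_r : \forall n \near \oo, forall i, (i < K)%N ->
  \sum_(l < K.+1 | (l <= i)%N) p n l = thr d (z i) #|G n|.
Local Notation V n := (invQ (G n)).
Local Notation W n := ({ffun V n -> 'I_K.+1}).

Definition diff_fun n (w : W n) (ab : nat * nat) (v : V n) : R :=
  tail_fun R d w ab.1 v - tail_fun R d w ab.2 v.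

(** Induction on [ds]: by [isum_sub] the first difference splits into two moments in which one more
    level has joined [es], which is why [es] is general. *)
Lemma diff_isum_cvg (es : seq nat) (ds : seq (nat * nat)) :
  {in es, forall i, (i < K)%N} -> {in ds, forall ab, (ab.1 < K)%N && (ab.2 < K)%N} ->
  Ex (p n) (fun w : W n => isum ([seq tail_fun R d w i | i <- es] ++
      [seq diff_fun w ab | ab <- ds]) finset.set0) @[n --> \oo] -->
    expR (- \sum_(i <- es) z i) * \prod_(ab <- ds) (expR (- z ab.1) - expR (- z ab.2)).
Proof.
elim: ds es => [|[a b] ds IH] es esK dsK.
  rewrite big_nil mulr1.
  apply: cvg_trans (tail_isum_cvg oG d1 G_oo p_ge0 p_sum p_r esK).
  by apply: near_eq_cvg; apply: nearW => n /=; apply: eq_Ex => w; rewrite cats0.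
have /andP[/= aK bK] := dsK _ (mem_head _ _).
have dsK' : {in ds, forall ab, (ab.1 < K)%N && (ab.2 < K)%N}.
  by move=> ab h; apply: dsK; rewrite inE h orbT.
have rK i : (i < K)%N -> {in rcons es i, forall i, (i < K)%N}.
  by move=> iK i'; rewrite mem_rcons inE => /orP[/eqP ->|/esK].
have E i : expR (- \sum_(j <- rcons es i) z j) = expR (- \sum_(j <- es) z j) * expR (- z i).
  by rewrite -cats1 big_cat big_seq1 opprD expRD.
have h1 := IH _ (rK _ aK) dsK'; have h2 := IH _ (rK _ bK) dsK'.
have h := cvgB h1 h2.
rewrite big_cons mulrA mulrBr -!E mulrBl; apply: cvg_trans (h _).
apply: near_eq_cvg; apply: nearW => n /=.
rewrite fctE -ExB; apply: eq_Ex => w.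
by rewrite /diff_fun isum_sub !map_rcons !cat_rcons.
Qed.

Definition cell_mean (j : nat) : R := expR (- z j) - expR (- z j.+1).

Lemma cell_pmf_cvg (c : 'I_m -> nat) :
  Ex (p n) (fun w : W n => [forall j, #|cell d w j| == c j]%:R) @[n --> \oo] -->
  \prod_(j < m) (cell_mean j ^+ c j / (c j)`!%:R * expR (- cell_mean j)).
Proof.
pose F : R := (\prod_j (c j)`!)%:R.
have F0 : F != 0 by rewrite pnatr_eq0 -lt0n prodn_gt0// => j; exact: fact_gt0.
pose a n := F * Ex (p n) (fun w : W n => [forall j, #|cell d w j| == c j]%:R).
pose s l n := Ex (p n) (fun w : W n => isum
  ([seq (fun v => (v \in cell d w j)%:R : R) | j <- label_seq c] ++
   nseq l (fun v => (v \in window d m w)%:R)) finset.set0).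
have s_cvg l : s l n @[n --> \oo] -->
    \prod_(j < m) cell_mean j ^+ c j * (expR (- z 0%N) - expR (- z m)) ^+ l.
  (* Cells are differences of consecutive tails, and the window is the difference of the two extreme
     ones. *)
  pose ds := [seq (val j, (val j).+1) | j <- label_seq c] ++ nseq l (0%N, m).
  have := @diff_isum_cvg [::] ds; rewrite big_nil oppr0 expR0 mul1r.
  have -> : \prod_(ab <- ds) (expR (- z ab.1) - expR (- z ab.2)) =
     \prod_(j < m) cell_mean j ^+ c j * (expR (- z 0%N) - expR (- z m)) ^+ l.
    rewrite /ds big_cat big_map big_nseq iter_mulr_1; congr (_ * _).
    rewrite /label_seq big_flatten big_map big_enum; apply: eq_bigr => j _.
    by rewrite big_nseq iter_mulr_1.
  move=> h; apply: cvg_trans (h _ _) => //.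
    apply: near_eq_cvg; apply: nearW => n; apply: eq_Ex => w; congr isum.
    rewrite /ds map_cat -map_comp /= map_nseq window_indic; congr (_ ++ _).
    by apply: eq_map => j /=; rewrite cell_indic.
  move=> ab; rewrite mem_cat => /orP[/mapP[j _ ->]|].
    by rewrite /= ltnS (ltnW (ltn_ord j)) ltnS ltn_ord.
  by rewrite mem_nseq => /andP[_ /eqP ->] /=; rewrite ltnSn.
have a_cvg : a n @[n --> \oo] --> \prod_(j < m) cell_mean j ^+ c j * expR (- (expR (- z 0%N) - expR (- z m))).
  apply: (bonferroni_limit (s := s)) => // n k.
  rewrite /a /s.
  have -> : F * Ex (p n) (fun w : W n => [forall j, #|cell d w j| == c j]%:R) -
    \sum_(l < k) (-1) ^+ l / l`!%:R * s l n = Ex (p n) (fun w : W n =>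
      F * [forall j, #|cell d w j| == c j]%:R -
      \sum_(l < k) (-1) ^+ l / l`!%:R * isum
  ([seq (fun v => (v \in cell d w j)%:R : R) | j <- label_seq c] ++
   nseq l (fun v => (v \in window d m w)%:R)) finset.set0).
    rewrite ExB ExZ Ex_sum; congr (_ - _); apply: eq_bigr => l _; by rewrite ExZ.
  apply: le_trans (ler_norm_Ex (p_ge0 n) _) _.
  rewrite mulrC -ExZ; apply: le_Ex => // w; rewrite [leRHS]mulrC.
  apply: pmf_bonferroni; [exact: cell_disj|exact: cell_sub|exact: card_window].
have -> : \prod_(j < m) (cell_mean j ^+ c j / (c j)`!%:R * expR (- cell_mean j)) =
  F^-1 * (\prod_(j < m) cell_mean j ^+ c j * expR (- (expR (- z 0%N) - expR (- z m)))).
  rewrite !big_split /= mulrA; congr (_ * _).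
    rewrite mulrC /F natr_prod -prodfV; by rewrite mulrC.
  rewrite -expR_sum; congr expR; rewrite sumrN; congr (- _).
  rewrite -(big_mkord xpredT cell_mean) -opprB -(telescope_sumr (fun j => expR (- z j)) (leq0n m)).
  by rewrite -sumrN; apply: eq_bigr => j _; rewrite /cell_mean opprB.
have h : F^-1 * a n @[n --> \oo] -->
  F^-1 * (\prod_(j < m) cell_mean j ^+ c j * expR (- (expR (- z 0%N) - expR (- z m)))).
  by apply: cvgM; [exact: cvg_cst|exact: a_cvg].
apply: cvg_trans h; apply: near_eq_cvg; apply: nearW => n.
by rewrite /a mulKf.
Qed.

End CellLimit.

(** * From counts on grids to the vague topology *)

Section Grid.
Variable R : realType.
Implicit Types (m j : nat) (x : R).

(* Mesh 1/(m+1) on [-(m+1), m+1). *)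
Definition gpt m j : R := j%:R / m.+1%:R - m.+1%:R.
Definition gsize m : nat := (2 * m.+1 * m.+1)%N.
Definition gcell m j : set R := `[gpt m j, gpt m j.+1[.

Lemma gpt_step m j : gpt m j.+1 = gpt m j + m.+1%:R^-1.
Proof. by rewrite /gpt -natr1 mulrDl mul1r addrAC. Qed.

Lemma gpt_le m i j : (i <= j)%N -> gpt m i <= gpt m j.
Proof. by move=> ij; rewrite /gpt lerD2r ler_wpM2r ?invr_ge0 ?ler_nat. Qed.

Lemma gpt_lt m i j : (i < j)%N -> gpt m i < gpt m j.
Proof. by move=> ij; rewrite /gpt ltrD2r ltr_pM2r ?invr_gt0 ?ltr_nat. Qed.

Lemma gcell_disj m i j x : gcell m i x -> gcell m j x -> i = j.
Proof.
rewrite /gcell /= !in_itv /= => /andP[ix xi] /andP[jx xj].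
apply/eqP; rewrite eqn_leq -[(i <= j)%N]ltnS -[(j <= i)%N]ltnS; apply/andP; split.
  rewrite ltnNge; apply/negP => ji; have := le_lt_trans ix xj.
  by rewrite ltNge (gpt_le m ji).
rewrite ltnNge; apply/negP => ij; have := le_lt_trans jx xi.
by rewrite ltNge (gpt_le m ij).
Qed.

Lemma gcell_cover m x : - m.+1%:R <= x < m.+1%:R -> exists2 j, (j < gsize m)%N & gcell m j x.
Proof.
move=> /andP[mx xm]; pose y := (x + m.+1%:R) * m.+1%:R.
have m0 : 0 < m.+1%:R :> R by rewrite ltr0n.
have y0 : 0 <= y by rewrite mulr_ge0// -lerBlDr sub0r.
have /andP[y1 y2] := truncn_itv y0.
exists (Num.truncn y).
  rewrite truncn_lt_nat// /y /gsize natrM ltr_pM2r// natrM mulr_natl mulr2n ltrD2r//.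
by rewrite /gcell /= in_itv /= /gpt lerBlDr ltrBrDr ler_pdivrMr// ltr_pdivlMr// y1.
Qed.

Lemma measurable_gcell m j : measurable (gcell m j).
Proof. exact: measurable_itv. Qed.

End Grid.

Section PointMeasure.
Variable R : realType.
Implicit Types (mu nu : point_measure R) (f : test_fun R).

Lemma fsum_dirac_nat (A : set nat) (z : nat -> R) (B : set R) : finite_set A ->
  exists k : nat, (\sum_(i \in A) (\d_(z i) B : \bar R) = (k%:R : R)%:E)%E.
Proof.
move=> fA; rewrite fsbig_finite//=; elim: (finmap.enum_fset (fset_set A)) => [|i s [k hk]].
  by exists 0%N; rewrite big_nil.
rewrite big_cons hk diracE; exists ((z i \in B) + k)%N.
by rewrite -EFinD natrD.
Qed.

(** The possibly infinite sum is the supremum of its finite partial sums. These are natural numbers,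
    so a finite supremum is attained. *)
Lemma point_measure_nat mu (B : set R) : measurable B -> (mu B < +oo)%E ->
  exists k : nat, mu B = k%:R%:E.
Proof.
move=> mB fin; have [D [z hz]] := pm_point mu; move: fin; rewrite (hz B mB) => fin.
rewrite /esum in fin *; set S := image _ _ in fin *.
have Snat x : S x -> exists k : nat, x = k%:R%:E.
  by move=> [A [fA _] <-]; exact: fsum_dirac_nat.
have [n [Sn nmax]] : exists n : nat, S n%:R%:E /\ forall k : nat, S k%:R%:E -> (k <= n)%N.
  have s0 : S 0%E by exists set0; [exact: fsets_set0|rewrite fsbig_set0].
  have [b hb] : exists b : nat, forall k : nat, S k%:R%:E -> (k <= b)%N.
    have [r hr] : exists r : R, (ereal_sup S <= r%:E)%E.
      move: fin; have : (0 <= ereal_sup S)%E by exact: ereal_sup_ubound.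
      by case: (ereal_sup S) => [r| |]//; exists r.
    exists (Num.truncn r) => k /ereal_sup_ubound /le_trans /(_ hr).
    rewrite lee_fin => kr; rewrite truncn_ge_nat//; exact: le_trans kr.
  have ex0 : exists k : nat, `[< S k%:R%:E >] by exists 0%N; apply/asboolP.
  have ub0 : forall k : nat, `[< S k%:R%:E >] -> (k <= b)%N by move=> k /asboolP; exact: hb.
  case: (ex_maxnP ex0 ub0) => n /asboolP Sn nm; exists n; split => // k Sk.
  by apply: nm; apply/asboolP.
exists n; apply/eqP; rewrite eq_le; apply/andP; split; last exact: ereal_sup_ubound.
apply: ge_ereal_sup => x Sx; have [k xk] := Snat _ Sx; rewrite xk lee_fin ler_nat.
by apply: nmax; rewrite -xk.
Qed.

Lemma point_measure_bounded_fin mu (a b : R) (B : set R) : measurable B -> B `<=` `[a, b] ->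
  (mu B < +oo)%E.
Proof.
move=> mB Bab; apply: le_lt_trans (pm_locally_finite mu (@segment_compact R a b)).
by apply: le_measure => //; rewrite inE//; exact: measurable_itv.
Qed.

Definition count_of mu m (j : nat) : nat := Num.truncn (fine (mu (gcell m j))).

Lemma count_ofE mu m j : mu (gcell m j) = (count_of mu m j)%:R%:E.
Proof.
have [k kE] : exists k : nat, mu (gcell m j) = k%:R%:E.
  apply: point_measure_nat; first exact: measurable_gcell.
  apply: (@point_measure_bounded_fin _ (gpt R m j) (gpt R m j.+1)); first exact: measurable_gcell.
  by move=> x; rewrite /gcell /= !in_itv /= => /andP[-> /ltW ->].
by rewrite /count_of kE /= natrK.
Qed.

Lemma test_fun_support f : exists K : nat, forall x, K%:R < `|x| -> f x = 0.
Proof.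
have [M [_ hM]] := compact_bounded (@tf_compact_support R f).
have [K MK] : exists K : nat, `|M| + 1 < K%:R.
  by exists (Num.truncn (`|M| + 1)).+1; rewrite truncnS_gt.
exists K => x Kx; apply/eqP; apply: contraTT Kx => fx; rewrite -leNgt.
apply: le_trans (ltW MK); apply: hM; first by rewrite (le_lt_trans (ler_norm _))// ltrDl.
exact: subset_closure.
Qed.

(** Heine-Cantor, with only x confined to the compact interval: a cell whose left endpoint lies in
    the interval may stick out of it. *)
Lemma test_fun_unif f (K : nat) (eps : R) : 0 < eps ->
  exists2 delta : R, 0 < delta & forall x y, `|x| <= K%:R -> `|x - y| < delta -> `|f x - f y| <= eps.
Proof.
move=> eps0; have e2 : 0 < eps / 2 by rewrite divr_gt0.
have /compact_near_coveringP nc := @segment_compact R (- K%:R) K%:R.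
have := nc _ (0^'+ : set_system R) (fun delta x => forall y, `|x - y| < delta -> `|f x - f y| <= eps) _.
case.
  move=> x _; have /cvgrPdist_lt/(_ _ e2) := @tf_continuous R f x.
  move=> /nbhs_ballP[eta /= eta0 heta].
  exists (ball x (eta / 2), [set delta | delta < eta / 2]) => /=.
    split; first by apply: nbhsx_ballx; rewrite divr_gt0.
    by apply: nbhs_right_lt; rewrite divr_gt0.
  move=> [x' delta] /= [bx hd] y xy.
  have h1 : `|f x - f x'| < eps / 2.
    by apply: heta; apply: le_ball bx; rewrite ler_pdivrMr// ler_peMr ?ler1n// ltW.
  have h2 : `|f x - f y| < eps / 2.
    apply: heta; rewrite /ball /=; apply: le_lt_trans (ler_distD x' _ _) _.
    rewrite [ltRHS]splitr; apply: ltrD; first exact: bx.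
    exact: lt_trans hd.
  apply: le_trans (ler_distD (f x) _ _) _; rewrite [leRHS]splitr; apply: lerD; last exact: ltW.
  by rewrite distrC ltW.
move=> delta /= d0 hd; exists (delta / 2); first by rewrite divr_gt0.
move=> x y xK xy; apply: (hd (delta / 2)) => //=.
- by rewrite sub0r normrN gtr0_norm ?divr_gt0// ltr_pdivrMr// ltr_pMr// ltr1n.
- by rewrite divr_gt0.
- by rewrite in_itv /=; rewrite -ler_norml.
Qed.

End PointMeasure.

Section SumIndic.
Context d (T : measurableType d) (R : realType) (mu : {measure set T -> \bar R}).
Variables (I : Type) (A : I -> set T).
Hypotheses (mA : forall i, measurable (A i)) (finA : forall i, (mu (A i) < +oo)%E).

Lemma integrable_indic_fin i : mu.-integrable setT (EFin \o (\1_(A i) : T -> R)).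
Proof.
apply/integrableP; split; first by apply/measurable_EFinP; exact: measurable_indic.
rewrite (eq_integral (fun x => (\1_(A i) x)%:E)); last first.
  by move=> x _; rewrite gee0_abs// lee_fin.
by rewrite integral_indic// setIT.
Qed.

Lemma Rintegral_sum_indic (r : seq I) (P : pred I) (a : I -> R) :
  mu.-integrable setT (EFin \o (fun x => \sum_(i <- r | P i) a i * \1_(A i) x)) /\
  \int[mu]_x (\sum_(i <- r | P i) a i * \1_(A i) x) = \sum_(i <- r | P i) a i * fine (mu (A i)).
Proof.
have term_int i : mu.-integrable setT (EFin \o (fun x : T => a i * \1_(A i) x)).
  by have := integrableZl measurableT (a i) (integrable_indic_fin i).
have term_val i : \int[mu]_x (a i * \1_(A i) x) = a i * fine (mu (A i)).
  rewrite RintegralZl//; last exact: integrable_indic_fin.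
  by congr (_ * _); rewrite /Rintegral integral_indic// setIT.
elim: r => [|i r [IH1 IH2]].
  rewrite big_nil; under eq_fun do rewrite big_nil.
  split; first exact: integrable0.
  by rewrite Rintegral_cst// mul0r.
rewrite big_cons; case: ifP => Pi; last by under eq_fun do rewrite big_cons Pi.
under eq_fun do rewrite big_cons Pi.
split; first by have := integrableD measurableT (term_int i) IH1.
by rewrite RintegralD// IH2 term_val.
Qed.

End SumIndic.

Section StepApproximation.
Variable R : realType.
Implicit Types (mu nu : point_measure R) (f : test_fun R).

Lemma step_integral mu m (q : nat) (P : pred nat) (a : nat -> R) :
  mu.-integrable setT (EFin \o (fun x : R => \sum_(j < q | P j) a j * \1_(gcell m j) x)) /\
  \int[mu]_x (\sum_(j < q | P j) a j * \1_(gcell m j) x) =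
    \sum_(j < q | P j) a j * (count_of mu m j)%:R.
Proof.
have fin (j : 'I_q) : (mu (gcell m j) < +oo)%E by rewrite count_ofE ltry.
have [h1 h2] := @Rintegral_sum_indic _ _ R mu _ (fun j : 'I_q => gcell m j)
  (fun j => measurable_gcell m j) fin (index_enum _) P a.
by split => //; rewrite h2; apply: eq_bigr => j _; rewrite count_ofE.
Qed.

(** A bound uniform in m: the mesh is at most 1, so these disjoint cells stay within distance K + 2
    of the origin. *)
Lemma count_sum_le mu m (K : nat) :
  \sum_(j < gsize m | `|gpt R m j| <= K.+1%:R) (count_of mu m j)%:R <=
  fine (mu `[- K.+2%:R, K.+2%:R]).
Proof.
have [int1 val1] := step_integral mu m (gsize m) (fun j => `|gpt R m j| <= K.+1%:R) (fun=> 1).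
have fin2 : (mu (`[(- K.+2%:R)%R, K.+2%:R%R] : set R) < +oo)%E.
  by apply: (@point_measure_bounded_fin _ mu (- K.+2%:R) K.+2%:R) => //; exact: measurable_itv.
under eq_bigr do rewrite -[_%:R]mul1r.
rewrite -val1.
have -> : fine (mu `[- K.+2%:R, K.+2%:R]) = \int[mu]_x (\1_(`[- K.+2%:R, K.+2%:R] : set R) x).
  by rewrite /Rintegral integral_indic//= setIT.
apply: le_Rintegral => //.
  apply/integrableP; split; first by apply/measurable_EFinP; exact: measurable_indic.
  rewrite (eq_integral (fun x => (\1_(`[- K.+2%:R, K.+2%:R] : set R) x)%:E)); last first.
    by move=> x _; rewrite gee0_abs// lee_fin.
  by rewrite integral_indic//= setIT.
move=> x _; have [[j [jq jK jx]]|nj] := pselect (exists j, [/\ (j < gsize m)%N,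
    `|gpt R m j| <= K.+1%:R & gcell m j x]).
  rewrite (bigD1 (Ordinal jq))//= big1 ?addr0; last first.
    move=> i /andP[_ ij]; rewrite indicE memNset ?mulr0// => ix.
    by move: ij; rewrite -val_eqE /= (gcell_disj ix jx) eqxx.
  rewrite !indicE !mem_set ?mulr1//; move: jx; rewrite /gcell /= !in_itv /= gpt_step => /andP[x1 x2].
  move: jK; rewrite ler_norml => /andP[k1 k2].
  have w : (m.+1%:R : R)^-1 <= 1 by rewrite invf_le1// ler1n.
  have K2 : K.+2%:R = K.+1%:R + 1 :> R by rewrite -natr1.
  rewrite K2; apply/andP; split.
    by apply: le_trans (le_trans k1 x1); rewrite lerN2 lerDl.
  by apply: le_trans (ltW x2) _; exact: lerD.
rewrite big1 ?indicE ?ler0n//.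
move=> i iK; rewrite indicE memNset ?mulr0// => ix; apply: nj; exists i; split => //; exact: ltn_ord.
Qed.

(** The rank m0 depends on f and eps but not on mu; this uniformity is essential, since later the
    measure changes together with the mesh. *)
Lemma step_approx f (K : nat) (eps : R) : 0 < eps -> (forall x, K%:R < `|x| -> f x = 0) ->
  exists m0, forall m, (m0 <= m)%N -> forall mu,
  `| \int[mu]_x f x - \sum_(j < gsize m) f (gpt R m j) * (count_of mu m j)%:R | <=
    eps * \sum_(j < gsize m | `|gpt R m j| <= K.+1%:R) (count_of mu m j)%:R.
Proof.
move=> eps0 fK; have [delta d0 hd] := test_fun_unif f K.+1 eps0.
exists (maxn K (Num.truncn delta^-1).+1) => m; rewrite geq_max => /andP[Km dm] mu.
have w0 : 0 < (m.+1%:R : R)^-1 by rewrite invr_gt0 ltr0n.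
have w1 : (m.+1%:R : R)^-1 <= 1 by rewrite invf_le1// ler1n.
have wd : (m.+1%:R : R)^-1 < delta.
  rewrite invf_plt ?posrE// ?ltr0n//; apply: lt_le_trans (truncnS_gt _) _.
  by rewrite ler_nat leqW.
have [int1 val1] := step_integral mu m (gsize m) predT (fun j => f (gpt R m j)).
have [int2 val2] := step_integral mu m (gsize m) (fun j => `|gpt R m j| <= K.+1%:R) (fun=> eps).
pose s (x : R) := \sum_(j < gsize m) f (gpt R m j) * \1_(gcell m j) x.
pose b (x : R) := \sum_(j < gsize m | `|gpt R m j| <= K.+1%:R) eps * \1_(gcell m j) x.
have b0 x : 0 <= b x by apply: sumr_ge0 => j _; rewrite mulr_ge0 ?(ltW eps0)// indicE ler0n.
have ptw x : `|f x - s x| <= b x.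
  have [[j [jq jx]]|nj] := pselect (exists j, (j < gsize m)%N /\ gcell m j x).
    have -> : s x = f (gpt R m j).
      rewrite /s (bigD1 (Ordinal jq))//= big1 ?addr0; last first.
        move=> i ij; rewrite indicE memNset ?mulr0// => ix.
        by move: ij; rewrite -val_eqE /= (gcell_disj ix jx) eqxx.
      by rewrite indicE mem_set ?mulr1.
    have : `|gpt R m j - x| < (m.+1%:R)^-1.
      move: jx; rewrite /gcell /= in_itv /= gpt_step => /andP[x1 x2].
      by rewrite ler0_norm ?subr_le0// opprB ltrBlDl.
    (* Beyond K + 1 both x and the left endpoint of its cell are outside the support, because the
       mesh is at most 1. *)
    move=> jx1; have [jK|jK] := leP `|gpt R m j| K.+1%:R.
      apply: (@le_trans _ _ eps).
        by rewrite distrC; apply: hd => //; exact: lt_trans wd.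
      rewrite /b (bigD1 (Ordinal jq))//= indicE mem_set// mulr1 lerDl.
      by apply: sumr_ge0 => i _; rewrite mulr_ge0 ?(ltW eps0)// indicE ler0n.
    rewrite (fK (gpt R m j)) ?fK ?subrr ?normr0//; last first.
      by apply: lt_trans jK; rewrite ltr_nat.
    have := ler_distD x (gpt R m j) 0; rewrite !subr0 => h.
    rewrite -(ltrD2l 1); have : `|gpt R m j| < 1 + `|x|.
      by apply: le_lt_trans h _; rewrite ltrD2r; exact: lt_le_trans w1.
    by apply: lt_trans; move: jK; rewrite -natr1 addrC.
  have sx : s x = 0.
    rewrite /s big1// => j _; rewrite indicE memNset ?mulr0// => jx.
    by apply: nj; exists j; split => //; exact: ltn_ord.
  rewrite sx fK ?subrr ?normr0//.
  rewrite ltNge; apply/negP; rewrite ler_norml => /andP[xa xb]; apply: nj.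
  have [|j jq jx] := @gcell_cover R m x; last by exists j.
  have : K%:R < m.+1%:R :> R by rewrite ltr_nat ltnS.
  by move=> Km1; apply/andP; split; lra.
have mf : measurable_fun setT (f : R -> R) by apply: continuous_measurable_fun; exact: tf_continuous.
have ms : measurable_fun setT s by have /integrableP[/measurable_EFinP] := int1.
have ifs : mu.-integrable setT (EFin \o (fun x => f x - s x)).
  apply: le_integrable int2 => //.
    by apply/measurable_EFinP; exact: measurable_funB.
  move=> x _; rewrite -[leRHS]/(`|(b x)%:E|%E) lee_fin (ger0_norm (b0 x)); exact: ptw.
have iff : mu.-integrable setT (EFin \o f).
  have := integrableD measurableT ifs int1; congr (_.-integrable _ _).
  by apply/funext => x /=; rewrite -EFinD subrK.
have -> : \int[mu]_x f x - \sum_(j < gsize m) f (gpt R m j) * (count_of mu m j)%:R =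
   \int[mu]_x (f x - s x).
  by rewrite RintegralB// -val1.
have hn : `|\int[mu]_x (f x - s x)| <= \int[mu]_x `|f x - s x| by exact: le_normr_Rintegral.
apply: le_trans hn _.
rewrite mulr_sumr -val2; apply: le_Rintegral => //.
by have := integrable_norm ifs.
Qed.

Lemma vague_cvg_of_counts mu (nu : nat -> point_measure R) f :
  (forall m j, (j < gsize m)%N -> count_of (nu m) m j = count_of mu m j) ->
  \int[nu m]_x f x @[m --> \oo] --> \int[mu]_x f x.
Proof.
move=> hnu; have [K fK] := test_fun_support f.
set B := fine (mu `[- K.+2%:R, K.+2%:R]).
have B0 : 0 <= B by rewrite fine_ge0.
apply/cvgrPdist_le => eps eps0.
have e0 : 0 < eps / 2 / (B + 1) by rewrite !divr_gt0// ltr_wpDl.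
have [m0 hm] := step_approx e0 fK.
exists m0 => // m /= m0m.
have h1 := hm m m0m mu; have h2 := hm m m0m (nu m).
have E1 : \sum_(j < gsize m) f (gpt R m j) * (count_of (nu m) m j)%:R =
  \sum_(j < gsize m) f (gpt R m j) * (count_of mu m j)%:R.
  by apply: eq_bigr => j _; rewrite hnu.
have E2 : \sum_(j < gsize m | `|gpt R m j| <= K.+1%:R) (count_of (nu m) m j)%:R =
  \sum_(j < gsize m | `|gpt R m j| <= K.+1%:R) (count_of mu m j)%:R :> R.
  by apply: eq_bigr => j _; rewrite hnu.
rewrite E1 E2 in h2.
apply: le_trans (ler_distD (\sum_(j < gsize m) f (gpt R m j) * (count_of mu m j)%:R) _ _) _.
rewrite [leRHS]splitr.
have bnd : eps / 2 / (B + 1) * \sum_(j < gsize m | `|gpt R m j| <= K.+1%:R) (count_of mu m j)%:R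
   <= eps / 2.
  apply: (@le_trans _ _ (eps / 2 / (B + 1) * B)).
    by rewrite ler_wpM2l ?(ltW e0)//; exact: count_sum_le.
  by rewrite mulrAC ler_pdivrMr ?ltr_wpDl// ler_wpM2l ?lerDl// ltW// divr_gt0.
apply: lerD; first exact: le_trans bnd.
by rewrite distrC; exact: le_trans bnd.
Qed.

Lemma cvg_of_counts (F : point_measure R -> R) mu (nu : nat -> point_measure R) :
  continuous F ->
  (forall m j, (j < gsize m)%N -> count_of (nu m) m j = count_of mu m j) ->
  F (nu m) @[m --> \oo] --> F mu.
Proof.
move=> cF hnu.
suff h : nu m @[m --> \oo] --> mu by exact: (cvg_comp _ _ h (cF mu)).
have h : ({ptws, (vague_eval (nu m)) @[m --> \oo] --> vague_eval mu}).
  apply/cvg_sup => f A [U [[V oV <-] Vmu] UA]; apply: filterS UA _.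
  apply: (@vague_cvg_of_counts mu nu f hnu); exact: open_nbhs_nbhs.
move=> A [U [[V oV <-] Vmu] UA]; apply: filterS UA _.
by apply: h; apply: open_nbhs_nbhs.
Qed.

End StepApproximation.

(** * Convergence in distribution from convergence of counts *)

Section Envelope.
Variables (R : realType) (F : point_measure R -> R) (B : R).
Hypotheses (cF : continuous F) (FB : forall mu, `|F mu| <= B).
Implicit Types (mu nu : point_measure R) (m : nat).

Definition same_counts m (c : nat -> nat) : set (point_measure R) :=
  [set nu | forall j, (j < gsize m)%N -> count_of nu m j = c j].

(* An upper bound for F that depends on a measure only through its counts on the
   grid; it is used for F and for - F. *)
Definition envelope m (c : nat -> nat) : R := sup (F @` same_counts m c).

Lemma F_ub m c : has_ubound (F @` same_counts m c).
Proof. by exists B => _ [nu _ <-]; apply: le_trans (ler_norm _) (FB nu). Qed.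

Lemma envelope_ge m c mu : same_counts m c mu -> F mu <= envelope m c.
Proof. by move=> h; apply: ub_le_sup; [exact: F_ub|exists mu]. Qed.

Lemma envelope_bound m c : `|envelope m c| <= B.
Proof.
have [[mu hmu]|no] := pselect (exists mu, same_counts m c mu).
  rewrite ler_norml; apply/andP; split.
    apply: le_trans (envelope_ge hmu); have := FB mu; by rewrite ler_norml => /andP[].
  apply: ge_sup; first by exists (F mu); exists mu.
  by move=> _ [nu _ <-]; apply: le_trans (ler_norm _) (FB nu).
(* Counts realized by no measure give the default value 0 of [sup]; evaluating F at the zero measure
   shows 0 <= B. *)
rewrite /envelope (_ : _ @` _ = set0) ?sup0 ?normr0; last first.
  by rewrite -subset0 => y [mu hmu _]; apply: no; exists mu.
exact: le_trans (normr_ge0 _) (FB (point_sum (fun _ : 'I_0 => 0))).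
Qed.

(** Near-maximizers chosen at each mesh share their counts with mu, so they converge vaguely to mu;
    continuity of F then keeps the suprema from staying above F mu. *)
Lemma envelope_cvg mu : envelope m (count_of mu m) @[m --> \oo] --> F mu.
Proof.
have /boolp.choice[nu hnu] : forall m, exists nu, same_counts m (count_of mu m) nu /\
    envelope m (count_of mu m) - m.+1%:R^-1 < F nu.
  move=> m; have hs : has_sup (F @` same_counts m (count_of mu m)).
    by split; [exists (F mu); exists mu|exact: F_ub].
  have m0 : 0 < m.+1%:R^-1 :> R by rewrite invr_gt0.
  by have [_ [nu h <-] lt] := sup_adherent m0 hs; exists nu.
have h1 := cvg_of_counts cF (fun m => (hnu m).1).
have h2 : F (nu m) + m.+1%:R^-1 @[m --> \oo] --> F mu + 0.
  by apply: cvgD => //; exact: cvg_harmonic.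
rewrite addr0 in h2; apply: (squeeze_cvgr _ (@cvg_cst _ (F mu) nat \oo _) h2).
apply: nearW => m; rewrite envelope_ge//= ltW// -ltrBlDr.
exact: (hnu m).2.
Qed.

End Envelope.

Section Counting.
Context (R : realType) dO (Omega : measurableType dO) (P : probability Omega R).
Variable X : Omega -> point_measure R.
Hypothesis mX : is_point_process X.

Definition count_event m (c : nat -> nat) : set Omega := [set w | same_counts m c (X w)].

Lemma count_eventE m c : count_event m c =
  \bigcap_(j in `I_(gsize m)) ((fun w => X w (gcell m j)) @^-1` [set (c j)%:R%:E]).
Proof.
apply/seteqP; split => [w h j /= jq|w h j jq]; first by rewrite count_ofE h.
have := h j jq; rewrite /= count_ofE => /eqP; rewrite eqe eqr_nat => /eqP; exact.
Qed.

Lemma measurable_count_event m c : measurable (count_event m c).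
Proof.
rewrite count_eventE; apply: fin_bigcap_measurable => // j _.
by rewrite -[X in measurable X]setTI; apply: mX => //; exact: measurable_gcell.
Qed.

(** Count vectors with entries below J form a finite type, so that expectations become finite sums;
    J is sent to infinity later. *)
Definition of_ffun q J (c : {ffun 'I_q -> 'I_J}) (j : nat) : nat :=
  if insub j is Some i then c i else 0%N.

Lemma of_ffunE q J (c : {ffun 'I_q -> 'I_J}) (j : 'I_q) : of_ffun c j = c j.
Proof. by rewrite /of_ffun valK. Qed.

Lemma count_event_inj m J (c c' : {ffun 'I_(gsize m) -> 'I_J}) w :
  count_event m (of_ffun c) w -> count_event m (of_ffun c') w -> c = c'.
Proof.
move=> h h'; apply/ffunP => j; apply: val_inj.
by rewrite -[LHS]of_ffunE -[RHS]of_ffunE /= -h// -h'.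
Qed.

Lemma sum_count_event m J (a : (nat -> nat) -> R) w (c : {ffun 'I_(gsize m) -> 'I_J}) :
  count_event m (of_ffun c) w ->
  \sum_(c' : {ffun 'I_(gsize m) -> 'I_J}) a (of_ffun c') * \1_(count_event m (of_ffun c')) w =
  a (of_ffun c).
Proof.
move=> hc; rewrite (bigD1 c)//= big1 ?addr0; first by rewrite indicE mem_set// mulr1.
move=> c' cc'; rewrite indicE memNset ?mulr0// => hc'.
by rewrite (count_event_inj hc' hc) eqxx in cc'.
Qed.

Definition bounded_counts m J : set Omega := [set w | forall j, (j < gsize m)%N -> (count_of (X w) m j < J)%N].

Lemma bounded_counts_event m J w : bounded_counts m J w ->
  exists c : {ffun 'I_(gsize m) -> 'I_J}, count_event m (of_ffun c) w.
Proof.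
move=> h; exists [ffun j : 'I_(gsize m) => Ordinal (h j (ltn_ord j))] => j jq.
by rewrite -[j in RHS]/(val (Ordinal jq)) of_ffunE ffunE.
Qed.

Lemma sum_count_event_out m J (a : (nat -> nat) -> R) w : ~ bounded_counts m J w ->
  \sum_(c' : {ffun 'I_(gsize m) -> 'I_J}) a (of_ffun c') * \1_(count_event m (of_ffun c')) w = 0.
Proof.
move=> nb; rewrite big1// => c _; rewrite indicE memNset ?mulr0// => h; apply: nb => j jq.
by rewrite h// -[j]/(val (Ordinal jq)) of_ffunE.
Qed.

Lemma near_bounded_counts m w : \forall J \near \oo, bounded_counts m J w.
Proof.
exists (\max_(j < gsize m) count_of (X w) m j).+1 => // J /= hJ j jq.
by apply: leq_trans hJ; rewrite ltnS (leq_bigmax (Ordinal jq)).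
Qed.

Lemma same_of_ffun (F : point_measure R -> R) m J (c : {ffun 'I_(gsize m) -> 'I_J}) w :
  count_event m (of_ffun c) w ->
  envelope F m (of_ffun c) = envelope F m (count_of (X w) m).
Proof.
move=> h; congr (sup (_ @` _)); apply/seteqP; split => nu hn j jq; first by rewrite hn// h.
by rewrite hn// -h.
Qed.

Lemma measurable_envelope (F : point_measure R -> R) m :
  measurable_fun setT (fun w => envelope F m (count_of (X w) m)).
Proof.
apply: (measurable_fun_cvg (h := fun J w =>
  \sum_(c : {ffun 'I_(gsize m) -> 'I_J}) envelope F m (of_ffun c) * \1_(count_event m (of_ffun c)) w)).
  move=> J; apply: measurable_sum => c; apply: measurable_funM => //.
  by apply: measurable_indic; exact: measurable_count_event.
move=> w _; apply: cvg_near_cst; apply: filterS (near_bounded_counts m w) => J.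
by move/bounded_counts_event => [c hc]; rewrite (sum_count_event _ hc) (same_of_ffun F hc).
Qed.

Lemma count_events_cvg m :
  \sum_(c : {ffun 'I_(gsize m) -> 'I_J}) fine (P (count_event m (of_ffun c))) @[J --> \oo] --> (1 : R).
Proof.
have mB J : measurable (bounded_counts m J).
  have -> : bounded_counts m J = \bigcup_(c in [set: {ffun 'I_(gsize m) -> 'I_J}]) count_event m (of_ffun c).
    apply/seteqP; split => [w /bounded_counts_event[c h]|w [c _ h] j jq]; first by exists c.
    by rewrite h// -[j]/(val (Ordinal jq)) of_ffunE.
  by apply: fin_bigcup_measurable => // c _; exact: measurable_count_event.
have c1 : P (bounded_counts m J) @[J --> \oo] --> P setT.
  have -> : [set: Omega] = \bigcup_J bounded_counts m J.
    apply/seteqP; split => // w _; have [J _ h] := near_bounded_counts m w.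
    by exists J => //; apply: h => /=.
  apply: nondecreasing_cvg_mu => //; first exact: bigcup_measurable.
  move=> J J' JJ; apply/subsetPset => w h j jq; exact: leq_trans (h j jq) JJ.
rewrite probability_setT in c1.
have E J : \sum_(c : {ffun 'I_(gsize m) -> 'I_J}) fine (P (count_event m (of_ffun c))) =
    fine (P (bounded_counts m J)).
  have fin (c : {ffun 'I_(gsize m) -> 'I_J}) : (P (count_event m (of_ffun c)) < +oo)%E.
    by rewrite ltey_eq fin_num_measure//; exact: measurable_count_event.
  have [_ h2] := @Rintegral_sum_indic _ _ R P _
    (fun c : {ffun 'I_(gsize m) -> 'I_J} => count_event m (of_ffun c))
    (fun c => measurable_count_event m _) fin (index_enum _) predT (fun=> 1).
  under eq_bigr do rewrite -[fine _]mul1r.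
  rewrite -h2.
  have -> : fine (P (bounded_counts m J)) = \int[P]_x (\1_(bounded_counts m J) x).
    by rewrite /Rintegral integral_indic// setIT.
  apply: eq_Rintegral => w _; have [bw|nb] := pselect (bounded_counts m J w).
    have [c hc] := bounded_counts_event bw.
    by rewrite (sum_count_event (fun=> 1) hc) indicE mem_set.
  by rewrite (sum_count_event_out (fun=> 1) nb) indicE memNset.
under eq_fun do rewrite E.
by apply: fine_cvg; exact: c1.
Qed.

End Counting.

Section CountExpectation.
Context (R : realType) dO (Omega : measurableType dO) (P : probability Omega R).
Variable X : Omega -> point_measure R.
Hypothesis mX : is_point_process X.
Variables (F : point_measure R -> R) (B : R).
Hypotheses (cF : continuous F) (FB : forall mu, `|F mu| <= B).
Local Notation env m w := (envelope F m (count_of (X w) m)).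
Local Notation pc m c := (fine (P (count_event X m (of_ffun c)))).

(** The hypothesis on X concerns only the values on Borel sets; F composed with X is measurable as
    the pointwise limit of its envelopes, which are functions of the counts. *)
Lemma measurable_comp_process : measurable_fun setT (F \o X).
Proof.
apply: (measurable_fun_cvg (h := fun m w => env m w)).
  by move=> m; exact: measurable_envelope.
by move=> w _; exact: envelope_cvg FB (X w).
Qed.

Lemma bounded_Rintegrable (Y : Omega -> R) : measurable_fun setT Y ->
  (forall w, `|Y w| <= B) -> P.-integrable setT (EFin \o Y).
Proof.
move=> mY YB; apply: measurable_bounded_integrable => //.
  by rewrite (le_lt_trans (probability_le1 _ _))// ltry.
by exists B; split => //= M BM w _; exact: le_trans (YB w) (ltW BM).
Qed.

Lemma envelope_integral_cvg :
  \int[P]_w env m w @[m --> \oo] --> \int[P]_w F (X w).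
Proof.
have Bint : P.-integrable setT (EFin \o (fun=> B) : Omega -> \bar R).
  by apply: bounded_Rintegrable => // w; rewrite ger0_norm// (le_trans _ (FB (X w))).
have h := @dominated_convergence _ _ R P setT measurableT
  (fun m w => (env m w)%:E) (fun w => (F (X w))%:E) (fun=> B%:E).
have [] := h.
- by move=> m; apply/measurable_EFinP; exact: measurable_envelope.
- by apply/measurable_EFinP; exact: measurable_comp_process.
- by apply: aeW => w _; apply: cvg_EFin; [exact: nearW|exact: envelope_cvg FB (X w)].
- exact: Bint.
- by apply: aeW => w m _; rewrite lee_fin envelope_bound.
move=> _ _ h3; apply: fine_cvg; rewrite fineK; first exact: h3.
apply: integrable_fin_num => //; apply: bounded_Rintegrable => //.
exact: measurable_comp_process.
Qed.

Lemma affine_indic_integral m J (b : R) (a : (nat -> nat) -> R) :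
  let g := (fun w => b + \sum_(c : {ffun 'I_(gsize m) -> 'I_J})
     a (of_ffun c) * \1_(count_event X m (of_ffun c)) w) in
  P.-integrable setT (EFin \o g) /\
  \int[P]_w g w = b + \sum_(c : {ffun 'I_(gsize m) -> 'I_J}) a (of_ffun c) * pc m c.
Proof.
have fin (c : {ffun 'I_(gsize m) -> 'I_J}) : (P (count_event X m (of_ffun c)) < +oo)%E.
  by rewrite (le_lt_trans (probability_le1 _ _)) ?ltry//; exact: measurable_count_event.
have [h1 h2] := @Rintegral_sum_indic _ _ R P _
    (fun c : {ffun 'I_(gsize m) -> 'I_J} => count_event X m (of_ffun c))
    (fun c => measurable_count_event mX m _) fin (index_enum _) predT (fun c => a (of_ffun c)).
have hb : P.-integrable setT (EFin \o (fun=> b) : Omega -> \bar R).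
  by apply: finite_measure_integrable_cst.
split; first by have := integrableD measurableT hb h1.
have P1 : fine (P [set: Omega]) = 1 by rewrite (@probability_setT _ _ _ P).
by rewrite RintegralD// h2 Rintegral_cst// [fine _]P1 mulr1.
Qed.

(** The envelope is used where all counts are below J, and the trivial bound B elsewhere. The right
    side involves P only through finitely many count probabilities. *)
Lemma expectation_count_upper m J : \int[P]_w F (X w) <=
  B + \sum_(c : {ffun 'I_(gsize m) -> 'I_J}) (envelope F m (of_ffun c) - B) * pc m c.
Proof.
have [h1 h2] := affine_indic_integral m J B (fun c => envelope F m c - B).
rewrite -h2; apply: le_Rintegral => //.
  by apply: bounded_Rintegrable => //; exact: measurable_comp_process.
move=> w _; have [bw|nb] := pselect (bounded_counts X m J w).
  have [c hc] := bounded_counts_event bw.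
  rewrite (sum_count_event (fun c => envelope F m c - B) hc) addrC subrK.
  exact: envelope_ge FB _ _ _ hc.
rewrite (sum_count_event_out (fun c => envelope F m c - B) nb) addr0.
exact: le_trans (ler_norm _) (FB _).
Qed.

(** Replacing the value B by - B outside the bounded counts goes below the envelope everywhere, at
    the price of 2 B times the missing mass. *)
Lemma expectation_count_lower m J :
  B + \sum_(c : {ffun 'I_(gsize m) -> 'I_J}) (envelope F m (of_ffun c) - B) * pc m c <=
  \int[P]_w env m w + 2 * B * (1 - \sum_(c : {ffun 'I_(gsize m) -> 'I_J}) pc m c).
Proof.
have [h1 h2] := affine_indic_integral m J (- B) (fun c => envelope F m c + B).
have -> : B + \sum_(c : {ffun 'I_(gsize m) -> 'I_J}) (envelope F m (of_ffun c) - B) * pc m c =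
   (- B + \sum_(c : {ffun 'I_(gsize m) -> 'I_J}) (envelope F m (of_ffun c) + B) * pc m c) +
   2 * B * (1 - \sum_(c : {ffun 'I_(gsize m) -> 'I_J}) pc m c).
  have -> : \sum_(c : {ffun 'I_(gsize m) -> 'I_J}) (envelope F m (of_ffun c) + B) * pc m c =
     \sum_(c : {ffun 'I_(gsize m) -> 'I_J}) (envelope F m (of_ffun c) - B) * pc m c +
     2 * B * \sum_(c : {ffun 'I_(gsize m) -> 'I_J}) pc m c.
    by rewrite mulr_sumr -big_split; apply: eq_bigr => c _ /=; ring.
  by ring.
rewrite lerD2r -h2; apply: le_Rintegral => //.
  apply: bounded_Rintegrable => //; first exact: measurable_envelope.
  by move=> w; exact: envelope_bound.
move=> w _; have [bw|nb] := pselect (bounded_counts X m J w).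
  have [c hc] := bounded_counts_event bw.
  by rewrite (sum_count_event (fun c => envelope F m c + B) hc) addrC addrK (same_of_ffun F hc).
rewrite (sum_count_event_out (fun c => envelope F m c + B) nb) addr0.
by have := envelope_bound FB m (count_of (X w) m); rewrite ler_norml => /andP[].
Qed.

End CountExpectation.

Section WeakConvergence.
Context (R : realType) (dO : nat -> measure_display) (Omega : forall n, measurableType (dO n))
  (P : forall n, probability (Omega n) R) (X : forall n, Omega n -> point_measure R)
  (dO' : measure_display) (Omega' : measurableType dO') (P' : probability Omega' R)
  (X' : Omega' -> point_measure R).
Hypotheses (mX : forall n, is_point_process (@X n)) (mX' : is_point_process X').
Hypothesis counts_cvg : forall m c,
  fine (P n (count_event (@X n) m c)) @[n --> \oo] --> fine (P' (count_event X' m c)).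

(** The order of choices is the mesh m, then the cutoff J, both from the limit process alone, and
    finally n. The opposite inequality comes from applying this to - F. *)
Lemma limsup_expectation (F : point_measure R -> R) (B eps : R) :
  continuous F -> (forall mu, `|F mu| <= B) -> 0 < eps ->
  \forall n \near \oo, \int[P n]_w F (X w) <= \int[P']_w F (X' w) + eps.
Proof.
move=> cF FB eps0; have e3 : 0 < eps / 3 by rewrite divr_gt0.
have /cvgrPdist_le/(_ _ e3) [m _ hm] := envelope_integral_cvg (P := P') mX' cF FB.
have := hm m (leqnn m); rewrite distrC /= => hm'.
have cJ : 2 * B * (1 - \sum_(c : {ffun 'I_(gsize m) -> 'I_J}) fine (P' (count_event X' m (of_ffun c))))
   @[J --> \oo] --> 2 * B * (1 - 1).
  apply: cvgM; first exact: cvg_cst.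
  by apply: cvgB; [exact: cvg_cst|exact: count_events_cvg].
move: cJ => /cvgrPdist_le/(_ _ e3) [J _ hJ].
have := hJ J (leqnn J); rewrite subrr mulr0 sub0r normrN /= => hJ'.
have cn : B + \sum_(c : {ffun 'I_(gsize m) -> 'I_J}) (envelope F m (of_ffun c) - B) *
     fine (P n (count_event (@X n) m (of_ffun c))) @[n --> \oo] -->
   B + \sum_(c : {ffun 'I_(gsize m) -> 'I_J}) (envelope F m (of_ffun c) - B) *
     fine (P' (count_event X' m (of_ffun c))).
  apply: cvgD; first exact: cvg_cst.
  by apply: cvg_sumr => c; apply: cvgM; [exact: cvg_cst|exact: counts_cvg].
move/cvgrPdist_le : cn => /(_ _ e3); apply: filterS => n hn.
apply: le_trans (expectation_count_upper (P n) (@mX n) cF FB m J) _.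
have low := expectation_count_lower P' mX' FB m J.
move: hn; rewrite distrC => /(le_trans (ler_norm _)) hn.
have k1 := le_trans (ler_norm _) hm'; have k2 := le_trans (ler_norm _) hJ'.
set u := B + \sum_c _ in hn *; set v := B + \sum_c _ in hn low.
have -> : eps = eps / 3 + (eps / 3 + eps / 3) by field.
lra.
Qed.

Lemma cvg_in_distribution_of_counts : cvg_in_distribution P (@X) P' X'.
Proof.
move=> F cF [M [_ hM]]; pose B := `|M| + 1.
have FB mu : `|F mu| <= B.
  by apply: hM => //; rewrite /B (le_lt_trans (ler_norm _))// ltrDl.
have cNF : continuous (fun mu => - F mu) by move=> mu; exact: (cvg_comp _ _ (cF mu) (@oppr_continuous R R (F mu))).
have NFB mu : `|- F mu| <= B by rewrite normrN.
have ER dS (S : measurableType dS) (Q : probability S R) (Y : S -> point_measure R) :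
    is_point_process Y -> ('E_Q[F \o Y] = (\int[Q]_w F (Y w))%:E)%E.
  move=> mY; rewrite unlock /Rintegral fineK//; apply: integrable_fin_num => //.
  apply: (@bounded_Rintegrable _ _ _ Q B (F \o Y)); first exact (measurable_comp_process mY cF FB).
  by move=> w; exact: FB.
rewrite (ER _ _ _ _ mX'); under eq_fun => n do rewrite (ER _ _ _ _ (@mX n)).
apply: cvg_EFin; first exact: nearW.
apply/cvgrPdist_le => eps eps0.
have h1 := limsup_expectation cF FB eps0; have h2 := limsup_expectation cNF NFB eps0.
have RN dS (S : measurableType dS) (Q : probability S R) (Y : S -> point_measure R) :
    is_point_process Y -> \int[Q]_w (- F (Y w)) = - \int[Q]_w F (Y w).
  move=> mY; rewrite -mulN1r -RintegralZl//.
    by apply: eq_Rintegral => w _; rewrite mulN1r.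
  apply: (@bounded_Rintegrable _ _ _ Q B (F \o Y)); first exact (measurable_comp_process mY cF FB).
  by move=> w; exact: FB.
near=> n.
have R1 : \int[P n]_w F (X w) <= \int[P']_w F (X' w) + eps by near: n.
have R2 : \int[P n]_w (- F (X w)) <= \int[P']_w (- F (X' w)) + eps by near: n.
rewrite (RN _ _ _ _ mX') (RN _ _ _ _ (@mX n)) in R2.
change (`|\int[P']_w F (X' w) - \int[P n]_w F (X w)| <= eps).
by rewrite ler_norml; apply/andP; split; lra.
Unshelve. all: by end_near.
Qed.

End WeakConvergence.

Lemma fine_prod (R : realType) (I : finType) (u : I -> \bar R) :
  (forall i, u i \is a fin_num) -> fine (\prod_i u i)%E = \prod_i fine (u i).
Proof.
move=> fu; rewrite (eq_bigr (fun i => (fine (u i))%:E)); last by move=> i _; rewrite fineK.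
suff -> : (\prod_i (fine (u i))%:E)%E = (\prod_i fine (u i))%:E by [].
by elim/big_ind2: _ => // x x' y y' -> ->; rewrite EFinM.
Qed.

(** * The coverage process and the Poisson process on a grid *)

Section PoissonSide.
Variable R : realType.

Lemma exp_intensity_itv (a b : R) : a < b -> exp_intensity `[a, b[ = (expR (- a) - expR (- b))%:E.
Proof.
move=> ab.
have ce : continuous (fun x : R^o => expR (- x)).
  by move=> x; apply: continuous_comp; [exact: (@continuousN _ R^o)|exact: continuous_expR].
rewrite /exp_intensity integral_itv_bndo_bndc; last first.
  apply: measurable_funTS; apply/measurable_EFinP; exact: continuous_measurable_fun.
rewrite (@continuous_FTC2 _ (fun x => expR (- x)) (fun x => - expR (- x)))//.
- by rewrite -EFinN opprK -EFinD addrC.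
- exact: continuous_subspaceT.
- split.
  + by move=> z _; exact: ex_derive.
  + by apply/cvg_at_right_filter; apply: cvgN; exact: ce.
  + by apply/cvg_at_left_filter; apply: cvgN; exact: ce.
- move=> z _; rewrite derive1N// derive1_comp// derive1N// derive1_id.
  rewrite derive1E; have /funeqP -> := @derive_expR R.
  by rewrite mulrN1 opprK.
Qed.

Lemma poisson_prob_set1 (r : R) (k : nat) : 0 < r ->
  poisson_prob r 0 [set k] = (r ^+ k / k`!%:R * expR (- r))%:E.
Proof.
move=> r0; rewrite /poisson_prob r0 esum_set1; last by rewrite lee_fin poisson_pmf_ge0.
by rewrite /poisson_pmf r0.
Qed.

Lemma cell_mean_gt0 m j : 0 < cell_mean (gpt R m) j.
Proof. by rewrite /cell_mean subr_gt0 ltr_expR ltrN2 gpt_lt. Qed.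

Lemma exp_intensity_gcell m j : fine (exp_intensity (gcell m j)) = cell_mean (gpt R m) j.
Proof. by rewrite exp_intensity_itv// gpt_lt. Qed.

Lemma bounded_gcell m j : bounded_set (gcell m j : set R).
Proof.
have [M [Mreal hM]] := compact_bounded (@segment_compact R (gpt R m j) (gpt R m j.+1)).
exists M; split => // M' MM' x; rewrite /gcell /= in_itv /= => /andP[x1 /ltW x2].
by apply: hM => //=; rewrite in_itv /= x1.
Qed.

Context d (Omega : measurableType d) (P : probability Omega R) (X : Omega -> point_measure R).
Hypothesis X_poisson : is_poisson_process P (@exp_intensity R) X.

Lemma poisson_count_event m (c : nat -> nat) :
  fine (P (count_event X m c)) = \prod_(j < gsize m)
    (cell_mean (gpt R m) j ^+ c j / (c j)`!%:R * expR (- cell_mean (gpt R m) j)).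
Proof.
have [mX law indep] := X_poisson.
have := indep 'I_(gsize m) (fun j => gcell m j) (fun j => measurable_gcell m j)
  (fun j => bounded_gcell m j) _ finset.setT (fun j : 'I_(gsize m) => [set (c j)%:R%:E]) _.
have -> : count_event X m c =
    \bigcap_(j in [set` (finset.setT : {set 'I_(gsize m)})])
      ((fun w => X w (gcell m (j : 'I_(gsize m)))) @^-1` [set (c (j : 'I_(gsize m)))%:R%:E]).
  rewrite count_eventE; apply/seteqP; split => w h j /=; first by move=> _; exact: (h j (ltn_ord j)).
  by move=> jq; apply: (h (Ordinal jq)); rewrite /= inE.
move=> ->.
- rewrite (eq_bigl predT); last by move=> j; rewrite inE.
  rewrite fine_prod; last by move=> j; rewrite fin_num_measure// -[X in measurable X]setTI; apply: mX => //; exact: measurable_gcell.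
  apply: eq_bigr => j _.
  have -> : (fun w => X w (gcell m j)) @^-1` [set (c j)%:R%:E] =
    [set w | X w (gcell m j) = (c j)%:R%:E] by [].
  rewrite law; [|exact: measurable_gcell|exact: bounded_gcell].
  by rewrite exp_intensity_gcell poisson_prob_set1 ?cell_mean_gt0.
- move=> i j _ _ [x [xi xj]]; apply: val_inj; exact: gcell_disj xi xj.
- by move=> j.
Qed.

End PoissonSide.

(** * Positions of the uniform times among the thresholds *)

Lemma sum_fibre_measure d (T : measurableType d) (R : realType) (P : probability T R)
    (I : finType) (f : T -> I) (Q : pred I) :
  (forall i, measurable [set t | f t = i]) ->
  \sum_(i | Q i) fine (P [set t | f t = i]) = fine (P [set t | Q (f t)]).
Proof.
move=> mf.
have fin i : (P [set t | f t = i] < +oo)%E by rewrite (le_lt_trans (probability_le1 _ _))// ltry.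
have [_ h] := @Rintegral_sum_indic _ _ R P _ (fun i => [set t | f t = i]) mf fin (index_enum _) Q (fun=> 1).
under eq_bigr do rewrite -[fine _]mul1r.
have mQ : measurable [set t | Q (f t)].
  have -> : [set t | Q (f t)] = \bigcup_(i in [set` Q]) [set t | f t = i].
    by apply/seteqP; split => [t qt|t [i qi /= ->]//]; exists (f t).
  by apply: fin_bigcup_measurable.
rewrite -h.
have -> : fine (P [set t | Q (f t)]) = \int[P]_t (\1_[set t | Q (f t)] t).
  by rewrite /Rintegral integral_indic// setIT.
apply: eq_Rintegral => t _; rewrite indicE.
have [qt|nqt] := boolP (Q (f t)).
  rewrite mem_set// (bigD1 (f t))//= indicE mem_set// mulr1 big1 ?addr0// => i /andP[_ fi].
  rewrite indicE memNset ?mulr0// => /esym/eqP e; by rewrite e in fi.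
rewrite memNset ?big1// => [i qi|/= qt]; last by rewrite qt in nqt.
by rewrite indicE memNset ?mulr0// => e; rewrite e qi in nqt.
Qed.

Lemma uniform_prob_lt (R : realType) (r : R) : 0 <= r <= 1 ->
  uniform_prob (@ltr01 R) `]-oo, r[ = r%:E.
Proof.
move=> /andP[r0 r1]; rewrite /uniform_prob integral_uniform_pdf.
have -> : `]-oo, r[ `&` `[0, 1] = (`[0, r[ : set R).
  apply/seteqP; split => x /=; rewrite !in_itv /=; first by move=> [-> /andP[->]].
  by move=> /andP[x0 xr]; rewrite x0 xr (ltW (lt_le_trans xr r1)).
rewrite (eq_integral (fun=> 1%:E)); last first.
  move=> x; rewrite inE /= in_itv /= => /andP[x0 xr].
  by rewrite /uniform_pdf x0 (ltW (lt_le_trans xr r1)) subr0 invr1.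
rewrite integral_cst//= mul1e lebesgue_measure_itv /= lte_fin.
by case: ltP => [_|r0']; [rewrite sube0|congr _%:E; apply/eqP; rewrite eq_le r0 r0'].
Qed.

Section Level.
Variables (R : realType) (K : nat) (r : nat -> R).
Hypothesis r_mono : forall i j, (i <= j)%N -> (j < K)%N -> r i <= r j.

Definition level (t : R) : 'I_K.+1 := inord (\sum_(i < K) (r i <= t)%R).

Lemma level_le t i : (i < K)%N -> (level t <= i)%N = (t < r i).
Proof.
move=> iK; have sumlt k : (k <= K)%N -> (\sum_(i' < K) (i' < k) = k)%N.
  by move=> kK; rewrite -big_mkcond (big_ord_narrow kK) sum1_card card_ord.
have -> : level t = (\sum_(i < K) (r i <= t)%R)%N :> nat.
  rewrite inordK// ltnS -[X in (_ <= X)%N](card_ord K) -sum1_card.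
  by apply: leq_sum => j _; exact: leq_b1.
have [ti|ti] := ltP t (r i).
  rewrite -[X in (_ <= X)%N](sumlt _ (ltnW iK)); apply: leq_sum => j _.
  case: (ltnP j i) => ji; first exact: leq_b1.
  by rewrite leNgt (lt_le_trans ti)// r_mono.
apply/negbTE; rewrite -ltnNge -[X in (X <= _)%N](sumlt _ iK); apply: leq_sum => j _.
by case: (ltnP j i.+1) => // ji; rewrite (le_trans _ ti)// r_mono.
Qed.

Lemma measurable_level_le i : measurable [set t | (level t <= i)%N].
Proof.
have [iK|Ki] := ltnP i K.
  have -> : [set t | (level t <= i)%N] = `]-oo, r i[.
    by apply/seteqP; split => t; rewrite /= in_itv /= level_le.
  exact: measurable_itv.
have -> : [set t | (level t <= i)%N] = setT.
  by apply/seteqP; split => // t _ /=; apply: leq_trans Ki; rewrite -ltnS ltn_ord.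
exact: measurableT.
Qed.

Lemma measurable_level (l : 'I_K.+1) : measurable [set t | level t = l].
Proof.
case: l => -[|i] il.
  have -> : [set t | level t = Ordinal il] = [set t | (level t <= 0)%N].
    by apply/seteqP; split => t /=; [move=> ->|rewrite leqn0 => /eqP e; exact: val_inj].
  exact: measurable_level_le.
have -> : [set t | level t = Ordinal il] = [set t | (level t <= i.+1)%N] `\` [set t | (level t <= i)%N].
  apply/seteqP; split => t /=; first by move=> -> /=; split => //; rewrite ltnn.
  by move=> [h1 /negP]; rewrite -ltnNge => h2; apply: val_inj; apply/eqP; rewrite eqn_leq h1.
by apply: measurableD; exact: measurable_level_le.
Qed.

Definition level_weight (l : 'I_K.+1) : R := fine (uniform_prob (@ltr01 R) [set t | level t = l]).

Lemma level_weight_ge0 l : 0 <= level_weight l.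
Proof. exact: fine_ge0. Qed.

Lemma level_weight_sum : \sum_l level_weight l = 1.
Proof.
rewrite /level_weight (@sum_fibre_measure _ _ R (uniform_prob (@ltr01 R)) _ level predT measurable_level).
rewrite (_ : [set t | _] = setT); last by apply/seteqP.
by rewrite (@probability_setT _ _ _ (uniform_prob (@ltr01 R))).
Qed.

Lemma level_weight_le i : (i < K)%N -> 0 <= r i <= 1 ->
  \sum_(l < K.+1 | (l <= i)%N) level_weight l = r i.
Proof.
move=> iK r01; rewrite /level_weight (@sum_fibre_measure _ _ R (uniform_prob (@ltr01 R)) _ level
  (fun l : 'I_K.+1 => (l <= i)%N) measurable_level).
have -> : [set t | (level t <= i)%N] = `]-oo, r i[.
  by apply/seteqP; split => t; rewrite /= in_itv /= level_le.
exact: (congr1 fine (uniform_prob_lt r01)).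
Qed.

Context d (Omega : measurableType d) (P : probability Omega R) (V : finType).
Variable T : V -> {RV P >-> R}.
Hypothesis T_uniform : forall v (B : set R), measurable B ->
  distribution P (T v) B = uniform_prob (@ltr01 R) B.
Hypothesis T_indep : mutually_independent P T.

Definition levels (w : Omega) : {ffun V -> 'I_K.+1} := [ffun v => level (T v w)].

Lemma levelsE (c : {ffun V -> 'I_K.+1}) : [set w | levels w = c] =
  \bigcap_(v in [set` (finset.setT : {set V})]) (T v @^-1` [set t | level t = c v]).
Proof.
apply/seteqP; split => [w /= <- v _|w h]; first by rewrite /= ffunE.
by apply/ffunP => v; rewrite ffunE; apply: h; rewrite /= inE.
Qed.

Lemma measurable_preimage_RV (v : V) (B : set R) : measurable B -> measurable (T v @^-1` B).
Proof. by move=> mB; rewrite -[X in measurable X]setTI; exact: measurable_funP. Qed.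

Lemma measurable_levels (c : {ffun V -> 'I_K.+1}) : measurable [set w | levels w = c].
Proof.
rewrite levelsE; apply: fin_bigcap_measurable => // v _.
by apply: measurable_preimage_RV; exact: measurable_level.
Qed.

(** The link with the product model: the positions of the times are independent with law
    [level_weight]. *)
Lemma levels_law (f : pred {ffun V -> 'I_K.+1}) :
  fine (P [set w | f (levels w)]) = Ex level_weight (fun c => (f c)%:R).
Proof.
rewrite -(sum_fibre_measure _ f measurable_levels) /Ex big_mkcond; apply: eq_bigr => c _.
case: ifP => _; last by rewrite mulr0.
rewrite mulr1 levelsE T_indep; last by move=> v; exact: measurable_level.
rewrite (eq_bigl predT); last by move=> v; rewrite inE.
have E v : P (T v @^-1` [set t | level t = c v]) = uniform_prob (@ltr01 R) [set t | level t = c v].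
  by rewrite -(T_uniform v)//; exact: measurable_level.
rewrite fine_prod; first by apply: eq_bigr => v _; rewrite E.
by move=> v; rewrite E fin_num_measure//; exact: measurable_level.
Qed.

(** The law bounds the times only almost surely, while comparing dth powers requires tau >= 0; this
    is why [count_event_cell] compares events up to a null set. *)
Lemma ae_nonneg : {ae P, forall w, forall v, 0 <= T v w}.
Proof.
have mB : measurable (`]-oo, 0[ : set R) by exact: measurable_itv.
apply: filter_forall => v; exists (T v @^-1` `]-oo, 0[).
split; first exact: measurable_preimage_RV.
- have := T_uniform v mB; rewrite /distribution /pushforward => ->.
  by apply: uniform_prob_lt; rewrite lexx ler01.
- by move=> w /= /negP; rewrite -ltNge in_itv.
Qed.

End Level.

Lemma measure_ae_iff (R : realType) dO (Omega : measurableType dO) (mu : {measure set Omega -> \bar R})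
    (A B : set Omega) : measurable A -> measurable B ->
  {ae mu, forall w, A w <-> B w} -> mu A = mu B.
Proof.
move=> mA mB [N [mN N0 hN]]; rewrite -(measureU0 mA mN N0) -(measureU0 mB mN N0).
congr (mu _); apply/seteqP; split=> w; rewrite /setU /=;
  have [Nw|nN] := pselect (N w); try by right.
all: have [h1 h2] : A w <-> B w by apply: contrapT => h; exact/nN/hN.
all: by case; [left; auto|right].
Qed.

Section Threshold.
Variables (R : realType) (G : finZmodType) (d : nat).
Hypothesis d0 : (0 < d)%N.
Implicit Types (t : invQ G -> R) (xi : invQ G).

Lemma cov_set0 (x : G) : x != 0 -> ~~ cov d finset.set0 x.
Proof.
apply: contra => /existsP[q /andP[/eqP <- /fintype.subsetP h]].
apply/eqP; rewrite big_seq big1// => a aq; apply/eqP; apply/negPn/negP => a0.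
have [xi xiE] := invQ_class a0; suff /h : xi \in cl (mem q) by rewrite inE.
by apply/clP; exists a => //; rewrite xiE !inE eqxx.
Qed.

Lemma tau_ge0 t xi : (forall eta, 0 <= t eta) -> 0 <= tau d t xi.
Proof.
move=> t0; rewrite leNgt; apply/negP => /(tau_lt_cov t _ d0 (class_repr_neq0 xi)).
rewrite (_ : finset _ = finset.set0); first by apply/negP; exact: cov_set0 (class_repr_neq0 xi).
by apply/setP => eta; rewrite !inE ltNge t0.
Qed.

Lemma Zcov_lt t xi z : (forall eta, 0 <= t eta) -> thr d z #|G| ^+ d = rho d z #|G| ->
  (Zcov d t xi < z) = cov d [set eta : invQ G | t eta < thr d z #|G|]%SET (class_repr xi).
Proof.
move=> t0 thrE.
have N0 : 0 < #|G|%:R ^+ d.-1 / d`!%:R :> R.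
  rewrite divr_gt0 ?exprn_gt0 ?ltr0n ?fact_gt0//; apply/card_gt0P; by exists 0.
have -> : (Zcov d t xi < z) = (tau d t xi < thr d z #|G|).
  rewrite -[RHS](ltr_pXn2r d0) ?nnegrE ?thr_ge0 ?tau_ge0// thrE /Zcov ltrBlDr mulrC -ltr_pdivlMr//.
  by rewrite /rho /alpha /nclass invf_div mulrA.
by apply/idP/idP => /(tau_lt_cov t _ d0 (class_repr_neq0 xi)).
Qed.

End Threshold.

Lemma point_sum_count (R : realType) (I : finType) (z : I -> R) m j :
  count_of (point_sum z) m j = #|[set i : I | `[< gcell m j (z i) >]]%SET|.
Proof.
have := count_ofE (point_sum z) m j; rewrite /= /dirac_sum.
under eq_bigr do rewrite diracE.
rewrite sumEFin => -[] /eqP; rewrite -natr_sum eqr_nat => /eqP <-.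
rewrite -sum1_card [RHS]big_mkcond; apply: eq_bigr => i _; rewrite inE.
by case: asboolP => h; [rewrite mem_set|rewrite memNset].
Qed.

Section TruncatedThreshold.
Variables (R : realType) (d K : nat) (z : nat -> R).
Hypothesis z_mono : forall i j, (i <= j)%N -> z i <= z j.

(* [thr] is monotone in the level only where [rho] is nonnegative. *)
Definition trunc_thr (m i : nat) : R :=
  if 0 <= alpha (z 0%N) m then thr d (z i) m else 0.

Lemma trunc_thr_mono m i j : (i <= j)%N -> trunc_thr m i <= trunc_thr m j.
Proof.
move=> ij; rewrite /trunc_thr; case: ifP => // a0.
have ai k : 0 <= alpha (z k) m by apply: le_trans a0 _; rewrite lerD2r z_mono.
have ri k : 0 <= rho d (z k) m by rewrite divr_ge0 ?exprn_ge0 ?mulr_ge0.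
rewrite /thr ge0_ler_powR ?nnegrE ?invr_ge0// /rho ler_wpM2r ?invr_ge0 ?exprn_ge0//.
by rewrite ler_wpM2r// lerD2r z_mono.
Qed.

End TruncatedThreshold.

Section CoverageCounts.
Context (R : realType) (G : finZmodType) (d m : nat) dO (Omega : measurableType dO).
Context (P : probability Omega R) (T : invQ G -> {RV P >-> R}).
Hypothesis d0 : (0 < d)%N.
Hypothesis T_uniform : forall xi (B : set R), measurable B ->
  distribution P (T xi) B = uniform_prob (@ltr01 R) B.
Hypothesis T_indep : mutually_independent P T.
Local Notation K := (gsize m).+1.
Local Notation z := (gpt R m).
Local Notation r := (trunc_thr d z #|G|).
Hypothesis alpha_ge0 : 0 <= alpha (z 0%N) #|G|.
Hypothesis thrE : forall i, (i < K)%N -> thr d (z i) #|G| ^+ d = rho d (z i) #|G|.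
Local Notation X w := (point_sum (Zcov d (fun xi => T xi w))).

Let r_mono i j : (i <= j)%N -> (j < K)%N -> r i <= r j.
Proof. by move=> ij _; apply: trunc_thr_mono ij => i' j'; exact: gpt_le. Qed.

Lemma Zcov_uncov w xi i : (forall eta, 0 <= T eta w) -> (i < K)%N ->
  uncov d i (levels K r T w) xi = (z i <= Zcov d (fun xi => T xi w) xi).
Proof.
move=> T0 iK; rewrite leNgt Zcov_lt ?thrE// /uncov; congr (~~ cov _ _ _).
by apply/setP => eta; rewrite !inE ffunE (level_le r_mono)// /trunc_thr alpha_ge0.
Qed.

Lemma count_of_cell w (j : 'I_(gsize m)) : (forall eta, 0 <= T eta w) ->
  count_of (X w) m j = #|cell d (levels K r T w) j|.
Proof.
move=> T0; rewrite point_sum_count; apply: eq_card => xi; rewrite !inE.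
have jK : (j.+1 < K)%N by rewrite ltnS.
rewrite (Zcov_uncov _ T0 (ltnW jK)) (Zcov_uncov _ T0 jK) -ltNge.
by apply/asboolP/idP; rewrite /gcell /= in_itv.
Qed.

Lemma count_event_cell (c : nat -> nat) :
  fine (P (count_event (fun w => X w) m c)) =
  Ex (level_weight r : 'I_K.+1 -> R)
    (fun w : {ffun invQ G -> 'I_K.+1} => [forall j : 'I_(gsize m), #|cell d w j| == c j]%:R).
Proof.
rewrite -(levels_law r_mono T_uniform T_indep
  (fun w => [forall j : 'I_(gsize m), #|cell d w j| == c j])).
congr fine; apply: measure_ae_iff.
- apply: measurable_count_event; exact: coverage_point_process.
- have -> : [set w | [forall j : 'I_(gsize m), #|cell d (levels K r T w) j| == c j]] =
    \bigcup_(v in [set v : {ffun invQ G -> 'I_K.+1} | [forall j : 'I_(gsize m), #|cell d v j| == c j]])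
      [set w | levels K r T w = v].
    by apply/seteqP; split => [w h|w [v h /= ->]//]; exists (levels K r T w).
  apply: fin_bigcup_measurable => [|v _]; [exact: finite_finset|exact: (measurable_levels r_mono)].
- apply: filterS (ae_nonneg T_uniform) => w T0; split.
    by move=> h; apply/forallP => j; rewrite -(count_of_cell _ T0) h.
  by move=> /forallP h j jq; rewrite -(eqP (h (Ordinal jq))) -(count_of_cell _ T0).
Qed.

End CoverageCounts.

Unset Implicit Arguments.

Theorem theorem1p1 (R : realType) (d : nat) (hd : (2 <= d)%N)
    (G : nat -> finZmodType)
    (G_odd : forall n, odd #|G n|)
    (G_infty : #|G n| @[n --> \oo] --> \oo)
    (dO : nat -> measure_display)
    (Omega : forall n, measurableType (dO n))
    (P : forall n, probability (Omega n) R)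
    (T : forall n, invQ (G n) -> {RV (P n) >-> R})
    (T_uniform : forall n (xi : invQ (G n)) (B : set R), measurable B ->
      distribution (P n) (T n xi) B = uniform_prob (@ltr01 R) B)
    (T_indep : forall n, mutually_independent (P n) (T n))
    (dO' : measure_display) (Omega' : measurableType dO')
    (P' : probability Omega' R)
    (Xi : Omega' -> point_measure R)
    (Xi_poisson : is_poisson_process P' (@exp_intensity R) Xi) :
  cvg_in_distribution P
    (fun n (w : Omega n) => point_sum (Zcov d (fun xi => T n xi w)))
    P' Xi.
Proof.
have d0 : (0 < d)%N by exact: ltnW.
apply: cvg_in_distribution_of_counts.
- by move=> n; exact: coverage_point_process.
- by case: Xi_poisson.
move=> m c; rewrite (poisson_count_event Xi_poisson).
pose K := (gsize m).+1; pose z := gpt R m.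
pose r n := trunc_thr d z #|G n|.
have z_mono i j : (i <= j)%N -> z i <= z j by exact: gpt_le.
have r_mono n i j : (i <= j)%N -> (j < K)%N -> r n i <= r n j.
  by move=> ij _; exact: trunc_thr_mono.
(* The truncation disappears for large n. It was made to have monotone thresholds for every n, so
   that [level_weight] always has total mass 1. *)
have rE : \forall n \near \oo, forall i, r n i = thr d (z i) #|G n|.
  by apply: filterS (near_alpha (z 0%N) G_infty 0) => n a0 i; rewrite /r /trunc_thr a0.
have r_le1 : \forall n \near \oo, forall i : 'I_K, thr d (z i) #|G n| <= 1.
  by apply: filter_forall => i; exact: near_thr_le1.
have thrE : \forall n \near \oo, forall i : 'I_K, thr d (z i) #|G n| ^+ d = rho d (z i) #|G n|.
  by apply: filter_forall => i; exact: near_thr_expr.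
have p_r : \forall n \near \oo, forall i, (i < K)%N ->
    \sum_(l < K.+1 | (l <= i)%N) level_weight (r n) l = thr d (z i) #|G n|.
  near=> n => i iK; have e : forall i, r n i = thr d (z i) #|G n| by near: n.
  have le1 : forall i : 'I_K, thr d (z i) #|G n| <= 1 by near: n.
  by rewrite (level_weight_le (r_mono n))// e// thr_ge0 (le1 (Ordinal iK)).
have h := cell_pmf_cvg G_odd hd G_infty (fun n l => level_weight_ge0 (r n) l)
  (fun n => level_weight_sum (r_mono n)) p_r (c := fun j => c j).
apply: cvg_trans h; apply: near_eq_cvg; near=> n.
have a0 : 0 <= alpha (z 0%N) #|G n| by near: n; exact: near_alpha.
have tE : forall i : 'I_K, thr d (z i) #|G n| ^+ d = rho d (z i) #|G n| by near: n.
rewrite (count_event_cell d0 (T_uniform n) (T_indep n) a0)// => i iK.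
exact: (tE (Ordinal iK)).
Unshelve. all: by end_near.
Qed.
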